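(* Let $0<|q|<1$ and $a,b,c,d,e,f\in\mathbb C^\ast$ such that $|q^2a^2|<|cdef|$, $|qb|<|f|$, and none of the denominator factors vanish. Then $${}_8\Psi_8\left(a;b,c,d,e,f,\tfrac ab;q,\tfrac{q^2a^2}{cdef}\right)$$ $$=\frac{(qa,\frac qa,\frac ba,\frac{qb}{f},\frac{qa}{cd},\frac{qa}{ce},\frac{qa}{de},\frac{bcd}{a},\frac{bce}{a},\frac{bde}{a},\frac{q^2a}{cde},\frac{q^2a^2}{bcdef};q)_\infty}{(\frac qf,\frac{qb}{a},\frac{qa}{c},\frac{qa}{d},\frac{qa}{e},\frac{bc}{a},\frac{bd}{a},\frac{be}{a},\frac{qa}{cde},\frac{bcde}{a},\frac{q^2a}{bcde},\frac{q^2a^2}{cdef};q)_\infty}\;{}_8\Psi_8\left(\tfrac{bcde}{qa};b,c,d,e,\tfrac{bcdef}{qa^2},\tfrac{cde}{qa};q,\tfrac{qb}{f}\right)$$ $$+\frac{(q,q,qa,\frac qa,c,d,e,\frac{qb}{c},\frac{qb}{d},\frac{qb}{e},\frac{qb}{f},\frac{qa}{bf};q)_\infty\;\vartheta(\frac{bcde}{qa^2};q)}{(qb,\frac qb,\frac qf,\frac{qb}{a},\frac{qa}{b},\frac{qa}{c},\frac{qa}{d},\frac{qa}{e},\frac{qa}{f},\frac{bc}{a},\frac{bd}{a},\frac{be}{a};q)_\infty\;\vartheta(\frac{cde}{qa};q)}.$$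
   Context: $\mathbb C^\ast=\mathbb C\setminus\{0\}$. $(x;q)_\infty=\prod_{n\ge0}(1-xq^n)$, $(x;q)_k=(x;q)_\infty/(xq^k;q)_\infty$ for $k\in\mathbb Z$, $(x_1,\dots,x_m;q)_k=\prod_i(x_i;q)_k$ for $k\in\mathbb Z\cup\{\infty\}$; $\vartheta(z;q)=(z,q/z;q)_\infty$. Very-well-poised bilateral series: $${}_8\Psi_8(a;a_3,\dots,a_8;q,z)=\sum_{k=-\infty}^\infty\frac{1-aq^{2k}}{1-a}\prod_{j=3}^8\frac{(a_j;q)_k}{(qa/a_j;q)_k}\,z^k .$$ *)

(* Defs.v *)
From Stdlib Require Import Reals ZArith List Lra Lia.
From Coquelicot Require Import Coquelicot.
Import ListNotations.

Open Scope C_scope.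

Fixpoint qpochn (x q : C) (n : nat) : C :=
  match n with
  | O => 1
  | S m => qpochn x q m * (1 - x * q ^ m)
  end.

(* Like [RInt], the total operators below are defined with [iota], so they are
   meaningful only when the limit exists; [qpochinf_correct] shows that it does
   for every infinite product with 0 < |q| < 1. *)
Definition qpochinf (x q : C) : C :=
  iota (fun l : C_CompleteNormedModule =>
          filterlim (qpochn x q) eventually (locally l)).

Definition Cpowz (z : C) (k : Z) : C :=
  match k with
  | Z0 => 1
  | Zpos p => z ^ Pos.to_nat p
  | Zneg p => / z ^ Pos.to_nat p
  end.

(* (x;q)_k for k in Z.  This is (x;q)_oo / (x q^k;q)_oo whenever the latter
   denominator is nonzero (see [qpoch_quotient]), and also has the usual
   finite-product value when that quotient reads 0/0, that is, when
   x = q^(-n) with 0 <= n < k. *)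
Definition qpoch (x q : C) (k : Z) : C :=
  match k with
  | Z0 => 1
  | Zpos p => qpochn x q (Pos.to_nat p)
  | Zneg p => / qpochn (x / q ^ Pos.to_nat p) q (Pos.to_nat p)
  end.

Definition Cprod (l : list C) : C := fold_right Cmult 1 l.

Definition qpochsinf (l : list C) (q : C) : C :=
  Cprod (map (fun x => qpochinf x q) l).

Definition theta (z q : C) : C := qpochsinf [z; q / z] q.

Definition CSeries (u : nat -> C) : C :=
  iota (fun l : C_CompleteNormedModule =>
          is_series (V := C_NormedModule) u l).

Definition ex_bilateral (t : Z -> C) : Prop :=
  ex_series (V := C_NormedModule) (fun n => t (Z.of_nat n)) /\
  ex_series (V := C_NormedModule) (fun n => t (- Z.of_nat (S n))%Z).

Definition bilateral (t : Z -> C) : C :=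
  CSeries (fun n => t (Z.of_nat n)) +
  CSeries (fun n => t (- Z.of_nat (S n))%Z).

(* In a factor (x;q)_k / (q a / x;q)_k with k < 0 the convention / 0 = 0 gives
   the right value 0 when (q a / x;q)_k has a pole. *)
Definition Psi8_term (a a3 a4 a5 a6 a7 a8 q z : C) (k : Z) : C :=
  (1 - a * Cpowz q (2 * k)) / (1 - a) *
  Cprod (map (fun x => qpoch x q k / qpoch (q * a / x) q k)
             [a3; a4; a5; a6; a7; a8]) *
  Cpowz z k.

Definition ex_Psi8 (a a3 a4 a5 a6 a7 a8 q z : C) : Prop :=
  ex_bilateral (Psi8_term a a3 a4 a5 a6 a7 a8 q z).

Definition Psi8 (a a3 a4 a5 a6 a7 a8 q z : C) : C :=
  bilateral (Psi8_term a a3 a4 a5 a6 a7 a8 q z).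

(* No denominator in a term of the series vanishes: (q a / x;q)_n is the
   denominator for k = n, and since (x;q)_(-n) = 1 / (x q^(-n);q)_n, the
   denominator for k = -n is (x q^(-n);q)_n. *)
Definition Psi8_nondegenerate (a a3 a4 a5 a6 a7 a8 q : C) : Prop :=
  1 - a <> 0 /\
  forall x, In x [a3; a4; a5; a6; a7; a8] -> forall n : nat,
    qpochn (q * a / x) q n <> 0 /\ qpochn (x / q ^ n) q n <> 0.

Lemma Cmod_Cpow (q : C) (n : nat) : Cmod (q ^ n) = (Cmod q ^ n)%R.
Proof.
induction n as [|n IH]; simpl.
- apply Cmod_1.
- now rewrite Cmod_mult, IH.
Qed.

Lemma Cpow_nz (q : C) (n : nat) : q <> 0 -> q ^ n <> 0.
Proof.
intros hq; apply Cmod_gt_0; rewrite Cmod_Cpow.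
now apply pow_lt, Cmod_gt_0.
Qed.

Lemma qpochn_bound (x q : C) : (Cmod q < 1)%R ->
  forall n, (Cmod (qpochn x q n) <= exp (Cmod x / (1 - Cmod q)))%R.
Proof.
intros hq n.
pose proof (Cmod_ge_0 q) as q0; pose proof (Cmod_ge_0 x) as x0.
assert (H : (Cmod (qpochn x q n)
             <= exp (Cmod x * ((1 - Cmod q ^ n) / (1 - Cmod q))))%R).
{ induction n as [|n IH].
  - simpl; rewrite Cmod_1.
    replace (Cmod x * ((1 - 1) / (1 - Cmod q)))%R with 0%R by (field; lra).
    rewrite exp_0; lra.
  - change (qpochn x q (S n)) with (qpochn x q n * (1 - x * q ^ n)).
    rewrite Cmod_mult.
    replace (Cmod x * ((1 - Cmod q ^ S n) / (1 - Cmod q)))%R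
      with (Cmod x * ((1 - Cmod q ^ n) / (1 - Cmod q)) + Cmod x * Cmod q ^ n)%R
      by (simpl; field; lra).
    rewrite exp_plus.
    apply Rmult_le_compat; try apply Cmod_ge_0; trivial.
    apply Rle_trans with (1 + Cmod x * Cmod q ^ n)%R.
    + eapply Rle_trans; [apply Cmod_triangle|].
      rewrite Cmod_1, Cmod_opp, Cmod_mult, Cmod_Cpow; lra.
    + apply exp_ineq1_le. }
eapply Rle_trans; [exact H|].
assert (Hexp : forall r s : R, (r <= s)%R -> (exp r <= exp s)%R).
{ intros r s [h|h]; [left; now apply exp_increasing | right; now rewrite h]. }
apply Hexp; unfold Rdiv; apply Rmult_le_compat_l; trivial.
rewrite <- (Rmult_1_l (/ (1 - Cmod q))) at 2.
apply Rmult_le_compat_r.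
- left; apply Rinv_0_lt_compat; lra.
- pose proof (pow_le _ n q0); lra.
Qed.

Lemma qpochn_cvg (x q : C) : (Cmod q < 1)%R ->
  exists l : C_NormedModule, filterlim (qpochn x q) eventually (locally l).
Proof.
intros hq.
pose proof (Cmod_ge_0 q) as q0.
set (M := exp (Cmod x / (1 - Cmod q))).
set (u := fun n => - (qpochn x q n * (x * q ^ n)) : C_CompleteNormedModule).
assert (Hu : ex_series u).
{ apply ex_series_le with (fun n => (M * Cmod x) * Cmod q ^ n)%R.
  - intros n; change (norm (u n)) with (Cmod (u n)); unfold u.
    rewrite Cmod_opp, !Cmod_mult, Cmod_Cpow, <- Rmult_assoc.
    apply Rmult_le_compat_r; [now apply pow_le|].
    apply Rmult_le_compat_r; [apply Cmod_ge_0|].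
    now apply qpochn_bound.
  - apply (ex_series_scal_l (V := R_NormedModule) (M * Cmod x)%R (pow (Cmod q))).
    apply ex_series_geom; rewrite Rabs_pos_eq; trivial. }
destruct Hu as [l Hl].
assert (Hs : forall n, qpochn x q (S n) = 1 + sum_n u n).
{ intros n; induction n as [|n IH].
  - rewrite sum_O; unfold u; simpl; ring.
  - rewrite sum_Sn.
    change (qpochn x q (S (S n)))
      with (qpochn x q (S n) * (1 - x * q ^ S n)).
    change (plus (sum_n u n) (u (S n))) with (sum_n u n + u (S n)).
    rewrite Cplus_assoc, <- IH; unfold u; ring. }
exists (plus (RtoC 1 : C_NormedModule) l).
assert (Hf : filterlim (fun n => qpochn x q (S n)) eventually
               (locally (plus (RtoC 1 : C_NormedModule) l))).
{ apply filterlim_ext with (fun n => plus (RtoC 1 : C_NormedModule) (sum_n u n)).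
  - intros n; now rewrite Hs.
  - eapply filterlim_comp_2; [apply filterlim_const | exact Hl |].
    apply (filterlim_plus (RtoC 1 : C_NormedModule) l). }
intros P HP; destruct (Hf P HP) as [N HN].
exists (S N); intros [|n] Hn; [lia|apply HN; lia].
Qed.

Lemma qpochinf_correct (x q : C) : (Cmod q < 1)%R ->
  filterlim (qpochn x q) eventually
    (locally (qpochinf x q : C_NormedModule)).
Proof.
intros hq; destruct (qpochn_cvg x q hq) as [l Hl].
enough (E : qpochinf x q = l) by now rewrite E.
exact (iota_filterlim_locally (V := C_CompleteNormedModule) (F := eventually)
         (qpochn x q) l Hl).
Qed.

Lemma qpochn_add (x q : C) (n m : nat) :
  qpochn x q (n + m) = qpochn x q n * qpochn (x * q ^ n) q m.
Proof.
induction m as [|m IH].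
- rewrite Nat.add_0_r; simpl; ring.
- rewrite Nat.add_succ_r; simpl.
  rewrite IH, Cpow_add_r; ring.
Qed.

Lemma qpochinf_shift (x q : C) (n : nat) : (Cmod q < 1)%R ->
  qpochinf x q = qpochn x q n * qpochinf (x * q ^ n) q.
Proof.
intros hq.
apply (filterlim_locally_unique (V := C_NormedModule) (F := eventually)
         (fun m => qpochn x q (n + m))).
- intros P HP; destruct (qpochinf_correct x q hq P HP) as [N HN].
  exists N; intros m Hm; apply HN; lia.
- apply filterlim_ext with
    (fun m => scal (qpochn x q n) (qpochn (x * q ^ n) q m : C_NormedModule)).
  + intros m; now rewrite qpochn_add.
  + eapply filterlim_comp; [now apply qpochinf_correct|].
    apply (filterlim_scal_r (qpochn x q n)
             (qpochinf (x * q ^ n) q : C_NormedModule)).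
Qed.

Lemma qpoch_quotient (x q : C) (k : Z) : (0 < Cmod q < 1)%R ->
  qpochinf (x * Cpowz q k) q <> 0 ->
  qpoch x q k = qpochinf x q / qpochinf (x * Cpowz q k) q.
Proof.
intros [hq0 hq] H.
assert (nq : q <> 0) by now apply Cmod_gt_0.
destruct k as [|p|p]; simpl in *.
- rewrite Cmult_1_r in *; now field.
- rewrite (qpochinf_shift x q (Pos.to_nat p) hq); now field.
- set (n := Pos.to_nat p) in *.
  pose proof (Cpow_nz q n nq) as nqn.
  assert (E : qpochinf (x * / q ^ n) q
              = qpochn (x / q ^ n) q n * qpochinf x q).
  { rewrite (qpochinf_shift _ q n hq); unfold Cdiv; do 2 f_equal.
    now field. }
  rewrite E in H |- *.
  assert (qpochn (x / q ^ n) q n <> 0)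
    by (intros Z; apply H; rewrite Z; ring).
  assert (qpochinf x q <> 0) by (intros Z; apply H; rewrite Z; ring).
  now field.
Qed.

(* Main.v *)
(* With X = 1/x, the ratio (x;q)_k / (qa/x;q)_k is, up to a power of -x and a
   factor independent of k, an entire function eps of X.  Products of values of
   eps satisfy q-difference equations in each X, and a solution that is
   continuous at X = 0 is determined by its value there.
   - For the 6psi6 the equation is homogeneous of first order, with a telescoping
     proof; putting X = 1/a and X = 1, where a single term survives, fixes the
     constant.  This is Bailey's sum.
   - An 8Psi8 with a pair of parameters b, a/b satisfies an inhomogeneous first
     order equation whose right-hand side is a 6psi6.  The two 8Psi8 of the
     theorem, with their prefactors, have equal right-hand sides in the variable
     1/f, so that their difference N is, up to explicit products, its value at
     f = oo.
   - This value satisfies a homogeneous equation under (c,d) -> (cq,d/q), which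
     allows c and 1/d to be made small; then at f = qa/c both series are 6psi6
     and N is a difference of two theta products, which Weierstrass' relation
     evaluates.  That relation comes from the 6psi6 with two pairs b, a/b and
     c, a/c by partial fractions. *)
Require Import Defs.
From Stdlib Require Import Reals List ZArith Lra Lia Permutation.
From Stdlib Require Import Classical FunctionalExtensionality.
From Coquelicot Require Import Coquelicot.
Import ListNotations.
Local Open Scope C_scope.

(** * Limits and bilateral series *)

(** Working with [eps] instead of quotients removes the denominators: the sums make sense for all
    small reciprocal parameters, 0 included, and the nonvanishing hypotheses of the theorem enter
    only in passing between q-shifted factorials and [eps] and in the last division. No analytic
    continuation is used: a solution of a q-difference equation is followed along X, Xq, Xq^2, ...
    to X = 0, which takes only dominated convergence, uniform for X in a polydisc. The inhomogeneous
    equation has this origin. The pair b, a/b contributes to the k-th term, up to a constant and a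
    geometric factor, 1/((1 - b u)(1 - a u/b)) with u = q^k. Shifting another parameter multiplies
    the term by (1 - y/u)(1 - a y u), which equals (1 - b y)(1 - a y/b) - (y/u)(1 - b u)(1 - a u/b);
    the last product cancels the pair and leaves a 6psi6. The obstacle is the value of N at f = oo,
    where the two series have no closed form. The choice f = qa/c cancels c from both, but the 6psi6
    that remain converge only for |qa/(de)| < 1 and |qa'/(de)| < 1, where a' = bcde/(qa). This is
    why d must first be made large. *)

Definition Climit (u : nat -> C) (l : C) : Prop :=
  is_lim_seq (fun n => Cmod (u n - l)) 0%R.

Lemma Climit_squeeze (u : nat -> C) (l : C) (w : nat -> R) :
  (forall n, (Cmod (u n - l) <= w n)%R) -> is_lim_seq w 0%R -> Climit u l.
Proof.
intros H Hw.
apply (is_lim_seq_le_le (fun _ => 0%R) _ w 0%R); trivial.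
- intros n; split; [apply Cmod_ge_0 | apply H].
- apply is_lim_seq_const.
Qed.

Lemma Climit_const (l : C) : Climit (fun _ => l) l.
Proof.
apply (Climit_squeeze _ _ (fun _ => 0%R)); [|apply is_lim_seq_const].
intros n; replace (l - l) with (RtoC 0) by ring; rewrite Cmod_0; lra.
Qed.

Lemma Climit_ext (u v : nat -> C) (l : C) :
  (forall n, u n = v n) -> Climit u l -> Climit v l.
Proof.
intros H; apply is_lim_seq_ext; intros n; now rewrite H.
Qed.

Lemma Climit_plus (u v : nat -> C) (l m : C) :
  Climit u l -> Climit v m -> Climit (fun n => u n + v n) (l + m).
Proof.
intros Hu Hv.
apply (Climit_squeeze _ _ (fun n => Cmod (u n - l) + Cmod (v n - m))%R).
- intros n; replace (u n + v n - (l + m)) with ((u n - l) + (v n - m)) by ring.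
  apply Cmod_triangle.
- replace 0%R with (0 + 0)%R by ring.
  now apply is_lim_seq_plus'.
Qed.

Lemma Climit_mult (u v : nat -> C) (l m : C) :
  Climit u l -> Climit v m -> Climit (fun n => u n * v n) (l * m).
Proof.
intros Hu Hv.
apply (Climit_squeeze _ _ (fun n => Cmod (u n - l) * Cmod (v n - m)
         + (Cmod l * Cmod (v n - m) + Cmod (u n - l) * Cmod m))%R).
- intros n; replace (u n * v n - l * m) with
    ((u n - l) * (v n - m) + (l * (v n - m) + (u n - l) * m)) by ring.
  eapply Rle_trans; [apply Cmod_triangle|]; rewrite Cmod_mult.
  apply Rplus_le_compat_l.
  eapply Rle_trans; [apply Cmod_triangle|]; rewrite !Cmod_mult; lra.
- replace 0%R with (0 * 0 + (Cmod l * 0 + 0 * Cmod m))%R by ring.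
  apply is_lim_seq_plus'; [|apply is_lim_seq_plus'];
    apply is_lim_seq_mult'; trivial; apply is_lim_seq_const.
Qed.

Lemma Climit_minus (u v : nat -> C) (l m : C) :
  Climit u l -> Climit v m -> Climit (fun n => u n - v n) (l - m).
Proof.
intros Hu Hv; replace (l - m) with (l + (-1) * m) by ring.
apply Climit_ext with (fun n => u n + (-1) * v n); [intros n; ring|].
apply Climit_plus; trivial; apply Climit_mult; trivial; apply Climit_const.
Qed.

Lemma Climit_incr (u : nat -> C) (l : C) :
  Climit u l -> Climit (fun n => u (S n)) l.
Proof. intros H; now apply (is_lim_seq_incr_1 (fun n => Cmod (u n - l))). Qed.

Lemma Climit_unique (u : nat -> C) (l m : C) :
  Climit u l -> Climit u m -> l = m.
Proof.
intros Hl Hm.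
pose proof (Climit_minus _ _ _ _ Hl Hm) as H.
apply (is_lim_seq_ext _ (fun _ => Cmod (l - m))) in H.
- assert (E : Cmod (l - m) = 0%R).
  { pose proof (is_lim_seq_unique _ _ H) as E.
    rewrite Lim_seq_const in E; now injection E. }
  apply Cmod_eq_0 in E.
  replace l with ((l - m) + m) by ring; rewrite E; ring.
- intros n; replace (u n - u n - (l - m)) with (- (l - m)) by ring.
  apply Cmod_opp.
Qed.

Lemma Climit_eventually (u : nat -> C) (l : C) (e : R) :
  Climit u l -> (0 < e)%R -> exists N, forall n, (N <= n)%nat ->
  (Cmod (u n - l) < e)%R.
Proof.
intros H he; apply is_lim_seq_spec in H.
destruct (H (mkposreal e he)) as [N HN]; exists N; intros n Hn.
specialize (HN n Hn); simpl in HN.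
rewrite Rminus_0_r, Rabs_pos_eq in HN; [trivial | apply Cmod_ge_0].
Qed.

Lemma Climit_filterlim (u : nat -> C) (l : C) :
  Climit u l <-> filterlim u eventually (locally (l : C_NormedModule)).
Proof.
split; intros H.
- apply (filterlim_locally_ball_norm (U := C_NormedModule)); intros e.
  destruct (Climit_eventually u l e H (cond_pos e)) as [N HN].
  exists N; intros n Hn; apply HN, Hn.
- apply is_lim_seq_spec; intros e.
  pose proof (proj1 (filterlim_locally_ball_norm (U := C_NormedModule) u l) H e)
    as [N HN].
  exists N; intros n Hn; rewrite Rminus_0_r, Rabs_pos_eq;
    [apply (HN n Hn) | apply Cmod_ge_0].
Qed.

Lemma Climit_Cmod_le (u : nat -> C) (l : C) (B : R) :
  Climit u l -> (forall n, (Cmod (u n) <= B)%R) -> (Cmod l <= B)%R.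
Proof.
intros H HB.
apply (is_lim_seq_le (fun _ => Cmod l) (fun n => B + Cmod (u n - l))%R
         (Cmod l) B).
- intros n; replace l with (u n + - (u n - l)) at 1 by ring.
  eapply Rle_trans; [apply Cmod_triangle|]; rewrite Cmod_opp.
  specialize (HB n); lra.
- apply is_lim_seq_const.
- replace (Finite B) with (Finite (B + 0)) by (f_equal; ring).
  apply is_lim_seq_plus'; trivial; apply is_lim_seq_const.
Qed.

Lemma Climit_pow (x q : C) : (Cmod q < 1)%R ->
  Climit (fun n => x * q ^ n) 0.
Proof.
intros hq.
apply (Climit_squeeze _ _ (fun n => Cmod x * Cmod q ^ n)%R).
- intros n; replace (x * q ^ n - 0) with (x * q ^ n) by ring.
  rewrite Cmod_mult, Cmod_Cpow; lra.
- replace 0%R with (Cmod x * 0)%R by ring.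
  apply is_lim_seq_mult'; [apply is_lim_seq_const|].
  apply is_lim_seq_geom; rewrite Rabs_pos_eq; trivial; apply Cmod_ge_0.
Qed.

(** Relational form of [bilateral]: it carries the convergence of both halves along with the value,
    which the [iota] inside [CSeries] does not. *)
Definition is_bilateral (t : Z -> C) (l : C) : Prop :=
  exists l1 l2 : C,
    is_series (V := C_NormedModule) (fun n => t (Z.of_nat n)) l1 /\
    is_series (V := C_NormedModule) (fun n => t (- Z.of_nat (S n))%Z) l2 /\
    l = l1 + l2.

Lemma CSeries_correct (u : nat -> C) (l : C) :
  is_series (V := C_NormedModule) u l -> CSeries u = l.
Proof.
intros H.
exact (iota_filterlim_locally (V := C_CompleteNormedModule) (F := eventually)
         (sum_n (G := C_NormedModule) u) l H).
Qed.

Lemma is_bilateral_unique (t : Z -> C) (l : C) :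
  is_bilateral t l -> bilateral t = l.
Proof.
intros (l1 & l2 & H1 & H2 & ->); unfold bilateral.
now rewrite (CSeries_correct _ _ H1), (CSeries_correct _ _ H2).
Qed.

Lemma is_bilateral_ext (t s : Z -> C) (l : C) :
  (forall k, t k = s k) -> is_bilateral t l -> is_bilateral s l.
Proof.
intros H (l1 & l2 & H1 & H2 & E); exists l1, l2; repeat split; trivial;
  (eapply is_series_ext; [|eassumption]); intros n; apply H.
Qed.

Lemma is_bilateral_lin (x y : C) (t s : Z -> C) (l m : C) :
  is_bilateral t l -> is_bilateral s m ->
  is_bilateral (fun k => x * t k + y * s k) (x * l + y * m).
Proof.
intros (l1 & l2 & H1 & H2 & ->) (m1 & m2 & H3 & H4 & ->).
exists (x * l1 + y * m1), (x * l2 + y * m2); repeat split.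
- apply (is_series_plus (V := C_NormedModule));
  apply (is_series_scal (V := C_NormedModule)); trivial.
- apply (is_series_plus (V := C_NormedModule));
  apply (is_series_scal (V := C_NormedModule)); trivial.
- ring.
Qed.

Lemma is_bilateral_scal (x : C) (t : Z -> C) (l : C) :
  is_bilateral t l -> is_bilateral (fun k => x * t k) (x * l).
Proof.
intros H; replace (x * l) with (x * l + 0 * l) by ring.
eapply is_bilateral_ext; [|apply (is_bilateral_lin x 0 t t); exact H].
intros k; simpl; ring.
Qed.

Lemma ex_bilateral_is (t : Z -> C) :
  ex_bilateral t -> is_bilateral t (bilateral t).
Proof.
intros [[l1 H1] [l2 H2]]; exists l1, l2; repeat split; trivial.
apply is_bilateral_unique; exists l1, l2; auto.
Qed.

Lemma is_bilateral_ex (t : Z -> C) (l : C) :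
  is_bilateral t l -> ex_bilateral t.
Proof. intros (l1 & l2 & H1 & H2 & _); split; eexists; eassumption. Qed.

(** One ratio serves both tails. For r < 1 this gives convergence, the vanishing at both ends that
    telescoping needs, and a majorant for termwise limits. *)
Definition dominated (M r : R) (t : Z -> C) : Prop :=
  forall n, (Cmod (t (Z.of_nat n)) <= M * r ^ n)%R /\
            (Cmod (t (- Z.of_nat n)%Z) <= M * r ^ n)%R.

Lemma ex_series_geom_bound (u : nat -> C) (M r : R) : (0 <= r < 1)%R ->
  (forall n, (Cmod (u n) <= M * r ^ n)%R) ->
  ex_series (V := C_NormedModule) u.
Proof.
intros hr H.
apply (ex_series_le (V := C_CompleteNormedModule) u (fun n => M * r ^ n)%R).
- exact H.
- apply (ex_series_scal_l (V := R_NormedModule) M (pow r)).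
  apply ex_series_geom; rewrite Rabs_pos_eq; lra.
Qed.

Lemma dominated_nonneg (M r : R) (t : Z -> C) : dominated M r t -> (0 <= M)%R.
Proof.
intros H; destruct (H 0%nat) as [H0 _]; simpl in H0.
pose proof (Cmod_ge_0 (t 0%Z)); lra.
Qed.

Lemma dominated_neg_S (M r : R) (t : Z -> C) : (0 <= r < 1)%R ->
  dominated M r t ->
  forall n, (Cmod (t (- Z.of_nat (S n))%Z) <= M * r ^ n)%R.
Proof.
intros hr H n; pose proof (dominated_nonneg _ _ _ H) as HM.
eapply Rle_trans; [apply H|]; simpl.
apply Rmult_le_compat_l; trivial.
rewrite <- (Rmult_1_l (r ^ n)) at 2; apply Rmult_le_compat_r; [apply pow_le|]; lra.
Qed.

Lemma dominated_bilateral (M r : R) (t : Z -> C) : (0 <= r < 1)%R ->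
  dominated M r t -> is_bilateral t (bilateral t).
Proof.
intros hr H; apply ex_bilateral_is; split.
- apply (ex_series_geom_bound _ M r hr); apply H.
- apply (ex_series_geom_bound _ M r hr); now apply dominated_neg_S.
Qed.

Lemma geom_lim0 (M r : R) : (0 <= r < 1)%R ->
  is_lim_seq (fun n => M * r ^ n)%R 0%R.
Proof.
intros hr; replace 0%R with (M * 0)%R by ring.
apply is_lim_seq_mult'; [apply is_lim_seq_const|].
apply is_lim_seq_geom; rewrite Rabs_pos_eq; lra.
Qed.

Lemma is_bilateral_telescope (M r : R) (h : Z -> C) : (0 <= r < 1)%R ->
  dominated M r h -> is_bilateral (fun k => h (k + 1)%Z - h k) 0.
Proof.
intros hr H; exists (- h 0%Z), (h 0%Z); repeat split; [| |ring].
- apply (Climit_filterlim (sum_n (G := C_NormedModule) _)).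
  apply Climit_ext with (fun n => h (Z.of_nat (S n)) - h 0%Z).
  + intros n; induction n as [|n IH]; [now rewrite sum_O|].
    rewrite sum_Sn, <- IH; change plus with Cplus.
    replace (Z.of_nat (S n) + 1)%Z with (Z.of_nat (S (S n))) by lia; ring.
  + replace (- h 0%Z) with (0 - h 0%Z) by ring.
    apply Climit_minus; [|apply Climit_const].
    apply (Climit_incr (fun n => h (Z.of_nat n))).
    apply (Climit_squeeze _ _ (fun n => M * r ^ n)%R); [|now apply geom_lim0].
    intros n; replace (h (Z.of_nat n) - 0) with (h (Z.of_nat n)) by ring.
    apply H.
- apply (Climit_filterlim (sum_n (G := C_NormedModule) _)).
  apply Climit_ext with (fun n => h 0%Z - h (- Z.of_nat (S n))%Z).
  + intros n; induction n as [|n IH]; [now rewrite sum_O|].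
    rewrite sum_Sn, <- IH; change plus with Cplus.
    replace (- Z.of_nat (S (S n)) + 1)%Z with (- Z.of_nat (S n))%Z by lia; ring.
  + enough (H' : Climit (fun n => h 0%Z - h (- Z.of_nat (S n))%Z) (h 0%Z - 0))
      by (replace (h 0%Z - 0) with (h 0%Z) in H' by ring; exact H').
    apply Climit_minus; [apply Climit_const|].
    apply (Climit_squeeze _ _ (fun n => M * r ^ n)%R); [|now apply geom_lim0].
    intros n; replace (h (- Z.of_nat (S n))%Z - 0)
      with (h (- Z.of_nat (S n))%Z) by ring.
    now apply dominated_neg_S.
Qed.

Lemma series_tail_bound (u : nat -> C) (l : C) (M r : R) (N : nat) :
  (0 <= r < 1)%R -> (forall n, (Cmod (u n) <= M * r ^ n)%R) ->
  is_series (V := C_NormedModule) u l ->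
  (Cmod l <= sum_n (fun n => Cmod (u n)) N + M * r ^ N / (1 - r))%R.
Proof.
intros hr Hu Hl.
assert (HM : (0 <= M)%R).
{ pose proof (Hu 0%nat) as H0; simpl in H0; pose proof (Cmod_ge_0 (u 0%nat)); lra. }
assert (pos : forall n, (0 <= M * r ^ n / (1 - r))%R).
{ intros n; apply Rmult_le_pos.
  - apply Rmult_le_pos; trivial; apply pow_le; lra.
  - left; apply Rinv_0_lt_compat; lra. }
assert (hs : forall n, (Cmod (sum_n u n) <= sum_n (fun n => Cmod (u n)) n)%R).
{ intros n; induction n as [|n IH].
  - rewrite !sum_O; lra.
  - rewrite !sum_Sn; eapply Rle_trans; [apply Cmod_triangle|].
    change (sum_n (fun m => Cmod (u m)) n + Cmod (u (S n)))%R with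
      (plus (sum_n (fun m => Cmod (u m)) n) (Cmod (u (S n)))).
    change plus with Rplus; lra. }
(* The true tail starts at [r ^ S N]; the bound with [r ^ N] is weaker by one power, and its form
   telescopes in m. *)
assert (hm : forall m, (sum_n (fun n => Cmod (u n)) (N + m)
   <= sum_n (fun n => Cmod (u n)) N + (M * r ^ N / (1 - r) - M * r ^ (N + m) / (1 - r)))%R).
{ intros m; induction m as [|m IH].
  - rewrite Nat.add_0_r; lra.
  - rewrite Nat.add_succ_r, sum_Sn; change plus with Rplus.
    pose proof (Hu (S (N + m))) as H1.
    assert (E : (M * r ^ (N + m) / (1 - r)
                 = M * r ^ (N + m) + M * r ^ S (N + m) / (1 - r))%R)
      by (simpl; field; lra).
    assert (M * r ^ S (N + m) <= M * r ^ (N + m))%R.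
    { apply Rmult_le_compat_l; trivial; simpl.
      rewrite <- (Rmult_1_l (r ^ (N + m))) at 2.
      apply Rmult_le_compat_r; [apply pow_le|]; lra. }
    lra. }
apply (Climit_Cmod_le (fun m => sum_n u (N + m))).
- apply Climit_filterlim; intros Q HQ; destruct (Hl Q HQ) as [n0 Hn0].
  exists n0; intros n Hn; apply Hn0; lia.
- intros m; eapply Rle_trans; [apply hs|].
  eapply Rle_trans; [apply hm|]; pose proof (pos (N + m)%nat); lra.
Qed.

Lemma sum_n_lim0 (u : nat -> nat -> R) (N : nat) :
  (forall n, is_lim_seq (fun j => u j n) 0%R) ->
  is_lim_seq (fun j => sum_n (u j) N) 0%R.
Proof.
intros H; induction N as [|N IH].
- apply is_lim_seq_ext with (fun j => u j 0%nat); [|apply H].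
  intros j; now rewrite sum_O.
- apply is_lim_seq_ext with (fun j => sum_n (u j) N + u j (S N))%R.
  + intros j; now rewrite sum_Sn.
  + replace 0%R with (0 + 0)%R by ring; now apply is_lim_seq_plus'.
Qed.

(** Tannery's theorem with limit 0: the geometric tail beyond N is small uniformly in j, and the
    finitely many terms up to N tend to 0. *)
Lemma series_lim0 (u : nat -> nat -> C) (l : nat -> C) (M r : R) :
  (0 <= r < 1)%R ->
  (forall j n, (Cmod (u j n) <= M * r ^ n)%R) ->
  (forall j, is_series (V := C_NormedModule) (u j) (l j)) ->
  (forall n, is_lim_seq (fun j => Cmod (u j n)) 0%R) ->
  Climit l 0.
Proof.
intros hr Hu Hl H; apply is_lim_seq_spec; intros e.
assert (He : (0 < e / 2)%R) by (pose proof (cond_pos e); lra).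
pose proof (geom_lim0 (M / (1 - r)) r hr) as Hg.
apply is_lim_seq_spec in Hg.
destruct (Hg (mkposreal _ He)) as [N HN].
specialize (HN N (le_n N)); simpl in HN.
pose proof (sum_n_lim0 (fun j n => Cmod (u j n)) N H) as Hs.
apply is_lim_seq_spec in Hs.
destruct (Hs (mkposreal _ He)) as [J HJ].
exists J; intros j Hj; specialize (HJ j Hj); simpl in HJ.
rewrite Rminus_0_r, Rabs_pos_eq by apply Cmod_ge_0.
replace (l j - 0) with (l j) by ring.
eapply Rle_lt_trans; [apply (series_tail_bound (u j) (l j) M r N); auto|].
rewrite Rminus_0_r in HN, HJ.
apply Rabs_def2 in HN; apply Rabs_def2 in HJ.
replace (M * r ^ N / (1 - r))%R with (M / (1 - r) * r ^ N)%R by (field; lra).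
lra.
Qed.

(** The limit s inherits the bound pointwise, so t_j - s is dominated with constant 2M, and
    [series_lim0] applies to each half. *)
Lemma bilateral_dominated_limit (t : nat -> Z -> C) (s : Z -> C) (M r : R) :
  (0 <= r < 1)%R -> (forall j, dominated M r (t j)) ->
  (forall k, Climit (fun j => t j k) (s k)) ->
  dominated M r s /\ Climit (fun j => bilateral (t j)) (bilateral s).
Proof.
intros hr Ht Hk.
assert (Hs : dominated M r s).
{ intros n; split; (eapply Climit_Cmod_le; [apply Hk|]); intros j; apply Ht. }
split; trivial.
pose proof (dominated_bilateral M r s hr Hs) as (s1 & s2 & S1 & S2 & ->).
assert (Hz : forall k, is_lim_seq (fun j => Cmod (1 * t j k + (-1) * s k)) 0%R).
{ intros k; eapply is_lim_seq_ext; [|apply (Hk k)].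
  intros j; simpl; f_equal; ring. }
assert (Hd : forall j k B, (Cmod (t j k) <= B)%R -> (Cmod (s k) <= B)%R ->
                (Cmod (1 * t j k + (-1) * s k) <= 2 * B)%R).
{ intros j k B h1 h2; eapply Rle_trans; [apply Cmod_triangle|].
  rewrite !Cmod_mult, Cmod_1, Cmod_R, Rabs_left by lra; lra. }
assert (E : forall j, exists l1 l2,
  is_series (V := C_NormedModule) (fun n => t j (Z.of_nat n)) l1 /\
  is_series (V := C_NormedModule) (fun n => t j (- Z.of_nat (S n))%Z) l2 /\
  bilateral (t j) = l1 + l2) by (intros j; exact (dominated_bilateral M r _ hr (Ht j))).
set (p1 := fun j => CSeries (fun n => t j (Z.of_nat n))).
set (p2 := fun j => CSeries (fun n => t j (- Z.of_nat (S n))%Z)).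
assert (L1 : Climit (fun j => 1 * p1 j + (-1) * s1) 0).
{ apply (series_lim0 (fun j n => 1 * t j (Z.of_nat n) + (-1) * s (Z.of_nat n)) _ (2 * M) r hr).
  - intros j n; rewrite Rmult_assoc; apply Hd; [apply Ht | apply Hs].
  - intros j; apply (is_series_plus (V := C_NormedModule));
      apply (is_series_scal (V := C_NormedModule)); trivial.
    destruct (E j) as (l1 & l2 & h1 & h2 & _); unfold p1.
    now rewrite (CSeries_correct _ _ h1).
  - intros n; apply Hz. }
assert (L2 : Climit (fun j => 1 * p2 j + (-1) * s2) 0).
{ apply (series_lim0 (fun j n => 1 * t j (- Z.of_nat (S n))%Z
            + (-1) * s (- Z.of_nat (S n))%Z) _ (2 * M) r hr).
  - intros j n; rewrite Rmult_assoc; apply Hd; apply (dominated_neg_S M r); auto.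
  - intros j; apply (is_series_plus (V := C_NormedModule));
      apply (is_series_scal (V := C_NormedModule)); trivial.
    destruct (E j) as (l1 & l2 & h1 & h2 & _); unfold p2.
    now rewrite (CSeries_correct _ _ h2).
  - intros n; apply Hz. }
replace (s1 + s2) with (0 + (s1 + (0 + s2))) by ring.
eapply Climit_ext; [|apply Climit_plus; [exact L1 |
   apply Climit_plus; [apply Climit_const | apply Climit_plus; [exact L2|apply Climit_const]]]].
intros j; unfold bilateral; fold (p1 j); fold (p2 j); simpl; ring.
Qed.

(** * Infinite products *)

Lemma exp_le (x y : R) : (x <= y)%R -> (exp x <= exp y)%R.
Proof. intros [h|h]; [left; now apply exp_increasing | right; now rewrite h]. Qed.

Lemma qpochinf_limit (x q : C) : (Cmod q < 1)%R ->
  Climit (qpochn x q) (qpochinf x q).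
Proof. intros hq; apply Climit_filterlim; now apply qpochinf_correct. Qed.

Lemma qpochinf_succ (x q : C) : (Cmod q < 1)%R ->
  qpochinf x q = (1 - x) * qpochinf (x * q) q.
Proof.
intros hq; rewrite (qpochinf_shift x q 1 hq); simpl.
rewrite !Cmult_1_r; ring.
Qed.

Lemma qpochinf_bound (x q : C) : (Cmod q < 1)%R ->
  (Cmod (qpochinf x q) <= exp (Cmod x / (1 - Cmod q)))%R.
Proof.
intros hq; apply (Climit_Cmod_le (qpochn x q)).
- now apply qpochinf_limit.
- now apply qpochn_bound.
Qed.

Lemma qpochinf_bound_le (x q : C) (r : R) : (Cmod q < 1)%R -> (Cmod x <= r)%R ->
  (Cmod (qpochinf x q) <= exp (r / (1 - Cmod q)))%R.
Proof.
intros hq hx; eapply Rle_trans; [now apply qpochinf_bound|].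
apply exp_le, Rmult_le_compat_r; trivial.
left; apply Rinv_0_lt_compat; lra.
Qed.

(** Continuity of (x;q)_oo in x comes from this estimate, whose constants stay bounded in n. With
    s_n = 1 + |q| + ... + |q|^(n-1), the factor exp(r s_n) closes the induction: |1 - x q^n| <=
    exp(r |q|^n) turns it into exp(r s_(n+1)). *)
Lemma qpochn_lipschitz (x y q : C) (r : R) (n : nat) : (Cmod q < 1)%R ->
  (Cmod x <= r)%R -> (Cmod y <= r)%R ->
  (Cmod (qpochn x q n - qpochn y q n) <=
   exp (r / (1 - Cmod q)) * Cmod (x - y) * ((1 - Cmod q ^ n) / (1 - Cmod q))
   * exp (r * ((1 - Cmod q ^ n) / (1 - Cmod q))))%R.
Proof.
intros hq hx hy.
pose proof (Cmod_ge_0 q) as q0; pose proof (Cmod_ge_0 x) as x0.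
assert (hr : (0 <= r)%R) by lra.
assert (K0 : (0 < exp (r / (1 - Cmod q)))%R) by apply exp_pos.
set (K := exp (r / (1 - Cmod q))) in *.
set (s := fun n => ((1 - Cmod q ^ n) / (1 - Cmod q))%R).
assert (sS : forall n, (s (S n) = s n + Cmod q ^ n)%R)
  by (intros m; unfold s; simpl; field; lra).
assert (s0 : forall n, (0 <= s n)%R).
{ intros m; induction m as [|m IH].
  - unfold s; simpl; right; field; lra.
  - rewrite sS; pose proof (pow_le (Cmod q) m q0); lra. }
change (Cmod (qpochn x q n - qpochn y q n) <= K * Cmod (x - y) * s n * exp (r * s n))%R.
induction n as [|n IH].
- simpl; replace (1 - 1) with (RtoC 0) by ring; rewrite Cmod_0.
  replace (s 0%nat) with 0%R by (unfold s; simpl; field; lra); lra.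
- simpl qpochn.
  replace (qpochn x q n * (1 - x * q ^ n) - qpochn y q n * (1 - y * q ^ n))
    with ((qpochn x q n - qpochn y q n) * (1 - x * q ^ n)
          + - (qpochn y q n * ((x - y) * q ^ n))) by ring.
  eapply Rle_trans; [apply Cmod_triangle|].
  rewrite Cmod_opp, !Cmod_mult, Cmod_Cpow, sS.
  pose proof (pow_le (Cmod q) n q0) as qn.
  pose proof (Cmod_ge_0 (x - y)) as d0.
  pose proof (s0 n) as sn.
  assert (h1 : (Cmod (1 - x * q ^ n) <= exp (r * Cmod q ^ n))%R).
  { eapply Rle_trans; [apply Cmod_triangle|].
    rewrite Cmod_1, Cmod_opp, Cmod_mult, Cmod_Cpow.
    eapply Rle_trans; [|apply exp_ineq1_le].
    apply Rplus_le_compat_l, Rmult_le_compat_r; trivial. }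
  assert (h2 : (Cmod (qpochn y q n) <= K)%R).
  { eapply Rle_trans; [now apply qpochn_bound|].
    apply exp_le, Rmult_le_compat_r; trivial.
    left; apply Rinv_0_lt_compat; lra. }
  assert (h3 : (1 <= exp (r * (s n + Cmod q ^ n)))%R).
  { rewrite <- exp_0; apply exp_le, Rmult_le_pos; lra. }
  apply Rle_trans with
    (K * Cmod (x - y) * s n * exp (r * s n) * exp (r * Cmod q ^ n)
     + K * Cmod (x - y) * Cmod q ^ n * 1)%R.
  + apply Rplus_le_compat.
    * apply Rmult_le_compat; trivial; apply Cmod_ge_0.
    * rewrite Rmult_1_r, <- Rmult_assoc.
      apply Rmult_le_compat_r; trivial; apply Rmult_le_compat_r; trivial.
  + rewrite (Rmult_assoc _ (exp _) (exp _)), <- exp_plus.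
    replace (r * s n + r * Cmod q ^ n)%R with (r * (s n + Cmod q ^ n))%R by ring.
    assert (0 <= K * Cmod (x - y))%R by (apply Rmult_le_pos; lra).
    assert (K * Cmod (x - y) * Cmod q ^ n * 1 <=
            K * Cmod (x - y) * Cmod q ^ n * exp (r * (s n + Cmod q ^ n)))%R.
    { apply Rmult_le_compat_l; trivial; now apply Rmult_le_pos. }
    lra.
Qed.

Lemma qpochinf_lipschitz (x y q : C) (r : R) : (Cmod q < 1)%R ->
  (Cmod x <= r)%R -> (Cmod y <= r)%R ->
  (Cmod (qpochinf x q - qpochinf y q) <=
   exp (r / (1 - Cmod q)) * Cmod (x - y) * (1 / (1 - Cmod q))
   * exp (r / (1 - Cmod q)))%R.
Proof.
intros hq hx hy.
pose proof (Cmod_ge_0 q) as q0; pose proof (Cmod_ge_0 x) as x0.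
assert (hr : (0 <= r)%R) by lra.
apply (Climit_Cmod_le (fun n => qpochn x q n - qpochn y q n)).
- apply Climit_minus; now apply qpochinf_limit.
- intros n; eapply Rle_trans; [apply (qpochn_lipschitz x y q r n); trivial|].
  assert (s1 : ((1 - Cmod q ^ n) / (1 - Cmod q) <= 1 / (1 - Cmod q))%R).
  { apply Rmult_le_compat_r; [left; apply Rinv_0_lt_compat; lra|].
    pose proof (pow_le (Cmod q) n q0); lra. }
  assert (s0 : (0 <= (1 - Cmod q ^ n) / (1 - Cmod q))%R).
  { apply Rmult_le_pos; [|left; apply Rinv_0_lt_compat; lra].
    assert (Cmod q ^ n <= 1 ^ n)%R by (apply pow_incr; lra).
    rewrite pow1 in *; lra. }
  assert (0 <= exp (r / (1 - Cmod q)) * Cmod (x - y))%R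
    by (apply Rmult_le_pos; [left; apply exp_pos | apply Cmod_ge_0]).
  apply Rmult_le_compat; [now apply Rmult_le_pos | left; apply exp_pos | |].
  + now apply Rmult_le_compat_l.
  + apply exp_le; unfold Rdiv at 2; apply Rmult_le_compat_l; trivial; lra.
Qed.

Lemma Climit_qpochinf (u : nat -> C) (l q : C) : (Cmod q < 1)%R ->
  Climit u l -> Climit (fun n => qpochinf (u n) q) (qpochinf l q).
Proof.
intros hq H.
destruct (Climit_eventually u l 1 H Rlt_0_1) as [N HN].
apply (is_lim_seq_incr_n _ N).
pose proof (proj1 (is_lim_seq_incr_n _ N _) H) as H'.
set (r := (Cmod l + 1)%R).
set (K := exp (r / (1 - Cmod q))).
apply (is_lim_seq_le_le (fun _ => 0%R) _
         (fun n => K * (1 / (1 - Cmod q)) * K * Cmod (u (n + N)%nat - l))%R 0%R).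
- intros n; split; [apply Cmod_ge_0|].
  replace (K * (1 / (1 - Cmod q)) * K * Cmod (u (n + N)%nat - l))%R
    with (K * Cmod (u (n + N)%nat - l) * (1 / (1 - Cmod q)) * K)%R by ring.
  apply qpochinf_lipschitz; trivial.
  + replace (u (n + N)%nat) with ((u (n + N)%nat - l) + l) by ring.
    eapply Rle_trans; [apply Cmod_triangle|].
    specialize (HN (n + N)%nat ltac:(lia)); unfold r; lra.
  + unfold r; lra.
- apply is_lim_seq_const.
- replace 0%R with (K * (1 / (1 - Cmod q)) * K * 0)%R by ring.
  apply is_lim_seq_mult'; trivial; apply is_lim_seq_const.
Qed.

Lemma qpochinf_0 (q : C) : (Cmod q < 1)%R -> qpochinf 0 q = 1.
Proof.
intros hq; apply (Climit_unique (qpochn 0 q)); [now apply qpochinf_limit|].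
apply Climit_ext with (fun _ => RtoC 1); [|apply Climit_const].
intros n; induction n as [|n IH]; simpl; trivial; rewrite <- IH; ring.
Qed.

(** Finitely many factors are split off until y = x q^N has |y| < (1 - |q|)/2. Then the finite
    products are at least 1 - |y| (1 + |q| + ...) > 1/2 in modulus, by the inequality that a product
    of 1 - t_i is at least 1 minus the sum of the t_i. *)
Lemma qpochinf_neq0 (x q : C) : (Cmod q < 1)%R ->
  (forall n, qpochn x q n <> 0) -> qpochinf x q <> 0.
Proof.
intros hq H.
pose proof (Cmod_ge_0 q) as q0.
assert (He : (0 < (1 - Cmod q) / 2)%R) by lra.
destruct (Climit_eventually _ _ _ (Climit_pow x q hq) He) as [N HN].
specialize (HN N (le_n N)).
rewrite (qpochinf_shift x q N hq); apply Cmult_neq_0; [apply H|].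
set (y := x * q ^ N) in *.
replace (y - 0) with y in HN by ring.
pose proof (Cmod_ge_0 y) as y0.
assert (D : (0 < 1 - Cmod q)%R) by lra.
assert (hy : (Cmod y / (1 - Cmod q) <= 1 / 2)%R).
{ apply (Rmult_le_reg_r (1 - Cmod q)); trivial.
  unfold Rdiv; rewrite Rmult_assoc, Rinv_l; lra. }
assert (B : forall n, (1 - Cmod y * ((1 - Cmod q ^ n) / (1 - Cmod q))
                       <= Cmod (qpochn y q n))%R).
{ intros n; induction n as [|n IH].
  - simpl; rewrite Cmod_1; replace ((1 - 1) / (1 - Cmod q))%R with 0%R by (field; lra); lra.
  - simpl qpochn; rewrite Cmod_mult.
    pose proof (pow_le (Cmod q) n q0) as qn.
    assert (qn1 : (Cmod q ^ n <= 1)%R)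
      by (rewrite <- (pow1 n); apply pow_incr; lra).
    assert (Ht : (1 - Cmod y * Cmod q ^ n <= Cmod (1 - y * q ^ n))%R).
    { pose proof (Cmod_triangle (1 - y * q ^ n) (y * q ^ n)) as T.
      replace (1 - y * q ^ n + y * q ^ n) with (RtoC 1) in T by ring.
      rewrite Cmod_1, (Cmod_mult y), Cmod_Cpow in T; lra. }
    replace ((1 - Cmod q ^ S n) / (1 - Cmod q))%R
      with ((1 - Cmod q ^ n) / (1 - Cmod q) + Cmod q ^ n)%R by (simpl; field; lra).
    set (s := ((1 - Cmod q ^ n) / (1 - Cmod q))%R) in *.
    assert (s0 : (0 <= s)%R).
    { apply Rmult_le_pos; [lra|left; apply Rinv_0_lt_compat; lra]. }
    assert (s1 : (s <= 1 / (1 - Cmod q))%R).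
    { apply Rmult_le_compat_r; [left; apply Rinv_0_lt_compat; lra|lra]. }
    assert (ys : (Cmod y * s <= 1 / 2)%R).
    { eapply Rle_trans; [apply Rmult_le_compat_l; [trivial|exact s1]|].
      unfold Rdiv in *; lra. }
    assert (yq : (Cmod y * Cmod q ^ n <= 1 / 2)%R).
    { eapply Rle_trans; [apply Rmult_le_compat_l; [trivial|exact qn1]|].
      unfold Rdiv in *; nra. }
    assert (0 <= Cmod y * s)%R by now apply Rmult_le_pos.
    assert (0 <= Cmod y * Cmod q ^ n)%R by now apply Rmult_le_pos.
    apply Rle_trans with ((1 - Cmod y * s) * (1 - Cmod y * Cmod q ^ n))%R; [nra|].
    apply Rmult_le_compat; lra. }
intros E.
pose proof (qpochinf_limit y q hq) as L; rewrite E in L.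
destruct (Climit_eventually _ _ (1/2) L ltac:(lra)) as [n Hn].
specialize (Hn n (le_n n)); specialize (B n).
replace (qpochn y q n - 0) with (qpochn y q n) in Hn by ring.
assert (s1 : ((1 - Cmod q ^ n) / (1 - Cmod q) <= 1 / (1 - Cmod q))%R).
{ apply Rmult_le_compat_r; [left; apply Rinv_0_lt_compat; lra|].
  pose proof (pow_le (Cmod q) n q0); lra. }
apply (Rmult_le_compat_l (Cmod y)) in s1; trivial.
unfold Rdiv in *; lra.
Qed.

(** * The theta function and integer powers *)

Lemma theta_eq (z q : C) : theta z q = qpochinf z q * qpochinf (q / z) q.
Proof. unfold theta, qpochsinf; simpl; ring. Qed.

Lemma theta_inv (z q : C) : z <> 0 -> q <> 0 -> theta (q / z) q = theta z q.
Proof.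
intros hz hq; rewrite !theta_eq; replace (q / (q / z)) with z; [ring|].
field; auto.
Qed.

Lemma theta_mult_q (z q : C) : (0 < Cmod q < 1)%R -> z <> 0 ->
  z * theta (q * z) q = - theta z q.
Proof.
intros [q0 hq] hz; assert (nq : q <> 0) by now apply Cmod_gt_0.
rewrite !theta_eq, (qpochinf_succ z q hq), (qpochinf_succ (q / (q * z)) q hq).
replace (q / (q * z) * q) with (q / z) by now field.
replace (z * q) with (q * z) by ring; field; auto.
Qed.

Lemma theta_recip (z q : C) : (0 < Cmod q < 1)%R -> z <> 0 ->
  z * theta (/ z) q = - theta z q.
Proof.
intros hq hz; assert (nq : q <> 0) by now apply Cmod_gt_0.
rewrite <- (theta_mult_q z q hq hz); f_equal.
rewrite <- (theta_inv (q * z)); trivial.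
- f_equal; field; auto.
- now apply Cmult_neq_0.
Qed.

Lemma Cpowz_of_nat (z : C) (n : nat) : Cpowz z (Z.of_nat n) = z ^ n.
Proof.
destruct n as [|n]; trivial; simpl Z.of_nat; unfold Cpowz.
now rewrite SuccNat2Pos.id_succ.
Qed.

Lemma Cpowz_opp_of_nat (z : C) (n : nat) : Cpowz z (- Z.of_nat n) = / z ^ n.
Proof.
destruct n as [|n].
- simpl; field.
- simpl Z.of_nat; simpl Z.opp; unfold Cpowz; now rewrite SuccNat2Pos.id_succ.
Qed.

Lemma Z_nat_cases (k : Z) :
  (exists n, k = Z.of_nat n) \/ (exists n, k = - Z.of_nat (S n))%Z.
Proof.
destruct (Z_le_gt_dec 0 k).
- left; exists (Z.to_nat k); lia.
- right; exists (Z.to_nat (- k - 1)); lia.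
Qed.

Lemma Cpowz_succ (z : C) (k : Z) : z <> 0 ->
  Cpowz z (k + 1) = Cpowz z k * z.
Proof.
intros hz; destruct (Z_nat_cases k) as [[n ->]|[n ->]].
- replace (Z.of_nat n + 1)%Z with (Z.of_nat (S n)) by lia.
  rewrite !Cpowz_of_nat; simpl; ring.
- replace (- Z.of_nat (S n) + 1)%Z with (- Z.of_nat n)%Z by lia.
  rewrite !Cpowz_opp_of_nat; simpl; pose proof (Cpow_nz z n hz); field; auto.
Qed.

Lemma Z_bi_ind (Q : Z -> Prop) : Q 0%Z -> (forall k, Q k <-> Q (k + 1)%Z) ->
  forall k, Q k.
Proof.
intros H0 HS k; apply Z.bi_induction; trivial.
now intros x y ->.
Qed.

Lemma Z_geometric (f : Z -> C) (c : C) : c <> 0 ->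
  (forall k, f (k + 1)%Z = f k * c) -> forall k, f k = f 0%Z * Cpowz c k.
Proof.
intros hc H; apply Z_bi_ind; [simpl; ring|].
intros k; rewrite H, (Cpowz_succ c k hc); split; intros E.
- rewrite E; ring.
- replace (f k) with (f k * c * / c) by (field; auto).
  rewrite E; field; auto.
Qed.

Lemma Cpowz_nz (z : C) (k : Z) : z <> 0 -> Cpowz z k <> 0.
Proof.
intros hz; destruct (Z_nat_cases k) as [[n ->]|[n ->]].
- rewrite Cpowz_of_nat; now apply Cpow_nz.
- rewrite Cpowz_opp_of_nat.
  intros E; pose proof (Cpow_nz z (S n) hz) as H.
  apply C1_nz; rewrite <- (Cinv_r (z ^ S n)) by trivial; rewrite E; ring.
Qed.

Lemma Cpowz_add (z : C) (k m : Z) : z <> 0 ->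
  Cpowz z (k + m) = Cpowz z k * Cpowz z m.
Proof.
intros hz.
rewrite (Z_geometric (fun m => Cpowz z (k + m)) z hz).
- now rewrite Z.add_0_r.
- intros j; rewrite Z.add_assoc; now apply Cpowz_succ.
Qed.

Lemma Cpowz_opp (z : C) (k : Z) : z <> 0 -> Cpowz z (- k) = / Cpowz z k.
Proof.
intros hz; pose proof (Cpowz_nz z k hz) as H.
assert (E : Cpowz z (- k) * Cpowz z k = 1).
{ rewrite <- Cpowz_add by trivial; now replace (- k + k)%Z with 0%Z by lia. }
replace (Cpowz z (- k)) with (Cpowz z (- k) * Cpowz z k * / Cpowz z k) by (field; auto).
rewrite E; ring.
Qed.

Lemma Cpowz_mult (x y : C) (k : Z) : x <> 0 -> y <> 0 ->
  Cpowz (x * y) k = Cpowz x k * Cpowz y k.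
Proof.
intros hx hy.
rewrite (Z_geometric (fun k => Cpowz x k * Cpowz y k) (x * y)).
- simpl; ring.
- now apply Cmult_neq_0.
- intros j; rewrite !Cpowz_succ by trivial; ring.
Qed.

Lemma Cinv_nz (z : C) : z <> 0 -> / z <> 0.
Proof.
intros hz E; apply C1_nz; rewrite <- (Cinv_r z) by trivial; rewrite E; ring.
Qed.

Lemma Cpowz_inv (x : C) (k : Z) : x <> 0 -> Cpowz (/ x) k = / Cpowz x k.
Proof.
intros hx; rewrite <- Cpowz_opp by trivial.
rewrite (Z_geometric (fun k => Cpowz x (- k)) (/ x)).
- simpl; ring.
- now apply Cinv_nz.
- intros j; pose proof (Cpowz_succ x (- (j + 1)) hx) as E.
  replace (- (j + 1) + 1)%Z with (- j)%Z in E by lia.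
  rewrite E; field; auto.
Qed.

(** The exponent of q in the leading behaviour (-x)^k q^(k(k-1)/2) of (x;q)_k as x tends to
    infinity; the division is exact. *)
Definition tri (k : Z) : Z := (k * (k - 1) / 2)%Z.

Lemma tri_succ (k : Z) : tri (k + 1) = (tri k + k)%Z.
Proof.
unfold tri; replace ((k + 1) * (k + 1 - 1))%Z with (k * (k - 1) + k * 2)%Z by ring.
now rewrite Z.div_add by lia.
Qed.

Lemma tri_opp (k : Z) : tri (- k) = (tri k + k)%Z.
Proof.
rewrite <- tri_succ; unfold tri; f_equal; ring.
Qed.

Definition Rprod (l : list R) : R := fold_right Rmult 1%R l.

Lemma Rprod_pos (l : list R) : List.Forall (fun r => (0 < r)%R) l -> (0 < Rprod l)%R.
Proof.
induction 1 as [|r l hr _ IH]; simpl; [lra|now apply Rmult_lt_0_compat].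
Qed.

(** Provides the polydisc on which a series is dominated uniformly. Strict inequalities leave every
    entry room to vary, and the radii are positive even where an entry is 0, as [eps_bound]
    requires. *)
Lemma Cprod_strict_bounds (l : list C) (B : R) : (Cmod (Cprod l) < B)%R ->
  exists rs, List.Forall (fun r => (0 < r)%R) rs /\
    Forall2 (fun X r => (Cmod X < r)%R) l rs /\ (Rprod rs < B)%R.
Proof.
revert B; induction l as [|x l IH]; intros B H.
- exists nil; simpl in *; rewrite Cmod_1 in H; auto.
- simpl in H; rewrite Cmod_mult in H.
  set (p := Cmod (Cprod l)) in *.
  assert (p0 : (0 <= p)%R) by apply Cmod_ge_0.
  pose proof (Cmod_ge_0 x) as x0.
  assert (hB : (0 < B)%R) by (pose proof (Rmult_le_pos _ _ x0 p0); lra).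
  (* The slack granted to the remaining entries, small enough that |x| (p + d) < B; the + 1 covers x
     = 0. *)
  set (d := ((B - Cmod x * p) / (2 * (Cmod x + 1)))%R).
  assert (d0 : (0 < d)%R).
  { apply Rmult_lt_0_compat; [lra|apply Rinv_0_lt_compat; lra]. }
  destruct (IH (p + d)%R ltac:(fold p; lra)) as (rs & H1 & H2 & H3).
  pose proof (Rprod_pos rs H1) as hp.
  assert (hx : (Cmod x * Rprod rs < B)%R).
  { apply Rle_lt_trans with (Cmod x * (p + d))%R.
    - apply Rmult_le_compat_l; lra.
    - assert (Cmod x * d < B - Cmod x * p)%R; [|lra].
      apply Rle_lt_trans with ((Cmod x + 1) * d)%R; [nra|].
      unfold d.
      replace ((Cmod x + 1) * ((B - Cmod x * p) / (2 * (Cmod x + 1))))%R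
        with ((B - Cmod x * p) / 2)%R by (field; lra).
      lra. }
  set (r := ((Cmod x + B / Rprod rs) / 2)%R).
  assert (hr : (Cmod x < B / Rprod rs)%R).
  { apply (Rmult_lt_reg_r (Rprod rs)); trivial.
    unfold Rdiv; rewrite Rmult_assoc, Rinv_l; lra. }
  assert (r < B / Rprod rs)%R by (unfold r; lra).
  exists (r :: rs); repeat split.
  + constructor; trivial; unfold r; lra.
  + constructor; trivial; unfold r; lra.
  + simpl; apply Rlt_le_trans with (B / Rprod rs * Rprod rs)%R.
    * now apply Rmult_lt_compat_r.
    * right; field; lra.
Qed.

Lemma Cprod_perm (l m : list C) : Permutation l m -> Cprod l = Cprod m.
Proof.
induction 1; simpl; trivial; try (rewrite IHPermutation; ring); try ring.
now rewrite IHPermutation1.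
Qed.

Lemma is_bilateral_single (t : Z -> C) :
  (forall k, k <> 0%Z -> t k = 0) -> is_bilateral t (t 0%Z).
Proof.
intros H; exists (t 0%Z), (RtoC 0); repeat split; [| |ring].
- apply (Climit_filterlim (sum_n (G := C_NormedModule) _)).
  apply Climit_ext with (fun _ => t 0%Z); [|apply Climit_const].
  intros n; induction n as [|n IH]; [now rewrite sum_O|].
  rewrite sum_Sn, <- IH, (H (Z.of_nat (S n))) by lia; change plus with Cplus; ring.
- apply (Climit_filterlim (sum_n (G := C_NormedModule) _)).
  apply Climit_ext with (fun _ => RtoC 0); [|apply Climit_const].
  intros n; induction n as [|n IH]; [rewrite sum_O; symmetry; now apply H|].
  rewrite sum_Sn, <- IH, (H (- Z.of_nat (S (S n)))%Z) by lia; change plus with Cplus; ring.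
Qed.

Lemma is_bilateral_eq (t : Z -> C) (l m : C) :
  is_bilateral t l -> is_bilateral t m -> l = m.
Proof.
intros H1 H2; apply is_bilateral_unique in H1, H2; congruence.
Qed.

Lemma Climit_inv (u : nat -> C) (l : C) : l <> 0 -> Climit u l ->
  Climit (fun n => / u n) (/ l).
Proof.
intros hl H.
assert (l0 : (0 < Cmod l)%R) by now apply Cmod_gt_0.
destruct (Climit_eventually u l (Cmod l / 2) H ltac:(lra)) as [N HN].
apply (is_lim_seq_incr_n _ N).
pose proof (proj1 (is_lim_seq_incr_n _ N _) H) as H'.
apply (is_lim_seq_le_le (fun _ => 0%R) _
  (fun n => (2 / (Cmod l * Cmod l)) * Cmod (u (n + N)%nat - l))%R 0%R).
- intros n; split; [apply Cmod_ge_0|].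
  specialize (HN (n + N)%nat ltac:(lia)).
  set (x := u (n + N)%nat) in *.
  assert (x0 : (Cmod l / 2 < Cmod x)%R).
  { pose proof (Cmod_triangle x (- (x - l))) as T.
    replace (x + - (x - l)) with l in T by ring; rewrite Cmod_opp in T; lra. }
  assert (hx : x <> 0) by (apply Cmod_gt_0; lra).
  replace (/ x - / l) with (- ((x - l) * / (x * l))) by (field; auto).
  rewrite Cmod_opp, Cmod_mult, Cmod_inv, Cmod_mult by now apply Cmult_neq_0.
  rewrite Rmult_comm; apply Rmult_le_compat_r; [apply Cmod_ge_0|].
  replace (2 / (Cmod l * Cmod l))%R with (/ (Cmod l / 2 * Cmod l))%R by (field; lra).
  apply Rinv_le_contravar.
  + apply Rmult_lt_0_compat; lra.
  + apply Rmult_le_compat_r; lra.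
- apply is_lim_seq_const.
- replace 0%R with (2 / (Cmod l * Cmod l) * 0)%R by ring.
  apply is_lim_seq_mult'; trivial; apply is_lim_seq_const.
Qed.

Lemma Climit_div (u v : nat -> C) (l m : C) : m <> 0 ->
  Climit u l -> Climit v m -> Climit (fun n => u n / v n) (l / m).
Proof.
intros hm Hu Hv; unfold Cdiv; apply Climit_mult; trivial; now apply Climit_inv.
Qed.

Lemma Cinv_zero : / RtoC 0 = 0.
Proof. unfold Cinv; simpl; unfold Rdiv; apply injective_projections; simpl; ring. Qed.

Lemma qpochsinf_nz (l : list C) (q : C) : qpochsinf l q <> 0 ->
  forall x, In x l -> qpochinf x q <> 0.
Proof.
intros H x; induction l as [|y l IH]; [intros []|].
unfold qpochsinf in *; simpl in H; intros [->|Hx].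
- intros E; apply H; rewrite E; ring.
- apply IH; trivial; intros E; apply H; rewrite E; ring.
Qed.

Local Opaque qpochinf theta.

(** * The entire functions eps *)

Section Sums.

Variable q : C.
Hypothesis hq : (0 < Cmod q < 1)%R.

Let q1 : (Cmod q < 1)%R := proj2 hq.
Let qnz : q <> 0 := proj2 (Cmod_gt_0 q) (proj1 hq).
Local Notation P x := (qpochinf x q).
Local Notation th x := (theta x q).

(* [eps a (/ x) k = (x;q)_k / (q a / x;q)_k * (- x)^(-k)] times the constant
   [(q / x, q a / x;q)_oo], see [qpoch_ratio_eps]; [X = 0] stands for [x = oo]. *)
Definition eps (a X : C) (k : Z) : C :=
  Cpowz q (tri k) * (P (q * X / Cpowz q k) * P (q * a * X * Cpowz q k)).

(** The ratio of consecutive terms, written without division so that it also holds where a factor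
    vanishes. *)
Lemma eps_succ (a X : C) (k : Z) :
  (1 - q * a * X * Cpowz q k) * eps a X (k + 1)
  = (Cpowz q k - X) * eps a X k.
Proof.
unfold eps; pose proof (Cpowz_nz q k qnz) as hu.
rewrite tri_succ, Cpowz_add, Cpowz_succ by trivial.
set (u := Cpowz q k) in *.
replace (q * X / (u * q)) with (X / u) by (field; auto).
rewrite (qpochinf_succ (X / u) q q1), (qpochinf_succ (q * a * X * u) q q1).
replace (X / u * q) with (q * X / u) by (field; auto).
replace (q * a * X * (u * q)) with (q * a * X * u * q) by ring.
field; auto.
Qed.

(** Source of all q-difference equations in the parameters: replacing x by qx changes each term only
    by a Laurent polynomial in q^k. *)
Lemma eps_div_q (a Y : C) (k : Z) :
  eps a (Y / q) k
  = (1 - Y / Cpowz q k) * (1 - a * Y * Cpowz q k) * eps a Y k.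
Proof.
unfold eps; pose proof (Cpowz_nz q k qnz) as hu; set (u := Cpowz q k) in *.
replace (q * (Y / q) / u) with (Y / u) by (field; auto).
replace (q * a * (Y / q) * u) with (a * Y * u) by (field; auto).
rewrite (qpochinf_succ (Y / u) q q1), (qpochinf_succ (a * Y * u) q q1).
replace (Y / u * q) with (q * Y / u) by (field; auto).
replace (a * Y * u * q) with (q * a * Y * u) by ring.
ring.
Qed.

(** Reversal of the order of summation; it reduces the growth at -oo to the growth at +oo. *)
Lemma eps_opp (a X : C) (k : Z) : a <> 0 ->
  eps a X (- k) = Cpowz q k * eps (/ a) (a * X) k.
Proof.
intros ha; unfold eps; pose proof (Cpowz_nz q k qnz) as hu.
rewrite tri_opp, Cpowz_add, (Cpowz_opp q k) by trivial.
set (u := Cpowz q k) in *.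
replace (q * X / / u) with (q * X * u) by (field; auto).
replace (q * a * X * / u) with (q * (a * X) / u) by (field; auto).
replace (q * / a * (a * X) * u) with (q * X * u) by (field; auto).
ring.
Qed.

Lemma eps_0 (a : C) (k : Z) : eps a 0 k = Cpowz q (tri k).
Proof.
unfold eps; replace (q * 0 / Cpowz q k) with (RtoC 0) by (unfold Cdiv; ring).
replace (q * a * 0 * Cpowz q k) with (RtoC 0) by ring.
rewrite qpochinf_0 by trivial; ring.
Qed.

(** Quasi-periodicity of theta, iterated: the left side acquires the factor -1/z whenever k grows by
    one, so [Z_geometric] covers both directions. *)
Lemma theta_shift (z : C) (k : Z) : z <> 0 ->
  Cpowz q (tri k) * (P (z * Cpowz q k) * P (q / (z * Cpowz q k)))
  = theta z q * Cpowz (- / z) k.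
Proof.
intros hz.
rewrite (Z_geometric (fun k => Cpowz q (tri k)
   * (P (z * Cpowz q k) * P (q / (z * Cpowz q k)))) (- / z)).
- simpl; change (tri 0) with 0%Z; simpl.
  rewrite theta_eq, !Cmult_1_r; ring.
- intros E; apply (Cinv_nz z hz); replace (/ z) with (- - / z) by ring.
  rewrite E; ring.
- intros j; pose proof (Cpowz_nz q j qnz) as hu.
  rewrite tri_succ, Cpowz_add, Cpowz_succ by trivial.
  set (u := Cpowz q j) in *.
  pose proof (theta_mult_q (z * u) q hq (Cmult_neq_0 _ _ hz hu)) as E.
  rewrite !theta_eq in E.
  replace (z * (u * q)) with (q * (z * u)) by ring.
  replace (Cpowz q (tri j) * u * (P (q * (z * u)) * P (q / (q * (z * u)))))
    with (Cpowz q (tri j) * / z * (z * u * (P (q * (z * u)) * P (q / (q * (z * u))))))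
    by (field; auto).
  rewrite E; ring.
Qed.

(** Classically, (b, a/b;q)_k / (qa/b, qb;q)_k = (1 - b)(1 - a/b) / ((1 - b q^k)(1 - a q^k/b)),
    because (b;q)_k / (qb;q)_k = (1 - b)/(1 - b q^k). The thetas come from the normalisation of
    [eps]. *)
Lemma eps_pair (a b : C) (k : Z) : a <> 0 -> b <> 0 ->
  (1 - b * Cpowz q k) * (1 - a / b * Cpowz q k)
    * (eps a (/ b) k * eps a (b / a) k)
  = theta b q * theta (a / b) q * Cpowz (/ a) k.
Proof.
intros ha hb.
assert (hab : a / b <> 0) by (apply Cmult_neq_0; trivial; now apply Cinv_nz).
assert (E : Cpowz (/ a) k = Cpowz (- / b) k * Cpowz (- / (a / b)) k).
{ rewrite <- Cpowz_mult.
  - f_equal; field; auto.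
  - intros E; apply (Cinv_nz b hb); replace (/ b) with (- - / b) by ring.
    rewrite E; ring.
  - intros E; apply (Cinv_nz _ hab); replace (/ (a / b)) with (- - / (a / b)) by ring.
    rewrite E; ring. }
rewrite E.
replace (theta b q * theta (a / b) q * (Cpowz (- / b) k * Cpowz (- / (a / b)) k))
  with ((theta b q * Cpowz (- / b) k) * (theta (a / b) q * Cpowz (- / (a / b)) k))
  by ring.
rewrite <- !theta_shift by trivial.
pose proof (Cpowz_nz q k qnz) as hu; unfold eps; set (u := Cpowz q k) in *.
rewrite (qpochinf_succ (b * u) q q1), (qpochinf_succ (a / b * u) q q1).
replace (b * u * q) with (q * a * (b / a) * u) by (field; auto).
replace (a / b * u * q) with (q * a * / b * u) by (field; auto).
replace (q * / b / u) with (q / (b * u)) by (field; auto).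
replace (q * (b / a) / u) with (q / (a / b * u)) by (field; auto).
ring.
Qed.

(** The parameters c and qa/c occur as each other's denominators, so their q-shifted factorials
    cancel and only a geometric factor survives. *)
Lemma eps_reflect (a c : C) (k : Z) : a <> 0 -> c <> 0 ->
  eps a (/ c) k * eps a (c / (q * a)) k
  = theta c q * theta (c / a) q * Cpowz (/ (q * a)) k.
Proof.
intros ha hc.
assert (hz : q * a / c <> 0)
  by (repeat apply Cmult_neq_0; trivial; now apply Cinv_nz).
assert (E : Cpowz (/ (q * a)) k = Cpowz (- / c) k * Cpowz (- / (q * a / c)) k).
{ rewrite <- Cpowz_mult.
  - f_equal; field; auto.
  - intros E; apply (Cinv_nz c hc); replace (/ c) with (- - / c) by ring.
    rewrite E; ring.
  - intros E; apply (Cinv_nz _ hz); replace (/ (q * a / c)) with (- - / (q * a / c)) by ring.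
    rewrite E; ring. }
rewrite E.
replace (theta (c / a) q) with (theta (q * a / c) q).
2:{ rewrite <- theta_inv; trivial; f_equal; field; auto. }
replace (theta c q * theta (q * a / c) q * (Cpowz (- / c) k * Cpowz (- / (q * a / c)) k))
  with ((theta c q * Cpowz (- / c) k) * (theta (q * a / c) q * Cpowz (- / (q * a / c)) k))
  by ring.
rewrite <- !theta_shift by trivial.
pose proof (Cpowz_nz q k qnz) as hu; unfold eps; set (u := Cpowz q k) in *.
replace (q * / c / u) with (q / (c * u)) by (field; auto).
replace (q * a * / c * u) with (q * a / c * u) by (field; auto).
replace (q * (c / (q * a)) / u) with (q / (q * a / c * u)) by (field; auto).
replace (q * a * (c / (q * a)) * u) with (c * u) by (field; auto).
ring.
Qed.

(** For k = n >= 0 the power of q is absorbed into n factors q^j - X, each close to -X. This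
    exhibits the growth, and it needs no division by X. *)
Lemma eps_of_nat (a X : C) (n : nat) :
  eps a X (Z.of_nat n)
  = fold_right Cmult 1 (map (fun j => q ^ j - X) (seq 0 n))
    * (P (q * X) * P (q * a * X * q ^ n)).
Proof.
unfold eps; rewrite Cpowz_of_nat.
replace (Cpowz q (tri (Z.of_nat n)) * (P (q * X / q ^ n) * P (q * a * X * q ^ n)))
  with (Cpowz q (tri (Z.of_nat n)) * P (q * X / q ^ n) * P (q * a * X * q ^ n)) by ring.
rewrite Cmult_assoc; f_equal.
induction n as [|n IH].
- simpl; change (tri 0) with 0%Z; simpl; f_equal.
  f_equal; field.
- replace (Z.of_nat (S n)) with (Z.of_nat n + 1)%Z by lia.
  rewrite tri_succ, Cpowz_add, Cpowz_of_nat by trivial.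
  rewrite seq_S, map_app, fold_right_app; simpl.
  assert (F : forall l x, fold_right Cmult (x * 1) l = fold_right Cmult 1 l * x).
  { intros l x; induction l as [|y l IHl]; simpl; [ring|rewrite IHl; ring]. }
  rewrite F.
  replace (fold_right Cmult 1 (map (fun j => q ^ j - X) (seq 0 n)) * (q ^ n - X) * P (q * X))
    with ((q ^ n - X) * (fold_right Cmult 1 (map (fun j => q ^ j - X) (seq 0 n)) * P (q * X))) by ring.
  rewrite <- IH; pose proof (Cpow_nz q n qnz) as hu.
  replace (q * X / (q * q ^ n)) with (X / q ^ n) by (field; auto).
  rewrite (qpochinf_succ (X / q ^ n) q q1).
  replace (X / q ^ n * q) with (q * X / q ^ n) by (field; auto).
  field; auto.
Qed.

(** From |q^j - X| <= r (1 + |q|^j/r) <= r exp(|q|^j/r), the n factors of [eps_of_nat] contribute at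
    most r^n times a convergent exponential. *)
Lemma eps_bound_nat (a : C) (r : R) : (0 < r)%R ->
  exists M : R, (0 < M)%R /\ forall X n, (Cmod X <= r)%R ->
    (Cmod (eps a X (Z.of_nat n)) <= M * r ^ n)%R.
Proof.
intros hr.
set (E := exp (/ r / (1 - Cmod q))).
set (E1 := exp (Cmod q * r / (1 - Cmod q))).
set (E2 := exp (Cmod q * Cmod a * r / (1 - Cmod q))).
exists (E * (E1 * E2))%R; split.
{ repeat apply Rmult_lt_0_compat; apply exp_pos. }
intros X n hX; rewrite eps_of_nat by trivial.
pose proof (Cmod_ge_0 q) as q0.
assert (qn : forall n, (0 <= Cmod q ^ n <= 1)%R).
{ intros m; split; [now apply pow_le|].
  rewrite <- (pow1 m); apply pow_incr; lra. }
assert (B1 : (Cmod (P (q * X)) <= E1)%R).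
{ apply qpochinf_bound_le; trivial; rewrite Cmod_mult.
  now apply Rmult_le_compat_l. }
assert (B2 : (Cmod (P (q * a * X * q ^ n)) <= E2)%R).
{ apply qpochinf_bound_le; trivial; rewrite !Cmod_mult, Cmod_Cpow.
  assert (h : (0 <= Cmod q * Cmod a)%R) by (apply Rmult_le_pos; apply Cmod_ge_0).
  assert (h2 : (0 <= Cmod q * Cmod a * Cmod X)%R) by (apply Rmult_le_pos; trivial; apply Cmod_ge_0).
  apply Rle_trans with (Cmod q * Cmod a * Cmod X)%R.
  - rewrite <- (Rmult_1_r (Cmod q * Cmod a * Cmod X)) at 2.
    apply Rmult_le_compat_l; trivial; apply qn.
  - now apply Rmult_le_compat_l. }
assert (B : (Cmod (fold_right Cmult 1 (map (fun j => q ^ j - X) (seq 0 n)))%C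
   <= r ^ n * exp (/ r * ((1 - Cmod q ^ n) / (1 - Cmod q))))%R).
{ clear B2; induction n as [|n IH].
  - simpl; rewrite Cmod_1.
    replace (/ r * ((1 - 1) / (1 - Cmod q)))%R with 0%R by (field; lra).
    rewrite exp_0; lra.
  - rewrite seq_S, map_app, fold_right_app; simpl.
    assert (F : forall l x, fold_right Cmult (x * 1) l = fold_right Cmult 1 l * x).
    { intros l x; induction l as [|y l IHl]; simpl; [ring|rewrite IHl; ring]. }
    rewrite F, Cmod_mult.
    replace (/ r * ((1 - Cmod q * Cmod q ^ n) / (1 - Cmod q)))%R
      with (/ r * ((1 - Cmod q ^ n) / (1 - Cmod q)) + / r * Cmod q ^ n)%R
      by (field; lra).
    rewrite exp_plus.
    replace (r * r ^ n * (exp (/ r * ((1 - Cmod q ^ n) / (1 - Cmod q))) * exp (/ r * Cmod q ^ n)))%R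
      with (r ^ n * exp (/ r * ((1 - Cmod q ^ n) / (1 - Cmod q))) * (r * exp (/ r * Cmod q ^ n)))%R by ring.
    apply Rmult_le_compat; try apply Cmod_ge_0; trivial.
    eapply Rle_trans; [apply Cmod_triangle|].
    rewrite Cmod_opp, Cmod_Cpow.
    apply Rle_trans with (r * (1 + / r * Cmod q ^ n))%R.
    + rewrite Rmult_plus_distr_l, <- Rmult_assoc, Rinv_r by lra; lra.
    + apply Rmult_le_compat_l; [lra|]; apply exp_ineq1_le. }
rewrite !Cmod_mult.
replace (E * (E1 * E2) * r ^ n)%R with (r ^ n * E * (E1 * E2))%R by ring.
apply Rmult_le_compat; try (repeat apply Rmult_le_pos; apply Cmod_ge_0).
- eapply Rle_trans; [exact B|].
  apply Rmult_le_compat_l; [apply pow_le; lra|].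
  apply exp_le; unfold Rdiv at 2; apply Rmult_le_compat_l.
  + left; now apply Rinv_0_lt_compat.
  + rewrite <- (Rmult_1_l (/ (1 - Cmod q))); apply Rmult_le_compat_r.
    * left; apply Rinv_0_lt_compat; lra.
    * pose proof (qn n); lra.
- apply Rmult_le_compat; try apply Cmod_ge_0; trivial.
Qed.

Lemma eps_bound (a : C) (r : R) : a <> 0 -> (0 < r)%R ->
  exists M : R, (0 < M)%R /\ forall X n, (Cmod X <= r)%R ->
    (Cmod (eps a X (Z.of_nat n)) <= M * r ^ n)%R /\
    (Cmod (eps a X (- Z.of_nat n)) <= M * (Cmod (q * a) * r) ^ n)%R.
Proof.
intros ha hr.
assert (ha' : (0 < Cmod a)%R) by now apply Cmod_gt_0.
destruct (eps_bound_nat a r hr) as (M1 & p1 & H1).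
destruct (eps_bound_nat (/ a) (Cmod a * r)) as (M2 & p2 & H2).
{ now apply Rmult_lt_0_compat. }
exists (M1 + M2)%R; split; [lra|]; intros X n hX; split.
- eapply Rle_trans; [now apply H1|].
  apply Rmult_le_compat_r; [apply pow_le|]; lra.
- rewrite eps_opp, Cmod_mult, Cpowz_of_nat, Cmod_Cpow by trivial.
  assert (h : (Cmod (eps (/ a) (a * X) (Z.of_nat n)) <= M2 * (Cmod a * r) ^ n)%R).
  { apply H2; rewrite Cmod_mult; apply Rmult_le_compat_l; lra. }
  apply Rle_trans with (Cmod q ^ n * (M2 * (Cmod a * r) ^ n))%R.
  + apply Rmult_le_compat_l; trivial; apply pow_le, Cmod_ge_0.
  + rewrite Cmod_mult, Rmult_assoc, (Rpow_mult_distr (Cmod q)).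
    assert (0 <= Cmod q ^ n * (Cmod a * r) ^ n)%R.
    { apply Rmult_le_pos; apply pow_le; [apply Cmod_ge_0|].
      apply Rmult_le_pos; lra. }
    replace (Cmod q ^ n * (M2 * (Cmod a * r) ^ n))%R
      with (M2 * (Cmod q ^ n * (Cmod a * r) ^ n))%R by ring.
    apply Rmult_le_compat_r; lra.
Qed.

Definition eprod (a : C) (l : list C) (k : Z) : C :=
  Cprod (map (fun X => eps a X k) l).

Lemma eprod_bound (a : C) (rs : list R) : a <> 0 -> List.Forall (fun r => (0 < r)%R) rs ->
  exists M : R, (0 < M)%R /\
  forall l, Forall2 (fun X r => (Cmod X <= r)%R) l rs -> forall n,
    (Cmod (eprod a l (Z.of_nat n)) <= M * Rprod rs ^ n)%R /\
    (Cmod (eprod a l (- Z.of_nat n))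
       <= M * (Cmod (q * a) ^ length rs * Rprod rs) ^ n)%R.
Proof.
intros ha H; induction H as [|r rs hr Hrs IH].
- exists 1%R; split; [lra|]; intros l Hl n; inversion Hl; subst.
  unfold eprod; simpl; rewrite Cmod_1.
  rewrite !Rmult_1_l, pow1; lra.
- destruct IH as (M1 & p1 & H1), (eps_bound a r ha hr) as (M2 & p2 & H2).
  exists (M2 * M1)%R; split; [now apply Rmult_lt_0_compat|].
  intros l Hl n; inversion Hl as [|X r' l' rs' hX hl]; subst.
  unfold eprod; simpl; rewrite !Cmod_mult.
  destruct (H1 l' hl n) as [e1 e2], (H2 X n hX) as [e3 e4]; split.
  + rewrite Rpow_mult_distr.
    replace (M2 * M1 * (r ^ n * Rprod rs ^ n))%R
      with (M2 * r ^ n * (M1 * Rprod rs ^ n))%R by ring.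
    apply Rmult_le_compat; trivial; apply Cmod_ge_0.
  + rewrite Cmod_mult in *.
    replace (M2 * M1 * (Cmod q * Cmod a * (Cmod q * Cmod a) ^ length rs * (r * Rprod rs)) ^ n)%R
      with (M2 * (Cmod q * Cmod a * r) ^ n * (M1 * ((Cmod q * Cmod a) ^ length rs * Rprod rs) ^ n))%R
      by (rewrite !Rpow_mult_distr; ring).
    apply Rmult_le_compat; trivial; apply Cmod_ge_0.
Qed.

(** * Very-well-poised series *)

(** The powers of the parameters are moved into z: for an even number of parameters, z times the
    product of l is the argument of the usual series, and z alone depends on a, q and that number
    only. *)
Definition vwp (a z : C) (l : list C) (k : Z) : C :=
  (1 - a * (Cpowz q k * Cpowz q k)) * eprod a l k * Cpowz z k.

(** With L parameters and R the product of the radii, the terms at -n are of order (|qa|^L R /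
    (|q|^2 |z|))^n. The condition on z makes this (|z| R)^n, the order of the terms at n, so that
    one inequality controls both tails. It gives the weights z = q a^2 for L = 4 and z = q^2 a^3 for
    L = 6. *)
Lemma vwp_dominated (a z : C) (rs : list R) : a <> 0 -> z <> 0 ->
  List.Forall (fun r => (0 < r)%R) rs -> z * z * (q * q) = (q * a) ^ length rs ->
  exists M : R,
  forall l, Forall2 (fun X r => (Cmod X <= r)%R) l rs ->
    dominated M (Cmod z * Rprod rs) (vwp a z l).
Proof.
intros ha hz Hrs Hz; destruct (eprod_bound a rs ha Hrs) as (M & p & H).
pose proof (Rprod_pos rs Hrs) as hp.
exists ((1 + Cmod a) * M)%R; intros l Hl n.
pose proof (Cmod_ge_0 a) as a0.
assert (z0 : (0 < Cmod z)%R) by now apply Cmod_gt_0.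
assert (q0 : (0 < Cmod q)%R) by now apply Cmod_gt_0.
assert (qn : (0 < Cmod q ^ n <= 1)%R).
{ split; [now apply pow_lt|].
  rewrite <- (pow1 n); apply pow_incr; lra. }
destruct (H l Hl n) as [e1 e2]; unfold vwp; rewrite !Cmod_mult; split.
- rewrite !Cpowz_of_nat, Cmod_Cpow.
  replace ((1 + Cmod a) * M * (Cmod z * Rprod rs) ^ n)%R
    with ((1 + Cmod a) * (M * Rprod rs ^ n) * Cmod z ^ n)%R
    by (rewrite Rpow_mult_distr; ring).
  apply Rmult_le_compat_r; [apply pow_le; lra|].
  apply Rmult_le_compat; try apply Cmod_ge_0; trivial.
  eapply Rle_trans; [apply Cmod_triangle|].
  rewrite Cmod_1, Cmod_opp, !Cmod_mult, Cmod_Cpow.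
  apply Rplus_le_compat_l; rewrite <- (Rmult_1_r (Cmod a)) at 2.
  apply Rmult_le_compat_l; trivial; nra.
- rewrite !Cpowz_opp_of_nat.
  assert (hn : forall x : C, x <> 0 -> Cmod (/ x ^ n) = (/ Cmod x ^ n)%R).
  { intros x hx; rewrite Cmod_inv, Cmod_Cpow; trivial; now apply Cpow_nz. }
  rewrite (hn z hz).
  assert (E : (Cmod z * Cmod z * (Cmod q * Cmod q) = Cmod (q * a) ^ length rs)%R).
  { now rewrite <- Cmod_Cpow, <- Hz, !Cmod_mult. }
  rewrite <- E in e2.
  replace ((1 + Cmod a) * M * (Cmod z * Rprod rs) ^ n)%R
    with ((1 + Cmod a) * (/ Cmod q ^ n * / Cmod q ^ n)
          * (M * (Cmod z * Cmod z * (Cmod q * Cmod q) * Rprod rs) ^ n) * / Cmod z ^ n)%R.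
  2:{ rewrite !Rpow_mult_distr; field; split; apply pow_nonzero; lra. }
  apply Rmult_le_compat_r.
  { left; apply Rinv_0_lt_compat, pow_lt; lra. }
  apply Rmult_le_compat; try apply Cmod_ge_0; trivial.
  eapply Rle_trans; [apply Cmod_triangle|].
  rewrite Cmod_1, Cmod_opp, !Cmod_mult, (hn q qnz).
  assert (1 <= / Cmod q ^ n)%R.
  { rewrite <- Rinv_1; apply Rinv_le_contravar; lra. }
  assert (1 <= / Cmod q ^ n * / Cmod q ^ n)%R by nra.
  rewrite Rmult_plus_distr_r; lra.
Qed.

Lemma Climit_eps (a l : C) (u : nat -> C) (k : Z) : Climit u l ->
  Climit (fun j => eps a (u j) k) (eps a l k).
Proof.
intros H; unfold eps.
apply Climit_mult; [apply Climit_const|].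
apply Climit_mult; apply Climit_qpochinf; trivial.
- unfold Cdiv; apply Climit_mult; [|apply Climit_const].
  apply Climit_mult; trivial; apply Climit_const.
- apply Climit_mult; [|apply Climit_const].
  apply Climit_mult; trivial; apply Climit_const.
Qed.

Definition vwp_sum (a z : C) (l : list C) : C := bilateral (vwp a z l).

Lemma vwp_dominated_ex (a z : C) (l : list C) : a <> 0 -> z <> 0 ->
  z * z * (q * q) = (q * a) ^ length l -> (Cmod (z * Cprod l) < 1)%R ->
  exists M r, (0 <= r < 1)%R /\ dominated M r (vwp a z l).
Proof.
intros ha hz Hz H; rewrite Cmod_mult in H.
assert (z0 : (0 < Cmod z)%R) by now apply Cmod_gt_0.
destruct (Cprod_strict_bounds l (/ Cmod z)) as (rs & H1 & H2 & H3).
{ apply (Rmult_lt_reg_l (Cmod z)); trivial; rewrite Rinv_r; lra. }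
assert (hl : length l = length rs) by (eapply Forall2_length; exact H2).
rewrite hl in Hz.
destruct (vwp_dominated a z rs ha hz H1 Hz) as (M & HM).
exists M, (Cmod z * Rprod rs)%R; split.
- split; [apply Rmult_le_pos; [lra|left; now apply Rprod_pos]|].
  apply (Rmult_lt_compat_l (Cmod z)) in H3; trivial; rewrite Rinv_r in H3; lra.
- apply HM; clear - H2; induction H2; constructor; trivial; lra.
Qed.

Lemma vwp_is_bilateral (a z : C) (l : list C) : a <> 0 -> z <> 0 ->
  z * z * (q * q) = (q * a) ^ length l -> (Cmod (z * Cprod l) < 1)%R ->
  is_bilateral (vwp a z l) (vwp_sum a z l).
Proof.
intros ha hz Hz H.
destruct (vwp_dominated_ex a z l ha hz Hz H) as (M & r & hr & D).
now apply (dominated_bilateral M r).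
Qed.

(** Joint continuity of the sum in all reciprocal parameters: from some index on they lie in one
    polydisc, where a single majorant is valid. *)
Lemma vwp_sum_limit (a z : C) (us : list (nat -> C)) (l : list C) :
  a <> 0 -> z <> 0 ->
  z * z * (q * q) = (q * a) ^ length l -> (Cmod (z * Cprod l) < 1)%R ->
  Forall2 Climit us l ->
  Climit (fun j => vwp_sum a z (map (fun u => u j) us)) (vwp_sum a z l).
Proof.
intros ha hz Hz H Hus; rewrite Cmod_mult in H.
assert (z0 : (0 < Cmod z)%R) by now apply Cmod_gt_0.
destruct (Cprod_strict_bounds l (/ Cmod z)) as (rs & H1 & H2 & H3).
{ apply (Rmult_lt_reg_l (Cmod z)); trivial; rewrite Rinv_r; lra. }
assert (hl : length l = length rs) by (eapply Forall2_length; exact H2).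
rewrite hl in Hz.
destruct (vwp_dominated a z rs ha hz H1 Hz) as (M & HM).
assert (N : exists N, forall n, (N <= n)%nat ->
   Forall2 (fun X r => (Cmod X <= r)%R) (map (fun u => u n) us) rs).
{ clear - Hus H2; revert rs H2.
  induction Hus as [|u x us l hu _ IH]; intros rs H2; inversion H2 as [|? r ? rs' hx hl]; subst.
  - exists 0%nat; intros; constructor.
  - destruct (IH rs' hl) as [N1 HN1].
    destruct (Climit_eventually u x (r - Cmod x) hu ltac:(lra)) as [N2 HN2].
    exists (N1 + N2)%nat; intros n Hn; simpl; constructor; [|apply HN1; lia].
    specialize (HN2 n ltac:(lia)).
    replace (u n) with ((u n - x) + x) by ring.
    eapply Rle_trans; [apply Cmod_triangle|]; lra. }
destruct N as [N HN].
assert (hr : (0 <= Cmod z * Rprod rs < 1)%R).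
{ split; [apply Rmult_le_pos; [lra|left; now apply Rprod_pos]|].
  apply (Rmult_lt_compat_l (Cmod z)) in H3; trivial; rewrite Rinv_r in H3; lra. }
apply (is_lim_seq_incr_n _ N).
apply (bilateral_dominated_limit
         (fun j => vwp a z (map (fun u => u (j + N)%nat) us)) _ M _ hr).
- intros j; apply HM, HN; lia.
- intros k; unfold vwp.
  apply Climit_mult; [|apply Climit_const].
  apply Climit_mult; [apply Climit_const|].
  unfold eprod; clear - Hus hq q1 qnz.
  induction Hus as [|u x us l hu _ IH]; simpl; [apply Climit_const|].
  apply Climit_mult; trivial.
  apply Climit_eps; now apply (is_lim_seq_incr_n (fun n => Cmod (u n - x))).
Qed.

Lemma vwp_perm (a z : C) (l m : list C) (k : Z) : Permutation l m ->
  vwp a z l k = vwp a z m k.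
Proof.
intros H; unfold vwp, eprod; do 2 f_equal; apply Cprod_perm.
now apply Permutation_map.
Qed.

Lemma vwp_sum_perm (a z : C) (l m : list C) : Permutation l m ->
  vwp_sum a z l = vwp_sum a z m.
Proof.
intros H; unfold vwp_sum; f_equal; apply functional_extensionality; intros k.
now apply vwp_perm.
Qed.

Lemma qpochinf_root (n : nat) : P (/ q ^ n) = 0.
Proof.
rewrite (qpochinf_shift _ q (S n) q1); simpl; rewrite Cinv_l by now apply Cpow_nz.
ring.
Qed.

Lemma qpochinf_small_nz (x : C) : (Cmod x < 1)%R -> P x <> 0.
Proof.
intros hx; apply qpochinf_neq0; trivial; intros n; induction n as [|n IH]; simpl.
- apply C1_nz.
- apply Cmult_neq_0; trivial; intros E.
  assert (E' : x * q ^ n = 1) by (replace (x * q ^ n) with (1 - (1 - x * q ^ n)) by ring; rewrite E; ring).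
  apply (f_equal Cmod) in E'; rewrite Cmod_mult, Cmod_Cpow, Cmod_1 in E'.
  assert (Cmod q ^ n <= 1)%R by (rewrite <- (pow1 n); apply pow_incr; lra).
  pose proof (Cmod_ge_0 x).
  assert (0 <= Cmod q ^ n)%R by (apply pow_le; lra).
  nra.
Qed.

(** * Bailey's 6psi6 sum *)

Definition psi6 (a : C) (l : list C) : C := vwp_sum a (q * (a * a)) l.

Lemma psi6_perm (a : C) (l m : list C) : Permutation l m ->
  psi6 a l = psi6 a m.
Proof. intros H; exact (vwp_sum_perm a (q * (a * a)) l m H). Qed.

Lemma psi6_weight (a : C) : a <> 0 ->
  q * (a * a) <> 0 /\
  q * (a * a) * (q * (a * a)) * (q * q) = (q * a) ^ 4.
Proof.
intros ha; split; [|simpl; ring].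
repeat apply Cmult_neq_0; trivial.
Qed.

Lemma psi6_is_bilateral (a x1 x2 x3 x4 : C) : a <> 0 ->
  (Cmod (q * (a * a) * (x1 * (x2 * (x3 * x4)))) < 1)%R ->
  is_bilateral (vwp a (q * (a * a)) [x1; x2; x3; x4]) (psi6 a [x1; x2; x3; x4]).
Proof.
intros ha H; destruct (psi6_weight a ha) as [h1 h2].
apply vwp_is_bilateral; trivial; simpl; now rewrite Cmult_1_r.
Qed.

(** The discrete antiderivative for [psi6_term_rec]; its linear factors are those that [eps_succ]
    absorbs at k + 1. *)
Definition psi6_prim (a x1 x2 x3 y : C) (k : Z) : C :=
  Cpowz (q * (a * a)) k * (y / Cpowz q k)
  * Cprod (map (fun x => 1 - a * x * Cpowz q k) [x1; x2; x3; y])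
  * eprod a [x1; x2; x3; y] k.

Lemma psi6_prim_dominated (a x1 x2 x3 y : C) : a <> 0 ->
  (Cmod (a * a * x1 * x2 * x3 * y) < 1)%R ->
  exists M r, (0 <= r < 1)%R /\ dominated M r (psi6_prim a x1 x2 x3 y).
Proof.
intros ha H.
assert (a0 : (0 < Cmod (a * a))%R) by (apply Cmod_gt_0; now apply Cmult_neq_0).
assert (q0 : (0 < Cmod q)%R) by lra.
set (l := [x1; x2; x3; y]).
destruct (Cprod_strict_bounds l (/ Cmod (a * a))) as (rs & H1 & H2 & H3).
{ apply (Rmult_lt_reg_l (Cmod (a * a))); trivial; rewrite Rinv_r by lra.
  rewrite <- Cmod_mult.
  replace (a * a * Cprod l) with (a * a * x1 * x2 * x3 * y) by (simpl; ring).
  exact H. }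
destruct (eprod_bound a rs ha H1) as (M & p & HM).
assert (hl : length rs = 4%nat) by (rewrite <- (Forall2_length H2); reflexivity).
specialize (HM l ltac:(clear - H2; induction H2; constructor; trivial; lra)).
rewrite hl in HM.
set (B := fold_right Rmult 1%R (map (fun x => 1 + Cmod (a * x))%R l)).
assert (B0 : (0 <= B)%R).
{ unfold B; generalize l; intros m; induction m as [|x m IH]; simpl; [lra|].
  apply Rmult_le_pos; trivial; pose proof (Cmod_ge_0 (a * x)); lra. }
(* Used with c = 1 at k = n and with c = |q|^(-n) at k = -n, where the four linear factors grow; the
   factor |qa|^(4n) in the bound for [eprod] compensates this. *)
assert (hf : forall k c, (Cmod (Cpowz q k) <= c)%R -> (1 <= c)%R ->
   (Cmod (Cprod (map (fun x => 1 - a * x * Cpowz q k)%C l)) <= B * c ^ 4)%R).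
{ intros k c h1 h2; unfold B.
  replace 4%nat with (length l) by reflexivity.
  generalize l; intros m; induction m as [|x m IH].
  - simpl; rewrite Cmod_1; lra.
  - simpl; rewrite Cmod_mult.
    replace ((1 + Cmod (a * x)) * fold_right Rmult 1 (map (fun x0 : C => 1 + Cmod (a * x0)) m) * (c * c ^ length m))%R
      with ((1 + Cmod (a * x)) * c * (fold_right Rmult 1 (map (fun x0 : C => 1 + Cmod (a * x0)) m) * c ^ length m))%R by ring.
    apply Rmult_le_compat; try apply Cmod_ge_0; trivial.
    eapply Rle_trans; [apply Cmod_triangle|].
    rewrite Cmod_1, Cmod_opp, (Cmod_mult (a * x)).
    pose proof (Cmod_ge_0 (a * x)) as h3.
    pose proof (Rmult_le_compat_l _ _ _ h3 h1); lra. }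
assert (qn : forall n, (0 < Cmod q ^ n <= 1)%R).
{ intros n; split; [now apply pow_lt|].
  rewrite <- (pow1 n); apply pow_incr; lra. }
exists (Cmod y * B * M)%R, (Cmod (a * a) * Rprod rs)%R; split.
{ split; [apply Rmult_le_pos; [lra|left; now apply Rprod_pos]|].
  apply (Rmult_lt_compat_l (Cmod (a * a))) in H3; trivial; rewrite Rinv_r in H3; lra. }
intros n; destruct (HM n) as [e1 e2]; destruct (qn n) as [qn0 qn1].
unfold psi6_prim; fold l; split.
- specialize (hf (Z.of_nat n) 1%R).
  rewrite !Cpowz_of_nat, Cmod_Cpow in *.
  specialize (hf qn1 (Rle_refl _)); rewrite pow1, Rmult_1_r in hf.
  replace ((q * (a * a)) ^ n * (y / q ^ n)) with (y * (a * a) ^ n).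
  2:{ rewrite (Cpow_mult_l q (a * a)); pose proof (Cpow_nz q n qnz) as h; revert h.
      generalize (q ^ n) ((a * a) ^ n); intros; field; auto. }
  rewrite !Cmod_mult, Cmod_Cpow, (Cmod_mult a a).
  rewrite (Rpow_mult_distr (Cmod a * Cmod a)).
  replace (Cmod y * B * M * ((Cmod a * Cmod a) ^ n * Rprod rs ^ n))%R
    with (Cmod y * (Cmod a * Cmod a) ^ n * B * (M * Rprod rs ^ n))%R by ring.
  apply Rmult_le_compat; try apply Cmod_ge_0; trivial.
  + apply Rmult_le_pos; [|apply Cmod_ge_0].
    apply Rmult_le_pos; [apply Cmod_ge_0|apply pow_le].
    apply Rmult_le_pos; apply Cmod_ge_0.
  + apply Rmult_le_compat_l; trivial.
    apply Rmult_le_pos; [apply Cmod_ge_0|apply pow_le].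
    apply Rmult_le_pos; apply Cmod_ge_0.
- specialize (hf (- Z.of_nat n)%Z (/ Cmod q ^ n)%R).
  rewrite !Cpowz_opp_of_nat in *.
  assert (E : Cmod (/ q ^ n) = (/ Cmod q ^ n)%R).
  { rewrite Cmod_inv, Cmod_Cpow; trivial; now apply Cpow_nz. }
  rewrite E in hf; specialize (hf (Rle_refl _)).
  assert (i1 : (1 <= / Cmod q ^ n)%R).
  { rewrite <- Rinv_1; apply Rinv_le_contravar; lra. }
  specialize (hf i1).
  replace (/ (q * (a * a)) ^ n * (y / / q ^ n)) with (y * / (a * a) ^ n).
  2:{ rewrite (Cpow_mult_l q (a * a)); pose proof (Cpow_nz q n qnz) as h; revert h.
      pose proof (Cpow_nz (a * a) n (Cmult_neq_0 _ _ ha ha)) as h; revert h.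
      generalize (q ^ n) ((a * a) ^ n); intros; field; auto. }
  rewrite !Cmod_mult, Cmod_inv, Cmod_Cpow.
  2:{ now apply Cpow_nz, Cmult_neq_0. }
  replace (Cmod y * B * M * (Cmod a * Cmod a * Rprod rs) ^ n)%R
    with (Cmod y * / Cmod (a * a) ^ n * (B * (/ Cmod q ^ n) ^ 4)
          * (M * (Cmod (q * a) ^ 4 * Rprod rs) ^ n))%R.
  2:{ rewrite !Cmod_mult; rewrite Cmod_mult in a0.
      assert (Cmod a <> 0)%R by (intros E0; rewrite E0 in a0; lra).
      rewrite !Rpow_mult_distr, <- !pow_mult, !(Nat.mul_comm 4 n), !pow_mult.
      field; repeat split; try (apply pow_nonzero; trivial; lra). }
  assert (g : (0 <= Cmod y * / Cmod (a * a) ^ n)%R).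
  { apply Rmult_le_pos; [apply Cmod_ge_0|].
    left; apply Rinv_0_lt_compat, pow_lt; lra. }
  apply Rmult_le_compat; try apply Cmod_ge_0; trivial.
  + apply Rmult_le_pos; trivial; apply Cmod_ge_0.
  + now apply Rmult_le_compat_l.
Qed.

(** By [eps_succ], applied to all four variables, [psi6_prim] at k + 1 is the weight times a^2
    (y/u)(u - x1)(u - x2)(u - x3)(u - y) times the product of the [eps] at k, where u = q^k. All
    terms then share that product, and a rational identity in u remains. *)
Lemma psi6_term_rec (a x1 x2 x3 y : C) (k : Z) : a <> 0 ->
  (1 - a * a * x1 * x2 * x3 * y) * vwp a (q * (a * a)) [x1; x2; x3; y / q] k
  + (- ((1 - a * x1 * y) * (1 - a * x2 * y) * (1 - a * x3 * y)))
    * vwp a (q * (a * a)) [x1; x2; x3; y] k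
  = psi6_prim a x1 x2 x3 y (k + 1) - psi6_prim a x1 x2 x3 y k.
Proof.
intros ha; unfold psi6_prim, vwp, eprod; simpl.
rewrite !Cpowz_succ by (try exact qnz; apply (psi6_weight a ha)).
rewrite (eps_div_q).
pose proof (eps_succ a x1 k) as E1; pose proof (eps_succ a x2 k) as E2.
pose proof (eps_succ a x3 k) as E3; pose proof (eps_succ a y k) as E4.
pose proof (Cpowz_nz q k qnz) as hu; set (u := Cpowz q k) in *.
set (w := Cpowz (q * (a * a)) k).
replace (w * (q * (a * a)) * (y / (u * q)) *
   ((1 - a * x1 * (u * q)) *
    ((1 - a * x2 * (u * q)) * ((1 - a * x3 * (u * q)) * ((1 - a * y * (u * q)) * 1)))) *
   (eps a x1 (k + 1) *
    (eps a x2 (k + 1) * (eps a x3 (k + 1) * (eps a y (k + 1) * 1)))))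
  with (w * (a * a) * (y / u) *
    (((1 - q * a * x1 * u) * eps a x1 (k + 1)) *
     ((1 - q * a * x2 * u) * eps a x2 (k + 1)) *
     ((1 - q * a * x3 * u) * eps a x3 (k + 1)) *
     ((1 - q * a * y * u) * eps a y (k + 1)))) by (field; auto).
rewrite E1, E2, E3, E4.
set (e1 := eps a x1 k); set (e2 := eps a x2 k);
set (e3 := eps a x3 k); set (e4 := eps a y k).
field; auto.
Qed.

Lemma psi6_rec (a x1 x2 x3 y : C) : a <> 0 ->
  (Cmod (a * a * x1 * x2 * x3 * y) < 1)%R ->
  (1 - a * a * x1 * x2 * x3 * y) * psi6 a [x1; x2; x3; y / q]
  = (1 - a * x1 * y) * (1 - a * x2 * y) * (1 - a * x3 * y)
    * psi6 a [x1; x2; x3; y].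
Proof.
intros ha H.
destruct (psi6_prim_dominated a x1 x2 x3 y ha H) as (M & r & hr & D).
pose proof (is_bilateral_telescope M r _ hr D) as T.
assert (h1 : is_bilateral (vwp a (q * (a * a)) [x1; x2; x3; y / q]) (psi6 a [x1; x2; x3; y / q])).
{ apply psi6_is_bilateral; trivial.
  replace (q * (a * a) * (x1 * (x2 * (x3 * (y / q))))) with (a * a * x1 * x2 * x3 * y)
    by (field; auto); trivial. }
assert (h2 : is_bilateral (vwp a (q * (a * a)) [x1; x2; x3; y]) (psi6 a [x1; x2; x3; y])).
{ apply psi6_is_bilateral; trivial.
  replace (q * (a * a) * (x1 * (x2 * (x3 * y)))) with (q * (a * a * x1 * x2 * x3 * y))
    by ring.
  rewrite Cmod_mult; pose proof (Cmod_ge_0 (a * a * x1 * x2 * x3 * y)); nra. }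
pose proof (is_bilateral_lin (1 - a * a * x1 * x2 * x3 * y)
  (- ((1 - a * x1 * y) * (1 - a * x2 * y) * (1 - a * x3 * y))) _ _ _ _ h1 h2) as h3.
pose proof (is_bilateral_ext _ _ _ (fun k => psi6_term_rec a x1 x2 x3 y k ha) h3) as h4.
pose proof (is_bilateral_eq _ _ _ h4 T) as E.
set (L := (1 - a * a * x1 * x2 * x3 * y) * psi6 a [x1; x2; x3; y / q]) in *.
match goal with |- L = ?r => replace L with (L - r + r) by ring;
  replace (L - r) with (RtoC 0); [ring|rewrite <- E; ring] end.
Qed.

Lemma psi6_limit (a x1 x2 x3 : C) (u : nat -> C) : a <> 0 -> Climit u 0 ->
  Climit (fun n => psi6 a [x1; x2; x3; u n]) (psi6 a [x1; x2; x3; RtoC 0]).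
Proof.
intros ha Hu; destruct (psi6_weight a ha) as [h1 h2].
apply (vwp_sum_limit a (q * (a * a))
  [fun _ => x1; fun _ => x2; fun _ => x3; u] [x1; x2; x3; RtoC 0]); trivial.
- replace (q * (a * a) * Cprod [x1; x2; x3; RtoC 0]) with (RtoC 0) by (simpl; ring).
  rewrite Cmod_0; lra.
- repeat constructor; trivial; apply Climit_const.
Qed.

Lemma psi6_extract (a x1 x2 x3 x : C) : a <> 0 ->
  (Cmod (q * (a * a) * (x1 * (x2 * (x3 * x)))) < 1)%R ->
  P (q * (a * a) * (x1 * (x2 * (x3 * x)))) * psi6 a [x1; x2; x3; x]
  = P (q * a * x1 * x) * P (q * a * x2 * x) * P (q * a * x3 * x)
    * psi6 a [x1; x2; x3; RtoC 0].
Proof.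
intros ha H; set (t := q * (a * a) * (x1 * (x2 * (x3 * x)))) in *.
assert (E : forall n, qpochn t q n * psi6 a [x1; x2; x3; x]
  = qpochn (q * a * x1 * x) q n * qpochn (q * a * x2 * x) q n
    * qpochn (q * a * x3 * x) q n * psi6 a [x1; x2; x3; x * q ^ n]).
{ intros n; induction n as [|n IH]; simpl qpochn.
  - simpl; rewrite !Cmult_1_r; ring.
  - replace (qpochn t q n * (1 - t * q ^ n) * psi6 a [x1; x2; x3; x])
      with ((1 - t * q ^ n) * (qpochn t q n * psi6 a [x1; x2; x3; x])) by ring.
    rewrite IH.
    (* With y = x q^(n+1) one has y/q = x q^n and a^2 x1 x2 x3 y = t q^n, so the convergence
       condition follows from |t| < 1. *)
    pose proof (psi6_rec a x1 x2 x3 (x * q ^ S n) ha) as R.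
    replace (a * a * x1 * x2 * x3 * (x * q ^ S n)) with (t * q ^ n) in R
      by (unfold t; simpl; ring).
    replace (x * q ^ S n / q) with (x * q ^ n) in R by (simpl; field; auto).
    assert (B : (Cmod (t * q ^ n) < 1)%R).
    { rewrite Cmod_mult, Cmod_Cpow.
      assert (Cmod q ^ n <= 1)%R by (rewrite <- (pow1 n); apply pow_incr; lra).
      assert (0 <= Cmod q ^ n)%R by (apply pow_le; lra).
      pose proof (Cmod_ge_0 t); nra. }
    specialize (R B).
    match goal with |- _ * (?A * _) = _ =>
      replace ((1 - t * q ^ n) * (A * psi6 a [x1; x2; x3; x * q ^ n]))
      with (A * ((1 - t * q ^ n) * psi6 a [x1; x2; x3; x * q ^ n])) by ring end.
    rewrite R; simpl (q ^ S n); ring. }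
apply (Climit_unique (fun n => qpochn t q n * psi6 a [x1; x2; x3; x])).
- apply Climit_mult; [now apply qpochinf_limit | apply Climit_const].
- eapply Climit_ext; [intros n; symmetry; apply E|].
  repeat apply Climit_mult; try (now apply qpochinf_limit).
  apply psi6_limit; trivial; now apply Climit_pow.
Qed.

(** Once a variable is 0, the argument of the series is 0: the product on the left of [psi6_extract]
    becomes 1 and no restriction on x remains. *)
Lemma psi6_extract_0 (a x1 x2 x : C) : a <> 0 ->
  psi6 a [x1; x2; RtoC 0; x]
  = P (q * a * x1 * x) * P (q * a * x2 * x) * psi6 a [x1; x2; RtoC 0; RtoC 0].
Proof.
intros ha.
pose proof (psi6_extract a x1 x2 0 x ha) as E.
replace (q * (a * a) * (x1 * (x2 * (0 * x)))) with (RtoC 0) in E by ring.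
replace (q * a * 0 * x) with (RtoC 0) in E by ring.
rewrite Cmod_0, (qpochinf_0 q q1), Cmult_1_l, Cmult_1_r in E.
apply E; lra.
Qed.

(* At [x1 = 1/a] the terms with k < 0 vanish and at [x2 = 1] those with k > 0. *)
Lemma psi6_zero (a : C) : a <> 0 -> psi6 a [RtoC 0; RtoC 0; RtoC 0; RtoC 0] = P q * theta a q.
Proof.
intros ha.
(* The value sought is Jacobi's triple product with even and odd terms paired. Extracting the
   variables 1 and 1/a costs only the factor [P q], from q a (1/a) = q; the resulting series
   consists of its term k = 0. *)
assert (E1 : psi6 a [RtoC 1; / a; RtoC 0; RtoC 0] = P q * psi6 a [RtoC 0; RtoC 0; RtoC 0; RtoC 0]).
{ rewrite (psi6_perm _ _ [/ a; RtoC 0; RtoC 0; RtoC 1]).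
  2:{ apply (Permutation_cons_app [/ a; RtoC 0; RtoC 0] []); simpl; reflexivity. }
  rewrite psi6_extract_0 by trivial.
  replace (q * a * / a * 1) with q by (field; auto).
  replace (q * a * 0 * 1) with (RtoC 0) by ring.
  rewrite qpochinf_0, Cmult_1_r by trivial; f_equal.
  rewrite (psi6_perm _ _ [RtoC 0; RtoC 0; RtoC 0; / a]).
  2:{ apply (Permutation_cons_app [RtoC 0; RtoC 0; RtoC 0] []); simpl; reflexivity. }
  rewrite psi6_extract_0 by trivial.
  replace (q * a * 0 * / a) with (RtoC 0) by ring.
  rewrite qpochinf_0 by trivial; ring. }
assert (V : forall k, k <> 0%Z -> vwp a (q * (a * a)) [RtoC 1; / a; RtoC 0; RtoC 0] k = 0).
{ intros k hk; unfold vwp, eprod; simpl.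
  destruct (Z_nat_cases k) as [[[|n] ->]|[n ->]]; [now elim hk| |].
  - replace (eps a 1 (Z.of_nat (S n))) with (RtoC 0); [ring|].
    unfold eps; rewrite Cpowz_of_nat; pose proof (Cpow_nz q n qnz).
    replace (q * 1 / q ^ S n) with (/ q ^ n) by (simpl; field; auto).
    rewrite qpochinf_root; ring.
  - replace (eps a (/ a) (- Z.of_nat (S n))) with (RtoC 0); [ring|].
    unfold eps; rewrite Cpowz_opp_of_nat; pose proof (Cpow_nz q n qnz).
    replace (q * a * / a * / q ^ S n) with (/ q ^ n) by (simpl; field; auto).
    rewrite qpochinf_root; ring. }
assert (E2 : psi6 a [RtoC 1; / a; RtoC 0; RtoC 0] = P q * (P q * theta a q)).
{ unfold psi6, vwp_sum; rewrite (is_bilateral_unique _ _ (is_bilateral_single _ V)).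
  unfold vwp, eprod; simpl; rewrite !eps_0 by trivial.
  unfold eps; change (tri 0) with 0%Z; simpl.
  replace (q * 1 / 1) with q by (field; auto).
  replace (q * a * 1 * 1) with (a * q) by ring.
  replace (q * / a / 1) with (q / a) by (field; auto).
  replace (q * a * / a * 1) with q by (field; auto).
  rewrite theta_eq, (qpochinf_succ a q q1); ring. }
assert (hP : P q <> 0) by now apply qpochinf_small_nz.
rewrite E2 in E1.
replace (psi6 a [RtoC 0; RtoC 0; RtoC 0; RtoC 0]) with (/ P q * (P q * psi6 a [RtoC 0; RtoC 0; RtoC 0; RtoC 0])) by (field; auto).
rewrite <- E1; field; auto.
Qed.

(* Bailey's 6psi6 sum; [x1], .., [x4] are the reciprocals of its parameters. *)
Lemma psi6_sum (a x1 x2 x3 x4 : C) : a <> 0 ->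
  (Cmod (q * (a * a) * (x1 * (x2 * (x3 * x4)))) < 1)%R ->
  P (q * (a * a) * (x1 * (x2 * (x3 * x4)))) * psi6 a [x1; x2; x3; x4]
  = P q * theta a q
    * (P (q * a * x1 * x2) * P (q * a * x1 * x3) * P (q * a * x1 * x4)
       * P (q * a * x2 * x3) * P (q * a * x2 * x4) * P (q * a * x3 * x4)).
Proof.
intros ha H; rewrite psi6_extract by trivial.
assert (E3 : psi6 a [x1; x2; x3; RtoC 0]
  = P (q * a * x1 * x3) * P (q * a * x2 * x3) * psi6 a [x1; x2; RtoC 0; RtoC 0]).
{ transitivity (psi6 a [x1; x2; RtoC 0; x3]); [|exact (psi6_extract_0 a x1 x2 x3 ha)].
  apply psi6_perm; do 2 apply perm_skip; apply perm_swap. }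
assert (E2 : psi6 a [x1; x2; RtoC 0; RtoC 0] = P (q * a * x1 * x2) * psi6 a [x1; RtoC 0; RtoC 0; RtoC 0]).
{ pose proof (psi6_extract_0 a x1 0 x2 ha) as E.
  replace (q * a * 0 * x2) with (RtoC 0) in E by ring.
  rewrite qpochinf_0, Cmult_1_r in E by trivial; rewrite <- E.
  apply psi6_perm, perm_skip, (Permutation_cons_app [RtoC 0; RtoC 0] []); reflexivity. }
assert (E1 : psi6 a [x1; RtoC 0; RtoC 0; RtoC 0] = psi6 a [RtoC 0; RtoC 0; RtoC 0; RtoC 0]).
{ pose proof (psi6_extract_0 a 0 0 x1 ha) as E.
  replace (q * a * 0 * x1) with (RtoC 0) in E by ring.
  rewrite qpochinf_0, !Cmult_1_l in E by trivial; rewrite <- E.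
  apply psi6_perm, (Permutation_cons_app [RtoC 0; RtoC 0; RtoC 0] []); reflexivity. }
rewrite E3, E2, E1, psi6_zero by trivial; ring.
Qed.

(** * The theta addition formula *)

Lemma Climit_theta (u : nat -> C) (l : C) : l <> 0 -> Climit u l ->
  Climit (fun n => th (u n)) (th l).
Proof.
intros hl H; rewrite theta_eq.
apply Climit_ext with (fun n => P (u n) * P (q / u n)).
{ intros n; now rewrite theta_eq. }
apply Climit_mult; apply Climit_qpochinf; trivial.
apply Climit_div; trivial; apply Climit_const.
Qed.

Lemma qpochinf_eq0 (x : C) : P x = 0 -> exists n, x * q ^ n = 1.
Proof.
intros H; apply NNPP; intros N; revert H; apply qpochinf_neq0; trivial.
intros n; induction n as [|n IH]; simpl; [apply C1_nz|].
apply Cmult_neq_0; trivial; intros E; apply N; exists n.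
replace (x * q ^ n) with (1 - (1 - x * q ^ n)) by ring; rewrite E; ring.
Qed.

Lemma theta_eq0 (z : C) : z <> 0 -> th z = 0 -> exists k, z = Cpowz q k.
Proof.
intros hz H; rewrite theta_eq in H.
destruct (classic (P z = 0)) as [E|E].
- destruct (qpochinf_eq0 _ E) as [n Hn]; exists (- Z.of_nat n)%Z.
  rewrite Cpowz_opp_of_nat; pose proof (Cpow_nz q n qnz) as h.
  replace z with (z * q ^ n * / q ^ n) by (field; auto).
  rewrite Hn; ring.
- assert (E' : P (q / z) = 0).
  { apply NNPP; intros N; now apply (Cmult_neq_0 _ _ E N). }
  destruct (qpochinf_eq0 _ E') as [n Hn]; exists (Z.of_nat (S n)).
  rewrite Cpowz_of_nat; simpl.
  replace z with (z * (q / z * q ^ n)) at 1 by (rewrite Hn; ring).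
  field; auto.
Qed.

Lemma Cmod_Cpowz_gap (k : Z) (t : R) : (1 < t < / Cmod q)%R ->
  Cmod (Cpowz q k) <> t.
Proof.
intros [t1 t2] E.
assert (le1 : forall n, (0 < Cmod q ^ n <= 1)%R).
{ intros n; split; [apply pow_lt; lra|].
  rewrite <- (pow1 n); apply pow_incr; lra. }
destruct (Z_nat_cases k) as [[n ->]|[n ->]].
- rewrite Cpowz_of_nat, Cmod_Cpow in E; pose proof (le1 n); lra.
- rewrite Cpowz_opp_of_nat, Cmod_inv, Cmod_Cpow in E by now apply Cpow_nz.
  pose proof (le1 n) as l1.
  assert (/ Cmod q <= / Cmod q ^ S n)%R; [|lra].
  apply Rinv_le_contravar; [apply pow_lt; lra|].
  simpl; pose proof (Rmult_le_compat_l (Cmod q) _ _ (Cmod_ge_0 q) (proj2 l1)); lra.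
Qed.

(** The zeros of theta are the powers of q. If z is one, it is scaled by reals t_n in (1, 1/|q|)
    decreasing to 1, so that |t_n z| lies strictly between consecutive powers of |q|. This lets
    factors that may vanish be removed by continuity. *)
Lemma theta_generic (z : C) : z <> 0 ->
  exists u, Climit u z /\ forall n, u n <> 0 /\ th (u n) <> 0.
Proof.
intros hz; destruct (classic (th z = 0)) as [E|E].
2:{ exists (fun _ => z); split; [apply Climit_const|auto]. }
destruct (theta_eq0 z hz E) as [k Hk].
set (d := (/ Cmod q - 1)%R).
assert (d0 : (0 < d)%R).
{ unfold d; assert (1 < / Cmod q)%R; [|lra].
  rewrite <- Rinv_1; apply Rinv_lt_contravar; lra. }
assert (s : forall n, (0 < / (INR n + 2) < 1)%R).
{ intros n; pose proof (pos_INR n); split; [apply Rinv_0_lt_compat; lra|].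
  rewrite <- Rinv_1; apply Rinv_lt_contravar; lra. }
set (t := fun n => (1 + d * / (INR n + 2))%R).
assert (ht : forall n, (1 < t n < / Cmod q)%R).
{ intros n; unfold t; pose proof (s n).
  assert (0 < d * / (INR n + 2))%R by (apply Rmult_lt_0_compat; lra).
  assert (d * / (INR n + 2) < d)%R by nra.
  unfold d in *; lra. }
exists (fun n => z * t n); split.
- replace z with (z * 1) at 1 by ring; apply Climit_mult; [apply Climit_const|].
  apply (Climit_squeeze _ _ (fun n => d * / (INR n + 2))%R).
  + intros n; rewrite <- RtoC_minus, Cmod_R; unfold t.
    pose proof (s n).
    assert (0 < d * / (INR n + 2))%R by (apply Rmult_lt_0_compat; lra).
    rewrite Rabs_pos_eq; lra.
  + replace 0%R with (d * 0)%R by ring.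
    apply is_lim_seq_mult'; [apply is_lim_seq_const|].
    apply (is_lim_seq_inv (fun n => INR n + 2)%R p_infty); [|discriminate].
    eapply is_lim_seq_plus; [apply is_lim_seq_INR|apply is_lim_seq_const|reflexivity].
- intros n; specialize (ht n).
  assert (tn : RtoC (t n) <> 0).
  { intros E1; apply RtoC_inj in E1; lra. }
  assert (hzt : z * t n <> 0) by now apply Cmult_neq_0.
  split; trivial; intros E1.
  destruct (theta_eq0 _ hzt E1) as [m Hm].
  apply (Cmod_Cpowz_gap (m - k) (t n) ht).
  replace (m - k)%Z with (m + - k)%Z by ring.
  rewrite Cpowz_add, Cpowz_opp, <- Hm, <- Hk by trivial.
  replace (z * t n * / z) with (RtoC (t n)) by (field; auto).
  rewrite Cmod_R, Rabs_pos_eq; lra.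
Qed.

(** With two pairs the argument of the 6psi6 is q, so it always converges. The factors c - b and 1 -
    a/(bc) supply the first factors that the products of Bailey's sum lack to be thetas. *)
Lemma psi6_two_pairs (a b c : C) : a <> 0 -> b <> 0 -> c <> 0 ->
  is_bilateral (vwp a (q * (a * a)) [/ b; b / a; / c; c / a])
    (psi6 a [/ b; b / a; / c; c / a]) /\
  (c - b) * (1 - a / (b * c)) * psi6 a [/ b; b / a; / c; c / a]
  = th a * (P q * P q) * (c * th (b / c) * th (a / (b * c))).
Proof.
intros ha hb hc.
assert (E : q * (a * a) * (/ b * (b / a * (/ c * (c / a)))) = q) by (field; auto).
assert (D : (Cmod (q * (a * a) * (/ b * (b / a * (/ c * (c / a))))) < 1)%R)
  by now rewrite E.
split; [now apply psi6_is_bilateral|].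
pose proof (psi6_sum a _ _ _ _ ha D) as S; rewrite E in S.
assert (hP : P q <> 0) by now apply qpochinf_small_nz.
replace (q * a * / b * (b / a)) with q in S by (field; auto).
replace (q * a * / b * / c) with (q * (a / (b * c))) in S by (field; auto).
replace (q * a * / b * (c / a)) with (q / (b / c)) in S by (field; auto).
replace (q * a * (b / a) * / c) with (q * (b / c)) in S by (field; auto).
replace (q * a * (b / a) * (c / a)) with (q / (a / (b * c))) in S by (field; auto).
replace (q * a * / c * (c / a)) with q in S by (field; auto).
set (s := psi6 a [/ b; b / a; / c; c / a]) in *.
rewrite (theta_eq (b / c)), (theta_eq (a / (b * c))).
rewrite (qpochinf_succ (b / c)), (qpochinf_succ (a / (b * c))) by trivial.
replace (b / c * q) with (q * (b / c)) by ring.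
replace (a / (b * c) * q) with (q * (a / (b * c))) by ring.
replace s with (/ P q * (P q * s)) by (field; auto); rewrite S.
field; auto.
Qed.

(** Put s(b) = b + a/b. Then (c - b)(1 - a/(bc)) = s(c) - s(b) and (1 - d u)(1 - a u/d) = 1 + a u^2
    - u s(d), and the cyclic sum over b, c, d of (s(c) - s(b))(1 + a u^2 - u s(d)) is 0. By
    [eps_pair] this makes a combination of three 6psi6 vanish term by term; their sums are known
    from [psi6_two_pairs]. *)
Lemma theta_addition_aux (a b c d : C) : a <> 0 -> b <> 0 -> c <> 0 -> d <> 0 ->
  th a * (th d * th (a / d) * (c * th (b / c) * th (a / (b * c)))
   + th b * th (a / b) * (d * th (c / d) * th (a / (c * d)))
   + th c * th (a / c) * (b * th (d / b) * th (a / (d * b)))) = 0.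
Proof.
intros ha hb hc hd.
destruct (psi6_two_pairs a b c ha hb hc) as [B1 E1].
destruct (psi6_two_pairs a c d ha hc hd) as [B2 E2].
destruct (psi6_two_pairs a d b ha hd hb) as [B3 E3].
set (s1 := psi6 a [/ b; b / a; / c; c / a]) in *.
set (s2 := psi6 a [/ c; c / a; / d; d / a]) in *.
set (s3 := psi6 a [/ d; d / a; / b; b / a]) in *.
pose proof (is_bilateral_lin (th d * th (a / d) * ((c - b) * (1 - a / (b * c))))
  (th b * th (a / b) * ((d - c) * (1 - a / (c * d)))) _ _ _ _ B1 B2) as B4.
pose proof (is_bilateral_lin 1
  (th c * th (a / c) * ((b - d) * (1 - a / (d * b)))) _ _ _ _ B4 B3) as B5.
assert (Z0 : is_bilateral (fun _ => RtoC 0) 0).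
{ apply (is_bilateral_single (fun _ => RtoC 0)); trivial. }
assert (B6 := fun H => is_bilateral_ext _ (fun _ => RtoC 0) _ H B5).
match type of B6 with ?H -> _ => assert (V : H) end.
{ intros k; unfold vwp, eprod; simpl.
  pose proof (eps_pair a b k ha hb) as F1.
  pose proof (eps_pair a c k ha hc) as F2.
  pose proof (eps_pair a d k ha hd) as F3.
  pose proof (Cpowz_nz q k qnz) as hu.
  assert (hm : Cpowz (/ a) k <> 0) by now apply Cpowz_nz, Cinv_nz.
  set (u := Cpowz q k) in *; set (m := Cpowz (/ a) k) in *.
  set (w := Cpowz (q * (a * a)) k).
  set (b1 := eps a (/ b) k) in *; set (b2 := eps a (b / a) k) in *.
  set (c1 := eps a (/ c) k) in *; set (c2 := eps a (c / a) k) in *.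
  set (d1 := eps a (/ d) k) in *; set (d2 := eps a (d / a) k) in *.
  replace (th b * th (a / b)) with ((1 - b * u) * (1 - a / b * u) * (b1 * b2) / m)
    by (rewrite F1; field; auto).
  replace (th c * th (a / c)) with ((1 - c * u) * (1 - a / c * u) * (c1 * c2) / m)
    by (rewrite F2; field; auto).
  replace (th d * th (a / d)) with ((1 - d * u) * (1 - a / d * u) * (d1 * d2) / m)
    by (rewrite F3; field; auto).
  field; auto. }
specialize (B6 V); pose proof (is_bilateral_eq _ _ _ B6 Z0) as E.
assert (hP : P q <> 0) by now apply qpochinf_small_nz.
match goal with |- ?g = _ => replace g with (/ (P q * P q) * (P q * P q * g)) by (field; auto) end.
match goal with |- _ * ?g = _ => replace g with (RtoC 0); [ring|] end.
rewrite <- E.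
replace (th d * th (a / d) * ((c - b) * (1 - a / (b * c))) * s1)
  with (th d * th (a / d) * ((c - b) * (1 - a / (b * c)) * s1)) by ring.
replace (th b * th (a / b) * ((d - c) * (1 - a / (c * d))) * s2)
  with (th b * th (a / b) * ((d - c) * (1 - a / (c * d)) * s2)) by ring.
replace (th c * th (a / c) * ((b - d) * (1 - a / (d * b))) * s3)
  with (th c * th (a / c) * ((b - d) * (1 - a / (d * b)) * s3)) by ring.
rewrite E1, E2, E3; ring.
Qed.

(* Weierstrass' three-term relation; the factor [th a] of [theta_addition_aux]
   is removed by continuity in [a]. *)
Lemma theta_addition (a b c d : C) : a <> 0 -> b <> 0 -> c <> 0 -> d <> 0 ->
  th d * th (a / d) * (c * th (b / c) * th (a / (b * c)))
  + th b * th (a / b) * (d * th (c / d) * th (a / (c * d)))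
  + th c * th (a / c) * (b * th (d / b) * th (a / (d * b))) = 0.
Proof.
intros ha hb hc hd.
destruct (theta_generic a ha) as (u & Hu & Hn).
assert (nz : forall x y : C, x <> 0 -> y <> 0 -> x / y <> 0).
{ intros x y hx hy; apply Cmult_neq_0; trivial; now apply Cinv_nz. }
assert (L : forall x : C, x <> 0 -> Climit (fun n => th (u n / x)) (th (a / x))).
{ intros x hx; apply Climit_theta; auto.
  apply Climit_div; trivial; apply Climit_const. }
apply (Climit_unique (fun n =>
  th d * th (u n / d) * (c * th (b / c) * th (u n / (b * c)))
  + th b * th (u n / b) * (d * th (c / d) * th (u n / (c * d)))
  + th c * th (u n / c) * (b * th (d / b) * th (u n / (d * b))))).
- apply Climit_plus; [apply Climit_plus|];
    (apply Climit_mult; (apply Climit_mult; [apply Climit_const | apply L]));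
    trivial; now apply Cmult_neq_0.
- apply Climit_ext with (fun _ => RtoC 0); [|apply Climit_const].
  intros n; destruct (Hn n) as [h1 h2].
  pose proof (theta_addition_aux (u n) b c d h1 hb hc hd) as E.
  match type of E with _ * ?g = _ =>
    replace g with (/ th (u n) * (th (u n) * g)) by (field; auto) end.
  rewrite E; ring.
Qed.

(** * The 8Psi8 with a pair of parameters b, a/b *)

Definition psi8 (a b : C) (l : list C) : C :=
  vwp_sum a (q * q * (a * a * a)) (/ b :: b / a :: l).

Lemma psi8_perm (a b : C) (l m : list C) : Permutation l m ->
  psi8 a b l = psi8 a b m.
Proof.
intros H; apply (vwp_sum_perm a (q * q * (a * a * a))).
now do 2 apply perm_skip.
Qed.

Lemma psi8_weight (a : C) : a <> 0 ->
  q * q * (a * a * a) <> 0 /\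
  q * q * (a * a * a) * (q * q * (a * a * a)) * (q * q) = (q * a) ^ 6.
Proof.
intros ha; split; [|simpl; ring].
repeat apply Cmult_neq_0; trivial.
Qed.

Lemma psi8_domain (a b x1 x2 x3 x4 : C) : a <> 0 -> b <> 0 ->
  q * q * (a * a * a) * Cprod [/ b; b / a; x1; x2; x3; x4]
  = q * (q * (a * a) * (x1 * (x2 * (x3 * x4)))).
Proof. intros ha hb; simpl; field; auto. Qed.

Lemma psi8_is_bilateral (a b x1 x2 x3 x4 : C) : a <> 0 -> b <> 0 ->
  (Cmod (q * (q * (a * a) * (x1 * (x2 * (x3 * x4))))) < 1)%R ->
  is_bilateral (vwp a (q * q * (a * a * a)) [/ b; b / a; x1; x2; x3; x4])
    (psi8 a b [x1; x2; x3; x4]).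
Proof.
intros ha hb H; destruct (psi8_weight a ha) as [h1 h2].
apply vwp_is_bilateral; trivial; now rewrite psi8_domain.
Qed.

Lemma psi8_limit (a b : C) (u1 u2 u3 u4 : nat -> C) (x1 x2 x3 x4 : C) :
  a <> 0 -> b <> 0 ->
  (Cmod (q * (q * (a * a) * (x1 * (x2 * (x3 * x4))))) < 1)%R ->
  Climit u1 x1 -> Climit u2 x2 -> Climit u3 x3 -> Climit u4 x4 ->
  Climit (fun n => psi8 a b [u1 n; u2 n; u3 n; u4 n]) (psi8 a b [x1; x2; x3; x4]).
Proof.
intros ha hb H H1 H2 H3 H4; destruct (psi8_weight a ha) as [h1 h2].
apply (vwp_sum_limit a (q * q * (a * a * a))
  [fun _ => / b; fun _ => b / a; u1; u2; u3; u4] [/ b; b / a; x1; x2; x3; x4]);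
  trivial.
- now rewrite psi8_domain.
- repeat constructor; trivial; apply Climit_const.
Qed.

Lemma weight_split (a : C) (k : Z) : a <> 0 ->
  Cpowz (q * q * (a * a * a)) k * Cpowz (/ a) k
  = Cpowz q k * Cpowz (q * (a * a)) k.
Proof.
intros ha; destruct (psi6_weight a ha) as [h1 _].
destruct (psi8_weight a ha) as [h2 _].
rewrite <- !Cpowz_mult; trivial; [|now apply Cinv_nz].
f_equal; field; auto.
Qed.

(** With u = q^k, (1 - y/u)(1 - a y u) = (1 - b y)(1 - a y/b) - (y/u)(1 - b u)(1 - a u/b). By
    [eps_pair] the last product cancels the pair, and the factors a^(-k) and q^(-k) so produced turn
    the weight q^2 a^3 into q a^2. *)
Lemma psi8_term_rec (a b x1 x2 x3 y : C) (k : Z) : a <> 0 -> b <> 0 ->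
  vwp a (q * q * (a * a * a)) [/ b; b / a; x1; x2; x3; y / q] k
  = ((1 - b * y) * (1 - a / b * y))
      * vwp a (q * q * (a * a * a)) [/ b; b / a; x1; x2; x3; y] k
    + (- (th b * th (a / b) * y)) * vwp a (q * (a * a)) [x1; x2; x3; y] k.
Proof.
intros ha hb; unfold vwp, eprod; simpl.
rewrite (eps_div_q).
pose proof (eps_pair a b k ha hb) as F.
pose proof (weight_split a k ha) as W.
pose proof (Cpowz_nz q k qnz) as hu.
assert (hm : Cpowz (/ a) k <> 0) by now apply Cpowz_nz, Cinv_nz.
set (u := Cpowz q k) in *; set (m := Cpowz (/ a) k) in *.
set (w8 := Cpowz (q * q * (a * a * a)) k) in *.
set (w6 := Cpowz (q * (a * a)) k) in *.
replace w6 with (w8 * m / u) by (rewrite W; field; auto).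
replace (th b * th (a / b)) with ((1 - b * u) * (1 - a / b * u)
    * (eps a (/ b) k * eps a (b / a) k) / m) by (rewrite F; field; auto).
field; auto.
Qed.

Lemma Cmod_mul_q_lt (x : C) : (Cmod x < 1)%R -> (Cmod (q * x) < 1)%R.
Proof.
intros H; rewrite Cmod_mult; pose proof (Cmod_ge_0 x); nra.
Qed.

Lemma psi8_rec (a b x1 x2 x3 y : C) : a <> 0 -> b <> 0 ->
  (Cmod (q * (a * a) * (x1 * (x2 * (x3 * y)))) < 1)%R ->
  psi8 a b [x1; x2; x3; y / q]
  = (1 - b * y) * (1 - a / b * y) * psi8 a b [x1; x2; x3; y]
    - th b * th (a / b) * y * psi6 a [x1; x2; x3; y].
Proof.
intros ha hb H.
assert (B1 : is_bilateral (vwp a (q * q * (a * a * a)) [/ b; b / a; x1; x2; x3; y / q])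
    (psi8 a b [x1; x2; x3; y / q])).
{ apply psi8_is_bilateral; trivial.
  replace (q * (q * (a * a) * (x1 * (x2 * (x3 * (y / q))))))
    with (q * (a * a) * (x1 * (x2 * (x3 * y)))) by (field; auto); trivial. }
assert (B2 : is_bilateral (vwp a (q * q * (a * a * a)) [/ b; b / a; x1; x2; x3; y])
    (psi8 a b [x1; x2; x3; y])).
{ apply psi8_is_bilateral; trivial; now apply Cmod_mul_q_lt. }
pose proof (psi6_is_bilateral a x1 x2 x3 y ha H) as B3.
pose proof (is_bilateral_lin ((1 - b * y) * (1 - a / b * y))
  (- (th b * th (a / b) * y)) _ _ _ _ B2 B3) as B4.
pose proof (is_bilateral_ext _ _ _
  (fun k => eq_sym (psi8_term_rec a b x1 x2 x3 y k ha hb)) B4) as B5.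
rewrite (is_bilateral_eq _ _ _ B1 B5); ring.
Qed.

Lemma psi8_rec_first (a b x1 x2 x3 y : C) : a <> 0 -> b <> 0 ->
  (Cmod (q * (a * a) * (x1 * (x2 * (x3 * y)))) < 1)%R ->
  psi8 a b [x1 / q; x2; x3; y]
  = (1 - b * x1) * (1 - a / b * x1) * psi8 a b [x1; x2; x3; y]
    - th b * th (a / b) * x1 * psi6 a [x1; x2; x3; y].
Proof.
intros ha hb H.
assert (p : forall x, Permutation [x; x2; x3; y] [x2; x3; y; x]).
{ intros x; apply (Permutation_cons_app [x2; x3; y] []); reflexivity. }
rewrite (psi8_perm _ _ _ _ (p (x1 / q))), (psi8_perm _ _ _ _ (p x1)).
rewrite (psi6_perm _ _ _ (p x1)); apply psi8_rec; trivial.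
replace (x2 * (x3 * (y * x1))) with (x1 * (x2 * (x3 * y))) by ring; trivial.
Qed.

Lemma psi8_rec_second (a b x1 x2 x3 y : C) : a <> 0 -> b <> 0 ->
  (Cmod (q * (a * a) * (x1 * (x2 * (x3 * y)))) < 1)%R ->
  psi8 a b [x1; x2 / q; x3; y]
  = (1 - b * x2) * (1 - a / b * x2) * psi8 a b [x1; x2; x3; y]
    - th b * th (a / b) * x2 * psi6 a [x1; x2; x3; y].
Proof.
intros ha hb H.
assert (p : forall x, Permutation [x1; x; x3; y] [x; x1; x3; y])
  by (intros x; apply perm_swap).
rewrite (psi8_perm _ _ _ _ (p (x2 / q))), (psi8_perm _ _ _ _ (p x2)).
rewrite (psi6_perm _ _ _ (p x2)); apply psi8_rec_first; trivial.
replace (x2 * (x1 * (x3 * y))) with (x1 * (x2 * (x3 * y))) by ring; trivial.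
Qed.

(** The parameters c and qa/c cancel by [eps_reflect]; the geometric factor (qa)^(-k) left behind
    turns the weight q^2 a^3 into q a^2. *)
Lemma psi8_reflect (a b c x y : C) : a <> 0 -> b <> 0 -> c <> 0 ->
  (Cmod (q * a * x * y) < 1)%R ->
  psi8 a b [/ c; x; y; c / (q * a)]
  = th c * th (c / a) * psi6 a [/ b; b / a; x; y].
Proof.
intros ha hb hc H.
assert (B1 : is_bilateral (vwp a (q * q * (a * a * a)) [/ b; b / a; / c; x; y; c / (q * a)])
    (psi8 a b [/ c; x; y; c / (q * a)])).
{ apply psi8_is_bilateral; trivial.
  replace (q * (q * (a * a) * (/ c * (x * (y * (c / (q * a)))))))
    with (q * a * x * y) by (field; auto); trivial. }
assert (B2 : is_bilateral (vwp a (q * (a * a)) [/ b; b / a; x; y])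
    (psi6 a [/ b; b / a; x; y])).
{ apply psi6_is_bilateral; trivial.
  replace (q * (a * a) * (/ b * (b / a * (x * y))))
    with (q * a * x * y) by (field; auto); trivial. }
pose proof (is_bilateral_scal (th c * th (c / a)) _ _ B2) as B3.
apply (is_bilateral_eq _ _ _ B1); eapply is_bilateral_ext; [|exact B3].
intros k; unfold vwp, eprod; simpl.
pose proof (eps_reflect a c k ha hc) as F.
rewrite Cpowz_inv in F by now apply Cmult_neq_0.
assert (hm : Cpowz (q * a) k <> 0) by (apply Cpowz_nz; now apply Cmult_neq_0).
assert (W : Cpowz (q * q * (a * a * a)) k = Cpowz (q * a) k * Cpowz (q * (a * a)) k).
{ rewrite <- Cpowz_mult.
  - f_equal; ring.
  - now apply Cmult_neq_0.
  - repeat apply Cmult_neq_0; trivial. }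
rewrite W; set (m := Cpowz (q * a) k) in *.
replace (th c * th (c / a)) with (m * (eps a (/ c) k * eps a (c / (q * a)) k))
  by (rewrite F; field; auto).
ring.
Qed.

(** * The difference of the two series and its value at f = oo *)

(* For [u = 1/c, v = 1/d, w = 1/e] and [q a a' u v w = b] one has
   [a' = b c d e / (q a)]; then [x = 1/(a' f)] gives the two series of the
   theorem, and [a], [a'] play symmetric roles. *)
Definition kfac (a b u v w : C) : C :=
  th (a / b) * th a / a * (P (q * a * u * v) * P (q * a * u * w) * P (q * a * v * w)).

Definition ndiff (a a' b u v w x : C) : C :=
  kfac a' b u v w * P (q * a * b * x) * psi8 a b [u; v; w; a' * x]
  - kfac a b u v w * P (q * a' * b * x) * psi8 a' b [u; v; w; a * x].

Section Balanced.

Variables a a' b u v w : C.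
Hypotheses (ha : a <> 0) (ha' : a' <> 0) (hb : b <> 0).
Hypothesis bal : q * a * a' * (u * v * w) = b.

(** The prefactors are chosen so that the 6psi6 contributions agree: by the balance their arguments
    are a b y and a' b y, and Bailey's sum makes kernel times product times 6psi6 symmetric in a and
    a'. The homogeneous parts acquire the same three factors, one of them from [P (a b y)] or
    [P (a' b y)]. *)
Lemma ndiff_rec (y : C) :
  (Cmod (a * b * y) < 1)%R -> (Cmod (a' * b * y) < 1)%R ->
  ndiff a a' b u v w (y / q)
  = (1 - a * b * y) * (1 - a' * b * y) * (1 - a * a' / b * y)
    * ndiff a a' b u v w y.
Proof.
intros H1 H2; unfold ndiff.
assert (E1 : q * (a * a) * (u * (v * (w * (a' * y)))) = a * b * y)
  by (rewrite <- bal; ring).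
assert (E2 : q * (a' * a') * (u * (v * (w * (a * y)))) = a' * b * y)
  by (rewrite <- bal; ring).
rewrite <- E1 in H1; rewrite <- E2 in H2.
replace (a' * (y / q)) with (a' * y / q) by (field; auto).
replace (a * (y / q)) with (a * y / q) by (field; auto).
rewrite psi8_rec, (psi8_rec a') by trivial.
pose proof (psi6_sum a _ _ _ _ ha H1) as S1.
pose proof (psi6_sum a' _ _ _ _ ha' H2) as S2.
rewrite E1 in S1; rewrite E2 in S2.
set (s1 := psi6 a [u; v; w; a' * y]) in *.
set (s2 := psi6 a' [u; v; w; a * y]) in *.
set (p1 := psi8 a b [u; v; w; a' * y]); set (p2 := psi8 a' b [u; v; w; a * y]).
replace (q * a * b * (y / q)) with (a * b * y) by (field; auto).
replace (q * a' * b * (y / q)) with (a' * b * y) by (field; auto).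
replace (P (q * a * b * y)) with (P (a * b * y * q)) by (f_equal; ring).
replace (P (q * a' * b * y)) with (P (a' * b * y * q)) by (f_equal; ring).
match goal with |- ?K1 * P ?X1 * (_ * p1 - ?T1 * s1) - ?K2 * P ?X2 * (_ * p2 - ?T2 * s2) = _ =>
  assert (E : K1 * T1 * (P X1 * s1) = K2 * T2 * (P X2 * s2)) end.
{ rewrite S1, S2; unfold kfac.
  replace (q * a' * u * (a * y)) with (q * a * u * (a' * y)) by ring.
  replace (q * a' * v * (a * y)) with (q * a * v * (a' * y)) by ring.
  replace (q * a' * w * (a * y)) with (q * a * w * (a' * y)) by ring.
  field; auto. }
match goal with |- ?K1 * P ?X1 * (?Q1 - ?T1 * s1) - ?K2 * P ?X2 * (?Q2 - ?T2 * s2) = _ =>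
  replace (K1 * P X1 * (Q1 - T1 * s1) - K2 * P X2 * (Q2 - T2 * s2))
  with (K1 * P X1 * Q1 - K2 * P X2 * Q2 - (K1 * T1 * (P X1 * s1) - K2 * T2 * (P X2 * s2)))
  by ring end.
rewrite E, (qpochinf_succ (a * b * y)), (qpochinf_succ (a' * b * y)) by trivial.
field; auto.
Qed.

Lemma ndiff_extract (x : C) :
  (Cmod (q * a * b * x) < 1)%R -> (Cmod (q * a' * b * x) < 1)%R ->
  ndiff a a' b u v w x
  = P (q * a * b * x) * P (q * a' * b * x) * P (q * (a * a' / b) * x)
    * ndiff a a' b u v w 0.
Proof.
intros H1 H2.
assert (le : forall t n, (Cmod t < 1)%R -> (Cmod (t * q ^ n) < 1)%R).
{ intros t n Ht; rewrite Cmod_mult, Cmod_Cpow.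
  assert (Cmod q ^ n <= 1)%R by (rewrite <- (pow1 n); apply pow_incr; lra).
  assert (0 <= Cmod q ^ n)%R by (apply pow_le; lra).
  pose proof (Cmod_ge_0 t); nra. }
assert (E : forall n, ndiff a a' b u v w x
  = qpochn (q * a * b * x) q n * qpochn (q * a' * b * x) q n
    * qpochn (q * (a * a' / b) * x) q n * ndiff a a' b u v w (x * q ^ n)).
{ intros n; induction n as [|n IH]; simpl qpochn.
  - simpl; rewrite !Cmult_1_r; ring.
  - rewrite IH at 1; replace (x * q ^ n) with (x * q ^ S n / q) by (simpl; field; auto).
    rewrite ndiff_rec.
    + simpl (q ^ S n); field; auto.
    + replace (a * b * (x * q ^ S n)) with (q * a * b * x * q ^ n) by (simpl; ring); auto.
    + replace (a' * b * (x * q ^ S n)) with (q * a' * b * x * q ^ n) by (simpl; ring); auto. }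
assert (hx : Climit (fun n => x * q ^ n) 0) by now apply Climit_pow.
assert (hm : forall c, Climit (fun n => c * (x * q ^ n)) (c * 0)).
{ intros c; apply Climit_mult; trivial; apply Climit_const. }
assert (z0 : forall c, (Cmod (q * (q * (c * c) * (u * (v * (w * 0))))) < 1)%R).
{ intros c; replace (q * (q * (c * c) * (u * (v * (w * 0))))) with (RtoC 0) by ring.
  rewrite Cmod_0; lra. }
apply (Climit_unique (fun _ => ndiff a a' b u v w x)); [apply Climit_const|].
eapply Climit_ext; [intros n; symmetry; apply E|].
apply Climit_mult.
{ apply Climit_mult; [apply Climit_mult|]; now apply qpochinf_limit. }
unfold ndiff.
apply Climit_minus; apply Climit_mult;
  try (apply Climit_mult; [apply Climit_const|]; now apply Climit_qpochinf).
- replace (a' * 0) with (RtoC 0) by ring.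
  apply psi8_limit; trivial; try apply Climit_const; try apply z0.
  replace (RtoC 0) with (a' * 0) by ring; apply hm.
- replace (a * 0) with (RtoC 0) by ring.
  apply psi8_limit; trivial; try apply Climit_const; try apply z0.
  replace (RtoC 0) with (a * 0) by ring; apply hm.
Qed.

End Balanced.

Lemma psi6_sum_0 (a u v w : C) : a <> 0 ->
  psi6 a [u; v; w; RtoC 0]
  = P q * th a * (P (q * a * u * v) * P (q * a * u * w) * P (q * a * v * w)).
Proof.
intros ha.
assert (H : (Cmod (q * (a * a) * (u * (v * (w * 0)))) < 1)%R).
{ replace (q * (a * a) * (u * (v * (w * 0)))) with (RtoC 0) by ring.
  rewrite Cmod_0; lra. }
pose proof (psi6_sum a u v w 0 ha H) as S.
replace (q * (a * a) * (u * (v * (w * 0)))) with (RtoC 0) in S by ring.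
replace (q * a * u * 0) with (RtoC 0) in S by ring.
replace (q * a * v * 0) with (RtoC 0) in S by ring.
replace (q * a * w * 0) with (RtoC 0) in S by ring.
rewrite qpochinf_0, Cmult_1_l in S by trivial; rewrite S; ring.
Qed.

(** Here the balance is without q, since u/q or v/q supplies it. Both sides are expanded in the same
    two series at (u, v, w, 0), whose coefficients agree because a/b = 1/(a' u v w). The 6psi6 parts
    agree only after subtraction: (1 - a' u v)(1 - a' u w)/a' minus the same with a is (1/a' -
    1/a)(1 - b u), which makes them symmetric in u and v. *)
Lemma ndiff_shift (a a' b u v w : C) :
  a <> 0 -> a' <> 0 -> u <> 0 -> v <> 0 -> w <> 0 ->
  a * a' * (u * v * w) = b ->
  v * (1 - b * v) * ndiff a a' b (u / q) v w 0
  = u * (1 - b * u) * ndiff a a' b u (v / q) w 0.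
Proof.
intros ha ha' hu hv hw Eb.
assert (hb : b <> 0) by (rewrite <- Eb; repeat apply Cmult_neq_0; trivial).
unfold ndiff.
replace (a' * 0) with (RtoC 0) by ring; replace (a * 0) with (RtoC 0) by ring.
replace (q * a * b * 0) with (RtoC 0) by ring.
replace (q * a' * b * 0) with (RtoC 0) by ring.
rewrite qpochinf_0 by trivial.
assert (z0 : forall c, (Cmod (q * (c * c) * (u * (v * (w * 0)))) < 1)%R).
{ intros c; replace (q * (c * c) * (u * (v * (w * 0)))) with (RtoC 0) by ring.
  rewrite Cmod_0; lra. }
rewrite !psi8_rec_first, !psi8_rec_second by (trivial; apply z0).
rewrite !psi6_sum_0 by trivial.
set (m1 := psi8 a b [u; v; w; RtoC 0]); set (m2 := psi8 a' b [u; v; w; RtoC 0]).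
unfold kfac.
assert (K : forall c, P (q * c * (u / q) * v) = P (c * u * v)
  /\ P (q * c * (u / q) * w) = (1 - c * u * w) * P (q * c * u * w)
  /\ P (q * c * u * (v / q)) = P (c * u * v)
  /\ P (q * c * (v / q) * w) = (1 - c * v * w) * P (q * c * v * w)
  /\ (1 - c * u * v) * P (q * c * u * v) = P (c * u * v)).
{ intros c; repeat split.
  - f_equal; field; auto.
  - replace (q * c * (u / q) * w) with (c * u * w) by (field; auto).
    rewrite qpochinf_succ by trivial; do 2 f_equal; ring.
  - f_equal; field; auto.
  - replace (q * c * (v / q) * w) with (c * v * w) by (field; auto).
    rewrite qpochinf_succ by trivial; do 2 f_equal; ring.
  - rewrite (qpochinf_succ (c * u * v)) by trivial; do 2 f_equal; ring. }
destruct (K a) as (k1 & k2 & k3 & k4 & k5), (K a') as (j1 & j2 & j3 & j4 & j5).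
rewrite k1, k2, k3, k4, j1, j2, j3, j4, <- k5, <- j5.
set (t1 := th (a / b)); set (t2 := th (a' / b)).
rewrite <- Eb; field; auto.
Qed.

(* The value of [ndiff] at [x = 0], see [ndiff_value]. *)
Definition nval (a a' b u v w : C) : C :=
  th (a' / a) / a' * (P q * P q) * (th a * th a') * (th (/ u) * th (/ v) * th (/ w))
  * (P (q * b * u) * P (q * b * v) * P (q * b * w)).

Lemma nval_shift (a a' b u v w : C) : u <> 0 -> v <> 0 ->
  v * (1 - b * v) * nval a a' b (u / q) v w
  = u * (1 - b * u) * nval a a' b u (v / q) w.
Proof.
intros hu hv; unfold nval.
replace (/ (u / q)) with (q / u) by (field; auto).
replace (/ (v / q)) with (q / v) by (field; auto).
rewrite !theta_inv by trivial.
replace (q * b * (u / q)) with (b * u) by (field; auto).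
replace (q * b * (v / q)) with (b * v) by (field; auto).
rewrite (qpochinf_succ (b * u)), (qpochinf_succ (b * v)) by trivial.
replace (b * u * q) with (q * b * u) by ring.
replace (b * v * q) with (q * b * v) by ring.
replace (th u) with (- (u * th (/ u))) by (rewrite (theta_recip u q hq hu); ring).
replace (th v) with (- (v * th (/ v))) by (rewrite (theta_recip v q hq hv); ring).
unfold Cdiv; ring.
Qed.

Lemma theta_balance (a a' b c d e : C) :
  a <> 0 -> a' <> 0 -> b <> 0 -> c <> 0 -> d <> 0 -> e <> 0 ->
  q * a * a' = b * c * d * e ->
  th (a' / b) / a' * (th (b * e / a) * th (b * d / a)) * th (c / a)
  - th (a / b) / a * (th (b * e / a') * th (b * d / a')) * th (c / a')
  = th (a' / a) / a' * (th (c / b) * th d * th e).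
Proof.
intros ha ha' hb hc hd he bal.
assert (nz : forall x y : C, x <> 0 -> y <> 0 -> x / y <> 0).
{ intros x y hx hy; apply Cmult_neq_0; trivial; now apply Cinv_nz. }
assert (hbd : b * d <> 0) by now apply Cmult_neq_0.
assert (hde : d * e <> 0) by now apply Cmult_neq_0.
assert (hbde : b * d * e <> 0) by now apply Cmult_neq_0.
assert (Ec : c = q * a * a' / (b * d * e)) by (rewrite bal; field; auto).
(* This choice produces the twelve theta values of the claim, up to inversions and q-shifts, once c
   is expressed through the balance. *)
pose proof (theta_addition (d * e) (a' / b) (b * d * e / a) d hde
  (nz _ _ ha' hb) (nz _ _ hbde ha) hd) as W.
replace (d * e / d) with e in W by (field; auto).
replace (a' / b / (b * d * e / a)) with (c / b / q) in W
  by (rewrite Ec; field; repeat split; assumption).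
replace (d * e / (a' / b * (b * d * e / a))) with (/ (a' / a)) in W by (field; auto).
replace (d * e / (a' / b)) with (q / (c / a)) in W by (rewrite Ec; field; repeat split; assumption).
replace (b * d * e / a / d) with (b * e / a) in W by (field; auto).
replace (d * e / (b * d * e / a * d)) with (/ (b * d / a)) in W by (field; auto).
replace (d * e / (b * d * e / a)) with (a / b) in W by (field; auto).
replace (b * d * e / a) with (q / (c / a')) in W by (rewrite Ec; field; repeat split; assumption).
replace (d / (a' / b)) with (b * d / a') in W by (field; auto).
replace (d * e / (d * (a' / b))) with (b * e / a') in W by (field; auto).
rewrite !theta_inv in W by auto.
assert (R : forall x : C, x <> 0 -> th (/ x) = - (th x / x)).
{ intros x hx; pose proof (theta_recip x q hq hx) as E.
  replace (th (/ x)) with (x * th (/ x) / x) by (field; auto).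
  rewrite E; field; auto. }
pose proof (theta_mult_q (c / b / q) q hq (nz _ _ (nz _ _ hc hb) qnz)) as Q1.
replace (q * (c / b / q)) with (c / b) in Q1 by (field; auto).
rewrite (R (a' / a)), (R (b * d / a)) in W by auto.
replace (th (c / b / q)) with (- (c / b / q * th (c / b))) in W by (rewrite Q1; ring).
set (x1 := th (c / b)) in *; set (x2 := th (a' / a)) in *.
set (x3 := th (b * d / a)) in *; set (x4 := th (b * e / a)) in *.
set (x5 := th (c / a)) in *; set (x6 := th (c / a')) in *.
set (x7 := th (b * d / a')) in *; set (x8 := th (b * e / a')) in *.
set (x9 := th (a / b)) in *; set (y1 := th (a' / b)) in *.
match type of W with ?l = _ => match goal with |- ?g = ?h =>
  replace g with (h - b / (a * a') * l); [rewrite W; ring|] end end.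
rewrite Ec; field; repeat split; auto.
Qed.

Lemma psi6_pair_sum (a b d e : C) : a <> 0 -> b <> 0 -> d <> 0 -> e <> 0 ->
  (Cmod (q * a * / d * / e) < 1)%R ->
  psi6 a [/ b; b / a; / d; / e]
  = P q * P q * th a * (P (q / (b * d / a)) * P (q / (b * e / a)))
    * (P (q * b * / d) * P (q * b * / e)).
Proof.
intros ha hb hd he H.
assert (E : q * (a * a) * (/ b * (b / a * (/ d * / e))) = q * a * / d * / e)
  by (field; auto).
rewrite <- E in H; pose proof (psi6_sum a _ _ _ _ ha H) as S.
rewrite E in S; rewrite E in H.
assert (hP : P (q * a * / d * / e) <> 0) by now apply qpochinf_small_nz.
replace (q * a * / b * (b / a)) with q in S by (field; auto).
replace (q * a * / b * / d) with (q / (b * d / a)) in S by (field; auto).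
replace (q * a * / b * / e) with (q / (b * e / a)) in S by (field; auto).
replace (q * a * (b / a) * / d) with (q * b * / d) in S by (field; auto).
replace (q * a * (b / a) * / e) with (q * b * / e) in S by (field; auto).
set (s := psi6 a [/ b; b / a; / d; / e]) in *.
set (r := P (q * a * / d * / e)) in *.
replace s with (/ r * (r * s)) by (field; auto); rewrite S; field; auto.
Qed.

(** At x = c/(q a a') the last variables are c/(qa) and c/(qa'), so c cancels from both series at
    once. Each becomes a 6psi6 with the pair of b and the parameters d, e, of argument qa/(de) or
    qa'/(de), which accounts for the size conditions. [theta_balance] evaluates the difference;
    going back to x = 0 by [ndiff_extract] means dividing by [P (c / b)]. *)
Lemma ndiff_value_small (a a' b c d e : C) :
  a <> 0 -> a' <> 0 -> b <> 0 -> c <> 0 -> d <> 0 -> e <> 0 ->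
  q * a * a' = b * c * d * e ->
  (Cmod (q * a * / d * / e) < 1)%R -> (Cmod (q * a' * / d * / e) < 1)%R ->
  P (c / b) <> 0 ->
  ndiff a a' b (/ c) (/ d) (/ e) 0 = nval a a' b (/ c) (/ d) (/ e).
Proof.
intros ha ha' hb hc hd he bal H1 H2 hP.
assert (Ec : c = q * a * a' / (b * d * e)) by (rewrite bal; field; auto).
assert (bal' : q * a * a' * (/ c * / d * / e) = b) by (rewrite bal; field; auto).
set (x := c / (q * a * a')).
assert (E1 : q * a * b * x = q * a * / d * / e).
{ unfold x; rewrite Ec; field; repeat split; assumption. }
assert (E2 : q * a' * b * x = q * a' * / d * / e).
{ unfold x; rewrite Ec; field; repeat split; assumption. }
assert (E3 : q * (a * a' / b) * x = c / b) by (unfold x; field; auto).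
pose proof (ndiff_extract a a' b (/ c) (/ d) (/ e) ha ha' hb bal' x) as N.
rewrite E1, E2, E3 in N; specialize (N H1 H2).
set (r1 := P (q * a * / d * / e)) in *.
set (r2 := P (q * a' * / d * / e)) in *.
assert (h1 : r1 <> 0) by now apply qpochinf_small_nz.
assert (h2 : r2 <> 0) by now apply qpochinf_small_nz.
set (n0 := ndiff a a' b (/ c) (/ d) (/ e) 0) in *.
unfold ndiff in N; rewrite E1, E2 in N; fold r1 r2 in N.
replace (a' * x) with (c / (q * a)) in N by (unfold x; field; auto).
replace (a * x) with (c / (q * a')) in N by (unfold x; field; auto).
rewrite !psi8_reflect, !psi6_pair_sum in N by trivial.
unfold kfac in N.
replace (q * a' * / c * / d) with (b * e / a) in N
  by (rewrite Ec; field; repeat split; assumption).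
replace (q * a' * / c * / e) with (b * d / a) in N
  by (rewrite Ec; field; repeat split; assumption).
replace (q * a * / c * / d) with (b * e / a') in N
  by (rewrite Ec; field; repeat split; assumption).
replace (q * a * / c * / e) with (b * d / a') in N
  by (rewrite Ec; field; repeat split; assumption).
fold r1 r2 in N.
pose proof (theta_balance a a' b c d e ha ha' hb hc hd he bal) as B.
rewrite (theta_eq (b * e / a)), (theta_eq (b * d / a)),
  (theta_eq (b * e / a')), (theta_eq (b * d / a')), (theta_eq (c / b)) in B.
replace (q / (c / b)) with (q * b * / c) in B by (field; auto).
unfold nval.
replace (/ / c) with c by (field; auto).
replace (/ / d) with d by (field; auto).
replace (/ / e) with e by (field; auto).
set (y1 := P (b * e / a)) in *; set (y2 := P (b * d / a)) in *.
set (y3 := P (b * e / a')) in *; set (y4 := P (b * d / a')) in *.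
set (z1 := P (q / (b * e / a))) in *; set (z2 := P (q / (b * d / a))) in *.
set (z3 := P (q / (b * e / a'))) in *; set (z4 := P (q / (b * d / a'))) in *.
set (s := P (c / b)) in *.
set (t1 := th (a' / b)) in *; set (t2 := th (a / b)) in *.
set (t3 := th (c / a)) in *; set (t4 := th (c / a')) in *.
set (t5 := th (a' / a)) in *.
set (w := P q) in *; set (p1 := P (q * b * / c)) in *.
set (p2 := P (q * b * / d)) in *; set (p3 := P (q * b * / e)) in *.
set (g := r1 * r2 * (th c * (w * w) * th a * th a' * p2 * p3)).
match type of B with ?l = ?r => assert (Q : r1 * r2 * s * n0 = g * l) end.
{ rewrite <- N; unfold g; field; auto. }
rewrite B in Q.
replace n0 with (/ (r1 * r2 * s) * (r1 * r2 * s * n0)) by (field; auto).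
rewrite Q; unfold g; field; auto.
Qed.

(* The shift (c,d) -> (cq,d/q) leads to the domain of [ndiff_value_small]; it
   can be undone as long as no [c q^j] equals [b]. *)
Lemma ndiff_value_generic (a a' b e : C) (n : nat) :
  a <> 0 -> a' <> 0 -> b <> 0 -> e <> 0 ->
  forall c d : C, c <> 0 -> d <> 0 -> q * a * a' = b * c * d * e ->
  (Cmod (q * a * / d * / e * q ^ n) < 1)%R ->
  (Cmod (q * a' * / d * / e * q ^ n) < 1)%R ->
  P (c / b) <> 0 ->
  ndiff a a' b (/ c) (/ d) (/ e) 0 = nval a a' b (/ c) (/ d) (/ e).
Proof.
intros ha ha' hb he; induction n as [|n IH]; intros c d hc hd bal H1 H2 hP.
- replace (q * a * / d * / e * q ^ 0) with (q * a * / d * / e) in H1 by (simpl; ring).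
  replace (q * a' * / d * / e * q ^ 0) with (q * a' * / d * / e) in H2 by (simpl; ring).
  now apply ndiff_value_small.
- rewrite qpochinf_succ in hP by trivial.
  assert (hb1 : 1 - b * / c <> 0).
  { intros E; apply hP; replace (1 - c / b) with (- (c / b) * (1 - b * / c))
      by (field; auto); rewrite E; ring. }
  assert (hP' : P (c * q / b) <> 0).
  { replace (c * q / b) with (c / b * q) by (field; auto).
    intros E; apply hP; rewrite E; ring. }
  assert (hcq : c * q <> 0) by now apply Cmult_neq_0.
  assert (hdq : d / q <> 0) by (apply Cmult_neq_0; trivial; now apply Cinv_nz).
  assert (I : ndiff a a' b (/ (c * q)) (/ (d / q)) (/ e) 0
              = nval a a' b (/ (c * q)) (/ (d / q)) (/ e)).
  { apply IH; trivial.
    - rewrite bal; field; auto.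
    - replace (q * a * / (d / q) * / e * q ^ n) with (q * a * / d * / e * q ^ S n)
        by (simpl; field; auto); trivial.
    - replace (q * a' * / (d / q) * / e * q ^ n) with (q * a' * / d * / e * q ^ S n)
        by (simpl; field; auto); trivial. }
  assert (bal' : a * a' * (/ c * / (d / q) * / e) = b).
  { replace (a * a' * (/ c * / (d / q) * / e)) with (q * a * a' / (c * d * e))
      by (field; auto); rewrite bal; field; auto. }
  assert (hu : / c <> 0) by now apply Cinv_nz.
  assert (hv : / (d / q) <> 0) by now apply Cinv_nz.
  assert (hw : / e <> 0) by now apply Cinv_nz.
  (* With u = 1/c and v = q/d the left side contains the value at (cq, d/q), known by induction, and
     the right side the value at (c, d), whose coefficient u (1 - b u) is nonzero because c differs
     from b. *)
  pose proof (ndiff_shift a a' b _ _ _ ha ha' hu hv hw bal') as S1.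
  pose proof (nval_shift a a' b _ _ (/ e) hu hv) as S2.
  replace (/ c / q) with (/ (c * q)) in S1, S2 by (field; auto).
  replace (/ (d / q) / q) with (/ d) in S1, S2 by (field; auto).
  rewrite I, S2 in S1.
  assert (hk : / c * (1 - b * / c) <> 0) by now apply Cmult_neq_0.
  set (k := / c * (1 - b * / c)) in *.
  set (n1 := ndiff a a' b (/ c) (/ d) (/ e) 0) in *.
  set (n2 := nval a a' b (/ c) (/ d) (/ e)) in *.
  replace n1 with (/ k * (k * n1)) by (field; auto).
  rewrite <- S1; field; auto.
Qed.

(* The exceptional values [c = b q^(-j)] are reached by continuity along a curve
   on which [c d] is constant. *)
Lemma ndiff_value (a a' b c d e : C) :
  a <> 0 -> a' <> 0 -> b <> 0 -> c <> 0 -> d <> 0 -> e <> 0 ->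
  q * a * a' = b * c * d * e ->
  ndiff a a' b (/ c) (/ d) (/ e) 0 = nval a a' b (/ c) (/ d) (/ e).
Proof.
intros ha ha' hb hc hd he bal.
assert (hcb : c / b <> 0) by (apply Cmult_neq_0; trivial; now apply Cinv_nz).
(* The approximating parameters are c_n = t_n b and d_n = cd/c_n. The balance, which involves c and
   d only through cd, is kept, and [th (t n)] being nonzero gives the condition on [P (c_n / b)]. *)
destruct (theta_generic (c / b) hcb) as (t & Ht & Hn).
assert (G : forall n, ndiff a a' b (/ (t n * b)) (t n * b * (/ c * / d)) (/ e) 0
  = nval a a' b (/ (t n * b)) (t n * b * (/ c * / d)) (/ e)).
{ intros n; destruct (Hn n) as [t0 tn].
  set (cn := t n * b).
  assert (c0 : cn <> 0) by now apply Cmult_neq_0.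
  replace (cn * (/ c * / d)) with (/ (c * d / cn)) by (field; auto).
  set (dn := c * d / cn).
  assert (d0 : dn <> 0) by (repeat apply Cmult_neq_0; trivial; now apply Cinv_nz).
  assert (lim : forall z, exists N, forall m, (N <= m)%nat -> (Cmod (z * q ^ m) < 1)%R).
  { intros z; destruct (Climit_eventually _ _ 1 (Climit_pow z q q1) Rlt_0_1) as [N HN].
    exists N; intros m hm; specialize (HN m hm).
    now replace (z * q ^ m - 0) with (z * q ^ m) in HN by ring. }
  destruct (lim (q * a * / dn * / e)) as [N1 L1].
  destruct (lim (q * a' * / dn * / e)) as [N2 L2].
  apply (ndiff_value_generic a a' b e (N1 + N2)); trivial.
  - rewrite bal; unfold dn; field; auto.
  - apply L1; lia.
  - apply L2; lia.
  - replace (cn / b) with (t n) by (unfold cn; field; auto).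
    intros E; apply tn; rewrite theta_eq, E; ring. }
assert (L1 : Climit (fun n => / (t n * b)) (/ c)).
{ apply Climit_inv; trivial; replace c with (c / b * b) by (field; auto).
  apply Climit_mult; trivial; apply Climit_const. }
assert (L2 : Climit (fun n => t n * b * (/ c * / d)) (/ d)).
{ assert (E : c / b * b * (/ c * / d) = / d) by (field; auto).
  refine (eq_ind _ (Climit _) _ _ E); apply Climit_mult; [|apply Climit_const].
  apply Climit_mult; trivial; apply Climit_const. }
set (u := fun n => / (t n * b)) in *.
set (v := fun n => t n * b * (/ c * / d)) in *.
assert (cst : forall x y : C, x = y -> Climit (fun _ => x) y)
  by (intros x y ->; apply Climit_const).
assert (LP : forall (k : C) x l, Climit x l -> Climit (fun n => P (k * x n)) (P (k * l))).
{ intros k x l H; apply Climit_qpochinf; trivial.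
  apply Climit_mult; trivial; apply Climit_const. }
assert (uv : forall n, u n * v n = / c * / d).
{ intros n; destruct (Hn n) as [t0 _]; unfold u, v; field; auto. }
assert (LK : forall k, Climit (fun n => kfac k b (u n) (v n) (/ e)) (kfac k b (/ c) (/ d) (/ e))).
{ intros k; unfold kfac; apply Climit_mult; [apply Climit_const|].
  apply Climit_mult; [apply Climit_mult|].
  - apply Climit_ext with (fun _ => P (q * k * (/ c * / d))).
    + intros n; rewrite <- (uv n); f_equal; ring.
    + apply cst; f_equal; ring.
  - apply Climit_qpochinf; trivial; apply Climit_mult; [|apply Climit_const].
    apply Climit_mult; trivial; apply Climit_const.
  - apply Climit_qpochinf; trivial; apply Climit_mult; [|apply Climit_const].
    apply Climit_mult; trivial; apply Climit_const. }
assert (L8 : forall k k' : C, k <> 0 -> Climit (fun n => psi8 k b [u n; v n; / e; k' * 0])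
   (psi8 k b [/ c; / d; / e; k' * 0])).
{ intros k k' hk.
  apply (psi8_limit k b u v (fun _ => / e) (fun _ => k' * 0)); trivial;
    try apply Climit_const.
  replace (q * (q * (k * k) * (/ c * (/ d * (/ e * (k' * 0)))))) with (RtoC 0) by ring.
  rewrite Cmod_0; lra. }
apply (Climit_unique (fun n => ndiff a a' b (u n) (v n) (/ e) 0)).
- unfold ndiff; apply Climit_minus; (apply Climit_mult; [|now apply L8]);
    (apply Climit_mult; [apply LK | apply Climit_const]).
- eapply Climit_ext; [intros n; symmetry; apply G|]; unfold nval.
  assert (LT : forall x (l : C), l <> 0 -> Climit x l -> Climit (fun n => th (/ x n)) (th (/ l))).
  { intros x l hl H; apply Climit_theta; trivial; [now apply Cinv_nz|now apply Climit_inv]. }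
  apply Climit_mult.
  + apply Climit_mult; [apply Climit_const|].
    apply Climit_mult; [|apply Climit_const].
    apply Climit_mult; apply LT; trivial; now apply Cinv_nz.
  + apply Climit_mult; [|apply Climit_const].
    apply Climit_mult; now apply LP.
Qed.

(** * From q-shifted factorials to eps *)

Lemma qpochn_div_succ (x : C) (n : nat) :
  qpochn (x / q ^ S n) q (S n) = (1 - x / q ^ S n) * qpochn (x / q ^ n) q n.
Proof.
pose proof (Cpow_nz q n qnz).
replace (S n) with (1 + n)%nat at 2 by lia; rewrite qpochn_add; simpl.
replace (x / (q * q ^ n) * (q * 1)) with (x / q ^ n) by (field; auto).
ring.
Qed.

(** Both sides obey the same first-order recurrence and agree at k = 0. Going up divides by factors
    of (qa/x;q)_n, going down by factors of (x q^(-n);q)_n; these are the denominators assumed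
    nonzero. *)
Lemma qpoch_ratio_eps (a x : C) (k : Z) : x <> 0 ->
  (forall n, qpochn (q * a / x) q n <> 0 /\ qpochn (x / q ^ n) q n <> 0) ->
  qpoch x q k / qpoch (q * a / x) q k * (P (q / x) * P (q * a / x))
  = eps a (/ x) k * Cpowz (- x) k.
Proof.
intros hx H.
assert (hx' : - x <> 0).
{ intros E; apply hx; replace x with (- - x) by ring; rewrite E; ring. }
assert (F : forall k, (1 - q * a / x * Cpowz q k) * (eps a (/ x) (k + 1) * Cpowz (- x) (k + 1))
            = (1 - x * Cpowz q k) * (eps a (/ x) k * Cpowz (- x) k)).
{ intros j; rewrite Cpowz_succ by trivial.
  pose proof (eps_succ a (/ x) j) as E.
  set (e0 := eps a (/ x) j) in *; set (e1 := eps a (/ x) (j + 1)) in *.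
  set (u := Cpowz q j) in *; set (w := Cpowz (- x) j).
  replace ((1 - q * a / x * u) * (e1 * (w * - x)))
    with ((1 - q * a * / x * u) * e1 * (w * - x)) by (unfold Cdiv; ring).
  rewrite E; field; auto. }
assert (Z0 : eps a (/ x) 0 * Cpowz (- x) 0 = P (q / x) * P (q * a / x)).
{ unfold eps; change (tri 0) with 0%Z; simpl.
  replace (q * / x / 1) with (q / x) by (field; auto).
  replace (q * a * / x * 1) with (q * a / x) by (field; auto); ring. }
destruct (Z_nat_cases k) as [[n ->]|[n ->]].
- assert (Eq : forall y, qpoch y q (Z.of_nat n) = qpochn y q n).
  { intros y; destruct n; trivial; simpl Z.of_nat; unfold qpoch.
    now rewrite SuccNat2Pos.id_succ. }
  rewrite !Eq; clear Eq; induction n as [|n IH].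
  + rewrite <- Z0; simpl; field.
  + specialize (F (Z.of_nat n)).
    replace (Z.of_nat n + 1)%Z with (Z.of_nat (S n)) in F by lia.
    rewrite <- IH, Cpowz_of_nat in F.
    destruct (H (S n)) as [h _]; simpl qpochn in h |- *.
    destruct (H n) as [h' _].
    assert (h1 : 1 - q * a / x * q ^ n <> 0) by (intros E; apply h; rewrite E; ring).
    set (r := eps a (/ x) (Z.of_nat (S n)) * Cpowz (- x) (Z.of_nat (S n))) in *.
    set (g := 1 - q * a / x * q ^ n) in *.
    replace r with (/ g * (g * r)) by (field; auto).
    rewrite F; field; auto.
- set (D := fun y n => qpochn (y / q ^ n) q n).
  assert (Eq : forall y, qpoch y q (- Z.of_nat (S n)) = / D y (S n)).
  { intros y; unfold D; simpl Z.of_nat; simpl Z.opp; unfold qpoch.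
    now rewrite SuccNat2Pos.id_succ. }
  rewrite !Eq; clear Eq.
  (* For k < 0 the factorial of qa/x may have a pole, that is z = 0; with / 0 = 0 both sides are
     then 0, the true value. *)
  assert (Ev : forall y z : C, / y / / z = z / y).
  { intros y z; destruct (Ceq_dec z 0) as [->|hz].
    - rewrite Cinv_zero; unfold Cdiv; rewrite Cinv_zero; ring.
    - destruct (Ceq_dec y 0) as [->|hy].
      + unfold Cdiv; rewrite Cinv_zero; ring.
      + field; auto. }
  rewrite Ev.
  assert (HD : forall n, D x n <> 0) by (intros m; apply H).
  assert (G : forall m, D (q * a / x) m / D x m * (P (q / x) * P (q * a / x))
    = eps a (/ x) (- Z.of_nat m) * Cpowz (- x) (- Z.of_nat m)); [|apply G].
  intros m; induction m as [|m IH].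
  + change (- Z.of_nat 0)%Z with 0%Z; rewrite Z0; unfold D; simpl; field.
  + specialize (F (- Z.of_nat (S m))%Z).
    replace (- Z.of_nat (S m) + 1)%Z with (- Z.of_nat m)%Z in F by lia.
    rewrite <- IH, Cpowz_opp_of_nat in F.
    pose proof (HD (S m)) as h; pose proof (HD m) as h'.
    unfold D in h |- *; rewrite qpochn_div_succ in h |- *.
    rewrite (qpochn_div_succ x) in *; fold (D x m) (D (q * a / x) m) in *.
    set (r := eps a (/ x) (- Z.of_nat (S m)) * Cpowz (- x) (- Z.of_nat (S m))) in *.
    set (y := q * a / x) in *; set (v := q ^ S m) in *.
    replace (x * / v) with (x / v) in F by reflexivity.
    replace (y * / v) with (y / v) in F by reflexivity.
    assert (h1 : 1 - x / v <> 0) by (intros E; apply h; rewrite E; ring).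
    set (g := 1 - x / v) in *.
    replace r with (/ g * (g * r)) by (field; auto).
    pose proof (Cpow_nz q (S m) qnz) as hv; fold v in hv.
    rewrite <- F; field; auto.
Qed.

(** A vanishing infinite product has a vanishing factor, which already occurs in one of the finite
    denominators; (q/x) q^n = 1 means x/q^(n+1) = 1, hence the index n + 1. *)
Lemma nondegenerate_nz (a x : C) : x <> 0 ->
  (forall n, qpochn (q * a / x) q n <> 0 /\ qpochn (x / q ^ n) q n <> 0) ->
  P (q / x) <> 0 /\ P (q * a / x) <> 0.
Proof.
intros hx H; split; intros E; destruct (qpochinf_eq0 _ E) as [n Hn].
- destruct (H (S n)) as [_ h]; apply h; rewrite qpochn_div_succ.
  pose proof (Cpow_nz q n qnz).
  replace (x / q ^ S n) with (/ (q / x * q ^ n)) by (simpl; field; auto).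
  rewrite Hn; field.
- destruct (H (S n)) as [h _]; apply h; simpl; rewrite Hn; ring.
Qed.

(** The factor, independent of k, between the usual terms and those built from [eps]. *)
Definition psi8_norm (a : C) (l : list C) : C :=
  (1 - a) * Cprod (map (fun x => P (q / x) * P (q * a / x)) l).

Lemma Psi8_term_vwp (a a3 a4 a5 a6 a7 a8 z : C) (k : Z) :
  Psi8_nondegenerate a a3 a4 a5 a6 a7 a8 q ->
  (forall x, In x [a3; a4; a5; a6; a7; a8] -> x <> 0) -> z <> 0 ->
  psi8_norm a [a3; a4; a5; a6; a7; a8] * Psi8_term a a3 a4 a5 a6 a7 a8 q z k
  = vwp a (a3 * a4 * a5 * a6 * a7 * a8 * z)
      [/ a3; / a4; / a5; / a6; / a7; / a8] k.
Proof.
intros [h1 H] nz hz.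
assert (R : forall x, In x [a3; a4; a5; a6; a7; a8] ->
  qpoch x q k / qpoch (q * a / x) q k * (P (q / x) * P (q * a / x))
  = eps a (/ x) k * Cpowz (- x) k).
{ intros x hx; apply qpoch_ratio_eps; [now apply nz | intros n; now apply H]. }
assert (E : a3 * a4 * a5 * a6 * a7 * a8 * z
  = - a3 * (- a4 * (- a5 * (- a6 * (- a7 * (- a8 * z)))))) by ring.
assert (on : forall x, In x [a3; a4; a5; a6; a7; a8] -> - x <> 0).
{ intros x hx E0; apply (nz x hx); replace x with (- - x) by ring; rewrite E0; ring. }
assert (i3 : In a3 [a3; a4; a5; a6; a7; a8]) by (simpl; tauto).
assert (i4 : In a4 [a3; a4; a5; a6; a7; a8]) by (simpl; tauto).
assert (i5 : In a5 [a3; a4; a5; a6; a7; a8]) by (simpl; tauto).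
assert (i6 : In a6 [a3; a4; a5; a6; a7; a8]) by (simpl; tauto).
assert (i7 : In a7 [a3; a4; a5; a6; a7; a8]) by (simpl; tauto).
assert (i8 : In a8 [a3; a4; a5; a6; a7; a8]) by (simpl; tauto).
unfold psi8_norm, Psi8_term, vwp, eprod; rewrite E.
rewrite !Cpowz_mult by (repeat apply Cmult_neq_0; auto).
replace (2 * k)%Z with (k + k)%Z by ring; rewrite Cpowz_add by trivial.
simpl map; unfold Cprod; simpl fold_right.
pose proof (R a3 i3) as r3; pose proof (R a4 i4) as r4; pose proof (R a5 i5) as r5.
pose proof (R a6 i6) as r6; pose proof (R a7 i7) as r7; pose proof (R a8 i8) as r8.
clear R.
set (p3 := P (q / a3) * P (q * a / a3)) in *; set (p4 := P (q / a4) * P (q * a / a4)) in *.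
set (p5 := P (q / a5) * P (q * a / a5)) in *; set (p6 := P (q / a6) * P (q * a / a6)) in *.
set (p7 := P (q / a7) * P (q * a / a7)) in *; set (p8 := P (q / a8) * P (q * a / a8)) in *.
set (s3 := qpoch a3 q k / qpoch (q * a / a3) q k) in *.
set (s4 := qpoch a4 q k / qpoch (q * a / a4) q k) in *.
set (s5 := qpoch a5 q k / qpoch (q * a / a5) q k) in *.
set (s6 := qpoch a6 q k / qpoch (q * a / a6) q k) in *.
set (s7 := qpoch a7 q k / qpoch (q * a / a7) q k) in *.
set (s8 := qpoch a8 q k / qpoch (q * a / a8) q k) in *.
transitivity ((1 - a * (Cpowz q k * Cpowz q k)) * Cpowz z k
   * ((s3 * p3) * (s4 * p4) * (s5 * p5) * (s6 * p6) * (s7 * p7) * (s8 * p8))).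
- field; auto.
- rewrite r3, r4, r5, r6, r7, r8; ring.
Qed.

Lemma Psi8_vwp (a a3 a4 a5 a6 a7 a8 z Z s : C) :
  Psi8_nondegenerate a a3 a4 a5 a6 a7 a8 q ->
  (forall x, In x [a3; a4; a5; a6; a7; a8] -> x <> 0) -> z <> 0 ->
  a3 * a4 * a5 * a6 * a7 * a8 * z = Z ->
  is_bilateral (vwp a Z [/ a3; / a4; / a5; / a6; / a7; / a8]) s ->
  ex_Psi8 a a3 a4 a5 a6 a7 a8 q z /\
  psi8_norm a [a3; a4; a5; a6; a7; a8] * Psi8 a a3 a4 a5 a6 a7 a8 q z = s.
Proof.
intros ND nz hz <- B.
assert (hn : psi8_norm a [a3; a4; a5; a6; a7; a8] <> 0).
{ destruct ND as [h1 H]; unfold psi8_norm; apply Cmult_neq_0; trivial.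
  revert nz H; generalize [a3; a4; a5; a6; a7; a8]; intros l.
  induction l as [|x l IH]; intros nz H; simpl; [apply C1_nz|].
  apply Cmult_neq_0.
  - destruct (nondegenerate_nz a x) as [n1 n2]; [apply nz; now left | apply H; now left |].
    now apply Cmult_neq_0.
  - apply IH; [intros y hy; apply nz; now right | intros y hy; apply H; now right]. }
set (n := psi8_norm a [a3; a4; a5; a6; a7; a8]) in *.
assert (B' : is_bilateral (Psi8_term a a3 a4 a5 a6 a7 a8 q z) (/ n * s)).
{ eapply is_bilateral_ext; [|exact (is_bilateral_scal (/ n) _ _ B)].
  intros k; cbv beta; rewrite <- Psi8_term_vwp by trivial; fold n; field; auto. }
split; [eapply is_bilateral_ex; exact B'|].
unfold Psi8; rewrite (is_bilateral_unique _ _ B'); field; auto.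
Qed.

End Sums.

(** * The transformation formula *)

(** Applied to both series. [g] and [z] are separate variables because in the second series the
    partner of b and the argument appear in simplified form, as cde/(qa) and qb/f. *)
Lemma Psi8_psi8 (q a b c d e f g z : C) : (0 < Cmod q < 1)%R ->
  a <> 0 -> b <> 0 -> c <> 0 -> d <> 0 -> e <> 0 -> f <> 0 -> g = a / b ->
  z = q ^ 2 * a ^ 2 / (c * d * e * f) -> (Cmod z < 1)%R ->
  Psi8_nondegenerate a b c d e f g q ->
  ex_Psi8 a b c d e f g q z /\
  psi8_norm q a [b; c; d; e; f; g] * Psi8 a b c d e f g q z
  = psi8 q a b [/ c; / d; / e; / f].
Proof.
intros hq ha hb hc hd he hf -> Ez hz ND.
assert (qnz : q <> 0) by now apply Cmod_gt_0.
assert (hab : a / b <> 0) by (apply Cmult_neq_0; trivial; now apply Cinv_nz).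
assert (E : b * c * d * e * f * (a / b) * z = q * q * (a * a * a))
  by (rewrite Ez; simpl; field; auto).
assert (hz0 : z <> 0).
{ rewrite Ez; simpl; apply Cmult_neq_0;
    [|apply Cinv_nz]; repeat apply Cmult_neq_0; trivial; apply C1_nz. }
apply (Psi8_vwp q hq a b c d e f (a / b) z (q * q * (a * a * a))); trivial.
- intros x [<-|[<-|[<-|[<-|[<-|[<-|[]]]]]]]; trivial.
- apply (is_bilateral_ext (vwp q a (q * q * (a * a * a)) [/ b; b / a; / c; / d; / e; / f])).
  + intros k; apply vwp_perm.
    replace (/ (a / b)) with (b / a) by (field; auto).
    apply perm_skip, (Permutation_cons_app [/ c; / d; / e; / f] []); reflexivity.
  + apply psi8_is_bilateral; trivial.
    replace (q * (q * (a * a) * (/ c * (/ d * (/ e * / f))))) with z; trivial.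
    rewrite Ez; simpl; field; auto.
Qed.

Theorem corollary3p16 (q a b c d e f : C)
  (hq : (0 < Cmod q < 1)%R)
  (ha : a <> 0) (hb : b <> 0) (hc : c <> 0)
  (hd : d <> 0) (he : e <> 0) (hf : f <> 0)
  (hz1 : (Cmod (q ^ 2 * a ^ 2) < Cmod (c * d * e * f))%R)
  (hz2 : (Cmod (q * b) < Cmod f)%R)
  (hlhs : Psi8_nondegenerate a b c d e f (a / b) q)
  (hrhs : Psi8_nondegenerate (b * c * d * e / (q * a)) b c d e
            (b * c * d * e * f / (q * a ^ 2)) (c * d * e / (q * a)) q)
  (hden1 : qpochsinf [q / f; q * b / a; q * a / c; q * a / d; q * a / e;
                      b * c / a; b * d / a; b * e / a;
                      q * a / (c * d * e); b * c * d * e / a;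
                      q ^ 2 * a / (b * c * d * e);
                      q ^ 2 * a ^ 2 / (c * d * e * f)] q <> 0)
  (hden2 : qpochsinf [q * b; q / b; q / f; q * b / a; q * a / b;
                      q * a / c; q * a / d; q * a / e; q * a / f;
                      b * c / a; b * d / a; b * e / a] q
           * theta (c * d * e / (q * a)) q <> 0) :
  ex_Psi8 a b c d e f (a / b) q (q ^ 2 * a ^ 2 / (c * d * e * f)) /\
  ex_Psi8 (b * c * d * e / (q * a)) b c d e
    (b * c * d * e * f / (q * a ^ 2)) (c * d * e / (q * a)) q (q * b / f) /\
  Psi8 a b c d e f (a / b) q (q ^ 2 * a ^ 2 / (c * d * e * f)) =
    qpochsinf [q * a; q / a; b / a; q * b / f;
               q * a / (c * d); q * a / (c * e); q * a / (d * e);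
               b * c * d / a; b * c * e / a; b * d * e / a;
               q ^ 2 * a / (c * d * e);
               q ^ 2 * a ^ 2 / (b * c * d * e * f)] q
    / qpochsinf [q / f; q * b / a; q * a / c; q * a / d; q * a / e;
                 b * c / a; b * d / a; b * e / a;
                 q * a / (c * d * e); b * c * d * e / a;
                 q ^ 2 * a / (b * c * d * e);
                 q ^ 2 * a ^ 2 / (c * d * e * f)] q
    * Psi8 (b * c * d * e / (q * a)) b c d e
        (b * c * d * e * f / (q * a ^ 2)) (c * d * e / (q * a)) q (q * b / f)
    + qpochsinf [q; q; q * a; q / a; c; d; e; q * b / c; q * b / d; q * b / e;
                 q * b / f; q * a / (b * f)] q
      * theta (b * c * d * e / (q * a ^ 2)) q
      / (qpochsinf [q * b; q / b; q / f; q * b / a; q * a / b;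
                    q * a / c; q * a / d; q * a / e; q * a / f;
                    b * c / a; b * d / a; b * e / a] q
         * theta (c * d * e / (q * a)) q).
Proof.
assert (qnz : q <> 0) by now apply Cmod_gt_0.
assert (q1 : (Cmod q < 1)%R) by apply hq.
(* [A] is the a' of [ndiff]. With [F] in the place of f, the second series has the shape of the
   first: cde/(qa) = A/b and qb/f = q^2 A^2/(cdeF). *)
set (A := b * c * d * e / (q * a)) in *.
set (F := b * c * d * e * f / (q * a ^ 2)) in *.
set (z1 := q ^ 2 * a ^ 2 / (c * d * e * f)) in *.
set (z2 := q * b / f) in *.
assert (hA : A <> 0).
{ apply Cmult_neq_0; [|apply Cinv_nz]; repeat apply Cmult_neq_0; trivial. }
assert (hF : F <> 0).
{ apply Cmult_neq_0; [|apply Cinv_nz]; simpl; repeat apply Cmult_neq_0; trivial;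
    apply C1_nz. }
assert (ratio : forall x y : C, y <> 0 -> (Cmod x < Cmod y)%R -> (Cmod (x / y) < 1)%R).
{ intros x y hy H; pose proof (proj1 (Cmod_gt_0 y) hy) as y0.
  rewrite Cmod_div by trivial; apply (Rmult_lt_reg_r (Cmod y)); trivial.
  unfold Rdiv; rewrite Rmult_assoc, Rinv_l; lra. }
assert (B1 : (Cmod z1 < 1)%R).
{ apply ratio; trivial; repeat apply Cmult_neq_0; trivial. }
assert (B2 : (Cmod z2 < 1)%R) by now apply ratio.
assert (Eg : c * d * e / (q * a) = A / b) by (unfold A; field; auto).
assert (Ez2 : z2 = q ^ 2 * A ^ 2 / (c * d * e * F)).
{ unfold z2, A, F; simpl; field; repeat split; auto. }
destruct (Psi8_psi8 q a b c d e f (a / b) z1 hq ha hb hc hd he hf eq_refl eq_refl B1 hlhs)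
  as [X1 N1].
destruct (Psi8_psi8 q A b c d e F (c * d * e / (q * a)) z2 hq hA hb hc hd he hF Eg Ez2 B2 hrhs)
  as [X2 N2].
split; [exact X1|split; [exact X2|]].
assert (bal : q * a * A = b * c * d * e) by (unfold A; field; auto).
assert (bal' : q * a * A * (/ c * / d * / e) = b) by (rewrite bal; field; auto).
(* This gives A x = 1/f and a x = 1/F, and the two conditions of [ndiff_extract] become |z1| < 1 and
   |z2| < 1. *)
set (x := / (A * f)).
pose proof (ndiff_extract q hq a A b (/ c) (/ d) (/ e) ha hA hb bal' x) as D.
rewrite (ndiff_value q hq a A b c d e ha hA hb hc hd he bal) in D.
assert (Ex1 : q * a * b * x = z1).
{ unfold x, z1, A; simpl; field; repeat split; auto. }
assert (Ex2 : q * A * b * x = z2) by (unfold x, z2; field; auto).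
unfold ndiff in D; rewrite Ex1, Ex2 in D; specialize (D B1 B2).
replace (A * x) with (/ f) in D by (unfold x; field; auto).
replace (a * x) with (/ F) in D.
2:{ unfold x, F, A; simpl; field; repeat split; auto. }
rewrite <- N1, <- N2 in D.
replace (q * (a * A / b) * x) with (q * a / (b * f)) in D by (unfold x; field; auto).
destruct hlhs as [na Hl]; destruct hrhs as [nA Hr].
(* The products (q/c, q/d, q/e;q)_oo occur in [psi8_norm] and in the thetas of [nval]. They cancel
   from the final formula, but isolating the first series divides by them. *)
assert (nc : qpochinf (q / c) q <> 0)
  by (apply (nondegenerate_nz q hq a c hc); apply Hl; simpl; tauto).
assert (nd : qpochinf (q / d) q <> 0)
  by (apply (nondegenerate_nz q hq a d hd); apply Hl; simpl; tauto).
assert (ne : qpochinf (q / e) q <> 0)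
  by (apply (nondegenerate_nz q hq a e he); apply Hl; simpl; tauto).
clear Hl Hr X1 X2 N1 N2 Ex1 Ex2 x bal bal'.
set (X := Psi8 a b c d e f (a / b) q z1) in *.
set (Y := Psi8 A b c d e F (c * d * e / (q * a)) q z2) in *.
pose proof (qpochsinf_nz _ _ hden1) as M1.
assert (hth : theta (c * d * e / (q * a)) q <> 0).
{ intros E; apply hden2; rewrite E; ring. }
assert (M2 := fun x => fun H => qpochsinf_nz _ q
  (fun E => hden2 (eq_trans (f_equal (fun y => y * _) E) (Cmult_0_l _))) x H).
assert (qn : forall x y : C, x = y -> qpochinf x q = qpochinf y q) by (intros ? ? ->; trivial).
set (t := c * d * e / (q * a)) in *.
assert (ht : t <> 0) by (apply Cmult_neq_0; [|apply Cinv_nz]; repeat apply Cmult_neq_0; trivial).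
assert (EA : A = b * t) by (unfold A, t; field; auto).
assert (Et : q * a / (c * d * e) = / t) by (unfold t; field; auto).
unfold psi8_norm, kfac, nval in D; simpl map in D; unfold Cprod in D; simpl fold_right in D.
rewrite Et in *.
(* Every argument is brought to the form it has in the statement, so that each infinite product can
   become one atom. *)
rewrite (qn (q / (a / b)) (q * b / a)), (qn (q * a / (a / b)) (q * b)),
  (qn (q * A / b) (q * t)), (qn (q * A / c) (b * d * e / a)),
  (qn (q * A / d) (b * c * e / a)), (qn (q * A / e) (b * c * d / a)),
  (qn (q / F) (q ^ 2 * a ^ 2 / (b * c * d * e * f))), (qn (q * A / F) (q * a / f)),
  (qn (q / t) (q ^ 2 * a / (c * d * e))), (qn (q * A / t) (q * b)),
  (qn (q * A * / c * / d) (b * e / a)), (qn (q * A * / c * / e) (b * d / a)),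
  (qn (q * A * / d * / e) (b * c / a)),
  (qn (q * a * / c * / d) (q * a / (c * d))), (qn (q * a * / c * / e) (q * a / (c * e))),
  (qn (q * a * / d * / e) (q * a / (d * e))),
  (qn (q * b * / c) (q * b / c)), (qn (q * b * / d) (q * b / d)),
  (qn (q * b * / e) (q * b / e)) in D
  by (unfold F, A, t; simpl; field; repeat split; auto).
replace (/ / c) with c in D by (field; auto).
replace (/ / d) with d in D by (field; auto).
replace (/ / e) with e in D by (field; auto).
replace (A / b) with t in D.
replace (A / a) with (b * c * d * e / (q * a ^ 2)) in D by (unfold A; simpl; field; auto).
rewrite (theta_eq A), (theta_eq (a / b)), (theta_eq a), (theta_eq c), (theta_eq d),
  (theta_eq e) in D.
rewrite (qpochinf_succ A q q1), (qpochinf_succ a q q1), (qpochinf_succ (a / b) q q1) in D.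
rewrite (qn (A * q) (b * c * d * e / a)), (qn (a * q) (q * a)), (qn (a / b * q) (q * a / b)),
  (qn (q / (a / b)) (q * b / a)), (qn (q / A) (q ^ 2 * a / (b * c * d * e))) in D
  by (unfold A; simpl; field; repeat split; auto).
(* Products that differ by their first factor, as those at 1/t and q/t or at b/a and qb/a, are
   expressed through the same atom. *)
assert (ET : theta t q = (1 - t) * qpochinf (q * t) q * qpochinf (q ^ 2 * a / (c * d * e)) q).
{ rewrite theta_eq, (qpochinf_succ t q q1), (qn (t * q) (q * t)) by ring.
  rewrite (qn (q / t) (q ^ 2 * a / (c * d * e))); [trivial|].
  unfold t; simpl; field; repeat split; auto. }
assert (Es : qpochinf (/ t) q = (1 - / t) * qpochinf (q ^ 2 * a / (c * d * e)) q).
{ rewrite (qpochinf_succ (/ t) q q1); f_equal; apply qn; unfold t; simpl; field; auto. }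
assert (Eb : qpochinf (b / a) q = (1 - b / a) * qpochinf (q * b / a) q).
{ rewrite (qpochinf_succ (b / a) q q1); f_equal; apply qn; field; auto. }
assert (h : forall x y : C, x * y <> 0 -> y <> 0) by (intros x y H E; apply H; rewrite E; ring).
cbv beta iota delta [qpochsinf Cprod map fold_right].
rewrite ET in D, hth |- *; rewrite Es, Eb.

assert (h1t : 1 - t <> 0) by (intros E; apply hth; rewrite E; ring).
assert (h2t : qpochinf (q * t) q <> 0) by (intros E; apply hth; rewrite E; ring).
assert (h3t : qpochinf (q ^ 2 * a / (c * d * e)) q <> 0)
  by (intros E; apply hth; rewrite E; ring).
assert (hP : qpochinf q q <> 0) by now apply qpochinf_small_nz.
assert (hA1 : 1 - A <> 0) by exact nA.
assert (k1 := M2 (q * b) ltac:(simpl; tauto)); assert (k2 := M2 (q / b) ltac:(simpl; tauto)).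
assert (k3 := M2 (q / f) ltac:(simpl; tauto)); assert (k4 := M2 (q * b / a) ltac:(simpl; tauto)).
assert (k5 := M2 (q * a / b) ltac:(simpl; tauto)); assert (k6 := M2 (q * a / c) ltac:(simpl; tauto)).
assert (k7 := M2 (q * a / d) ltac:(simpl; tauto)); assert (k8 := M2 (q * a / e) ltac:(simpl; tauto)).
assert (k9 := M2 (q * a / f) ltac:(simpl; tauto)); assert (l1 := M2 (b * c / a) ltac:(simpl; tauto)).
assert (l2 := M2 (b * d / a) ltac:(simpl; tauto)); assert (l3 := M2 (b * e / a) ltac:(simpl; tauto)).
assert (l4 := M1 (b * c * d * e / a) ltac:(simpl; tauto)).
assert (l5 := M1 (q ^ 2 * a / (b * c * d * e)) ltac:(simpl; tauto)).
assert (l6 := M1 z1 ltac:(simpl; tauto)).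
clear M1 M2 hden1 hden2 hth ET Es Eb qn h ratio Et Ez2 Eg nA.
clearbody X Y.
(* With the products replaced by independent variables and A by b t, the relation D is linear in the
   first series; solving it for [X] leaves a rational identity. *)
revert D nc nd ne h2t h3t hP k1 k2 k3 k4 k5 k6 k7 k8 k9 l1 l2 l3 l4 l5 l6.
generalize (qpochinf (q * t) q) (qpochinf (q ^ 2 * a / (c * d * e)) q) (qpochinf q q)
  (qpochinf (q * b) q) (qpochinf (q / b) q) (qpochinf (q / f) q) (qpochinf (q * b / a) q)
  (qpochinf (q * a / b) q) (qpochinf (q * a / c) q) (qpochinf (q * a / d) q)
  (qpochinf (q * a / e) q) (qpochinf (q * a / f) q) (qpochinf (b * c / a) q)
  (qpochinf (b * d / a) q) (qpochinf (b * e / a) q) (qpochinf (b * c * d * e / a) q)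
  (qpochinf (q ^ 2 * a / (b * c * d * e)) q) (qpochinf z1 q) (qpochinf z2 q)
  (qpochinf (q / c) q) (qpochinf (q / d) q) (qpochinf (q / e) q)
  (qpochinf (q * a) q) (qpochinf (q / a) q) (qpochinf c q) (qpochinf d q) (qpochinf e q)
  (qpochinf (q * b / c) q) (qpochinf (q * b / d) q) (qpochinf (q * b / e) q)
  (qpochinf (q * a / (b * f)) q) (qpochinf (q * a / (c * d)) q)
  (qpochinf (q * a / (c * e)) q) (qpochinf (q * a / (d * e)) q)
  (qpochinf (b * c * d / a) q) (qpochinf (b * c * e / a) q) (qpochinf (b * d * e / a) q)
  (qpochinf (q ^ 2 * a ^ 2 / (b * c * d * e * f)) q)
  (theta (b * c * d * e / (q * a ^ 2)) q).
revert hA hA1 EA ht h1t; generalize t A; intros t' A' hA hA1 EA ht h1t; subst A'.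
intros.
match type of D with ?k1 * (?n1 * X) - ?k2 * (?n2 * Y) = ?v =>
  replace X with ((v + k2 * (n2 * Y)) / (k1 * n1)) end.
2:{ rewrite <- D; field; repeat split; assumption. }
clear D; field; repeat split; try assumption.
intros E; apply h1t; replace (1 - t') with (- (t' - 1)) by ring; rewrite E; ring.
Qed.
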